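(* Let $p$ be a natural number ($p=0$ included) and let $F$ be a given function of order $O(R^{-3})$. Let $(\Phi_{\underline\psi},\Phi_\psi,\Phi_A)$ be a solution, in the compactified hyperboloidal coordinates $(t,r,\bar\theta,\bar\phi)$ described in the context, of the first-order form of the ugly equation in flat space, $$\frac{1}{R^{p+1}}\nabla_\psi\big[R^p\Phi_{\underline\psi}\big]-\frac1R\,D^A\Phi_A=\frac{\cot\theta}{R^3}\Phi_\theta-\frac{p}{R^3}\Phi_\psi-F,$$ $$\frac{1}{R^2}\nabla_{\underline\psi}\Phi_\psi-\frac1R\,D^A\Phi_A+\frac{p}{R^2}\Phi_{\underline\psi}=\frac{\cot\theta}{R^3}\Phi_\theta-\frac{p+1}{R^3}\Phi_\psi-F,$$ $$2\nabla_T\Phi_A-D_A\Phi_{\underline\psi}-\frac1R\,D_A\Phi_\psi=0 .$$ Define the energy on the hyperboloidal slice $\Sigma_t$ by $$E^2(t)=\int_{\Sigma_t}\left(\frac{1}{2R'R^2}\Phi_{\underline\psi}^2+\frac{2R'-1}{2R'R^4}\Phi_\psi^2+\frac{1}{R^4}\Phi_{\bar\theta}^2+\frac{1}{R^4\sin^2\bar\theta}\Phi_{\bar\phi}^2\right)dV .$$ Let $\mathcal R$ be the spacetime region bounded by the initial hyperboloidal slice $\Sigma_0$, the later slice $\Sigma_t$, the boundary $\Sigma_R=\{r=r_0\}$ of a world-tube, and null infinity $\mathscr I^+=\{r=r_{\mathscr I}\}$. Then, for a positive constant $C$, $$E^2(t)+\int_{\mathcal R}\frac{p}{R^3}\Big(\Phi_{\underline\psi}+\frac{\Phi_\psi}{R}\Big)^2dV\,dt+\frac12\int_{\mathscr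 I^+}\Phi_{\underline\psi}^2\,d\Omega\,dt+\frac12\int_{\Sigma_R}\frac{\Phi_\psi^2}{R^2}\,d\Omega\,dt$$ $$\le\left(E^2(0)+\frac12\int_{\Sigma_R}\Phi_{\underline\psi}^2\,d\Omega\,dt+\int_{\mathcal R}R^2F^2\,dV\,dt\right)e^{Ct}.$$ Setting $p=F=0$ reduces this to an estimate for the standard wave equation.
   Context: Minkowski spacetime has inertial time $T$, radius $R$ and spherical angles $\theta^A=(\theta,\varphi)$. The null vector fields are $\psi=\partial_T+\partial_R$ and $\underline\psi=\partial_T-\partial_R$, and $\nabla_\psi,\nabla_{\underline\psi},\nabla_T$ act on functions and on each component $\Phi_A$ as $\partial_T+\partial_R$, $\partial_T-\partial_R$, $\partial_T$. $D_A$ denotes the angular coordinate derivative $\partial_A$, and its index is raised with the angular part of the inverse flat metric, so that $D^A\Phi_A=\frac{1}{R^2}\big(\partial_\theta\Phi_\theta+\frac{1}{\sin^2\theta}\partial_\varphi\Phi_\varphi\big)$. The ugly equation is $\square\phi=\frac{2p}{R}\nabla_T\phi+F$, with $\square=-\partial_T^2+\partial_R^2+\frac2R\partial_R+\frac{1}{R^2}\Delta_{S^2}$. Its first-order reduction uses the rescaled variables $\Phi=R\phi$, $\Phi_\psi=R\nabla_\psi\Phi$, $\Phi_{\underline\psi}=\nabla_{\underline\psi}\Phi$, $\Phi_A=D_A\Phi$, of which $\Phi_{\underline\psi},\Phi_\psi,\Phi_A$ are treated as the unknowns of the system in the claim. The compactified coordinates $(t,r,\bar\theta,\bar\phi)$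 are defined by $T=t+H(R(r))$, $R=R(r)$, $\bar\theta=\theta$, $\bar\phi=\varphi$, where the compression function $R(r)$ satisfies $R'(r)\simeq R^n$ asymptotically, with $R'=dR/dr$ and $1<n\le2$. The height function $H$ satisfies $dH/dR=1-\frac{1}{R'}$, which makes the outgoing radial coordinate light speed equal to $1$. The value of $r$ at which $R\to\infty$ is $r_{\mathscr I}$, which is finite. In these coordinates $\nabla_T=\partial_t$, $\nabla_\psi=\frac{1}{R'}(\partial_t+\partial_r)$ and $\nabla_{\underline\psi}=\frac{2R'-1}{R'}\partial_t-\frac{1}{R'}\partial_r$. The slices $\Sigma_t$ of constant $t$ (with $r_0\le r<r_{\mathscr I}$) are hyperboloidal: everywhere spacelike and intersecting null infinity. The measures are $dV=R'R^2\,dr\,d\Omega$ and $d\Omega=\sin\bar\theta\,d\bar\theta\,d\bar\phi$. *)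

(* Defs.v *)
From mathcomp Require Import all_boot all_order all_algebra.
From mathcomp Require Import all_classical all_reals all_analysis.
Set Implicit Arguments.
Unset Strict Implicit.
Unset Printing Implicit Defensive.
Import Order.TTheory GRing.Theory Num.Theory.
Import numFieldNormedType.Exports.
Local Open Scope classical_set_scope.
Local Open Scope ring_scope.

(* Points are written in the compactified coordinates (t, r, theta, phi);
   scalars and coordinate components of one-forms are functions of these. *)
Definition stfun (R : realType) := R -> R -> R -> R -> R.

Definition joint (R : realType) (f : stfun R) : (R * R * R * R)%type -> R :=
  fun x => f x.1.1.1 x.1.1.2 x.1.2 x.2.

(* [Rc] is the compression function R(r), [H] the height function, so that
   T = t + H (Rc r).  [R' ~ R^n] is read as a two-sided bound near [rI], which
   covers asymptotic equality up to any positive factor.  The slice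
   T = t + H(R) is spacelike iff |dH/dR| < 1; this forces R' > 1/2.  It meets
   null infinity since T - R = t - r + const there. *)
Record hyperboloidal (R : realType) (n r0 rI : R) (Rc H : R -> R) : Prop := {
  hyp_lt : r0 < rI ;
  hyp_pos : 0 < Rc r0 ;
  hyp_derivable : forall r, r0 <= r < rI -> derivable Rc r 1 ;
  hyp_C1 : {within `[r0, rI[, continuous (derive1 Rc)} ;
  hyp_infinity : Rc r @[r --> rI^'-] --> +oo ;
  hyp_rate : exists c1 c2 : R, [/\ 0 < c1, 0 < c2 &
    \forall r \near rI^'-,
      c1 * (Rc r `^ n) <= derive1 Rc r <= c2 * (Rc r `^ n)] ;
  hyp_height : forall r, r0 <= r < rI ->
    is_derive (Rc r) 1 H (1 - (derive1 Rc r)^-1) ;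
  hyp_spacelike : forall r, r0 <= r < rI -> `|derive1 H (Rc r)| < 1
}.

Section Derivatives.
Variable R : realType.
Implicit Types f : stfun R.

Definition d_t f : stfun R := fun t r th ph => derive1 (fun x => f x r th ph) t.
Definition d_r f : stfun R := fun t r th ph => derive1 (fun x => f t x th ph) r.
Definition d_th f : stfun R := fun t r th ph => derive1 (fun x => f t r x ph) th.
Definition d_ph f : stfun R := fun t r th ph => derive1 (fun x => f t r th x) ph.

Variable Rc : R -> R.

Definition nabla_T f : stfun R := d_t f.

(* d/dT + d/dR and d/dT - d/dR, rewritten with t = T - H(R) and
   dH/dR = 1 - 1/R' *)
Definition nabla_psi f : stfun R := fun t r th ph =>
  (derive1 Rc r)^-1 * (d_t f t r th ph + d_r f t r th ph).

Definition nabla_psib f : stfun R := fun t r th ph =>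
  (2 * derive1 Rc r - 1) / derive1 Rc r * d_t f t r th ph
  - (derive1 Rc r)^-1 * d_r f t r th ph.

(* D^A w_A for w = (wth, wph): the coordinate derivatives only; the
   connection term cot(theta) w_theta is written separately in the system. *)
Definition ang_div (wth wph : stfun R) : stfun R := fun t r th ph =>
  (Rc r ^+ 2)^-1 * (d_th wth t r th ph + (sin th ^+ 2)^-1 * d_ph wph t r th ph).

End Derivatives.

Record fields (R : realType) := Fields {
  Phi_psib : stfun R ;
  Phi_psi : stfun R ;
  Phi_th : stfun R ;
  Phi_ph : stfun R
}.

Section Region.
Variables (R : realType) (r0 rI t : R).

(* 0 <= s <= t, r0 <= r < rI, away from the poles of the sphere *)
Definition region : set (R * R * R * R)%type :=
  [set x | [/\ 0 <= x.1.1.1 <= t, r0 <= x.1.1.2 < rI & 0 < x.1.2 < pi]].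

(* the same with null infinity r = rI adjoined *)
Definition region_scri : set (R * R * R * R)%type :=
  [set x | [/\ 0 <= x.1.1.1 <= t, r0 <= x.1.1.2 <= rI & 0 < x.1.2 < pi]].

(* C^1 up to the slices s = 0, s = t and the world-tube r = r0, in the sense
   that [f] is also given slightly beyond them. *)
Definition C1_region (f : stfun R) : Prop :=
  [/\ (forall s r th ph, region (s, r, th, ph) ->
        [/\ derivable (fun x => f x r th ph) s 1,
            derivable (fun x => f s x th ph) r 1,
            derivable (fun x => f s r x ph) th 1 &
            derivable (fun x => f s r th x) ph 1]),
      {within region, continuous (joint f)},
      {within region, continuous (joint (d_t f))},
      {within region, continuous (joint (d_r f))} &
      {within region, continuous (joint (d_th f))} /\
      {within region, continuous (joint (d_ph f))}].

Definition ph_periodic (f : stfun R) : Prop :=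
  forall s r th ph, region (s, r, th, ph) ->
    f s r th (ph + 2 * pi) = f s r th ph.

(* The spherical chart degenerates at the poles.  [reg_poles] is what
   continuity on the whole sphere S^2 gives there: scalars are bounded, and so
   are the components w_theta, w_phi / sin(theta) of a one-form in the
   orthonormal frame, locally uniformly in s and r.
   [reg_scri] makes the flux through null infinity meaningful: the value of
   Phi_psib at r = rI is its limit.  Nothing is assumed at r = rI about the
   other unknowns. *)
Record regular_fields (Phi : fields R) : Prop := {
  reg_C1 : [/\ C1_region (Phi_psib Phi), C1_region (Phi_psi Phi),
               C1_region (Phi_th Phi) & C1_region (Phi_ph Phi)] ;
  reg_periodic : [/\ ph_periodic (Phi_psib Phi), ph_periodic (Phi_psi Phi),
                     ph_periodic (Phi_th Phi) & ph_periodic (Phi_ph Phi)] ;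
  reg_poles : forall r1, r1 < rI -> exists K : R,
    forall s r th ph, region (s, r, th, ph) -> r <= r1 ->
      [/\ `|Phi_psib Phi s r th ph| <= K, `|Phi_psi Phi s r th ph| <= K,
          `|Phi_th Phi s r th ph| <= K &
          `|Phi_ph Phi s r th ph| <= K * sin th] ;
  reg_scri : {within region_scri, continuous (joint (Phi_psib Phi))}
}.

Variable Rc : R -> R.

(* F = O(R^-3) as R -> oo, uniformly in the angles and in 0 <= s <= t *)
Definition bigO_Rm3 (F : stfun R) : Prop :=
  exists K : R, \forall r \near rI^'-,
    forall s th ph, 0 <= s <= t -> 0 < th < pi ->
      `|F s r th ph| <= K / Rc r ^+ 3.

Definition ugly_system (p : nat) (F : stfun R) (Phi : fields R) : Prop :=
  let: Fields u v wth wph := Phi in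
  forall s r th ph, region (s, r, th, ph) ->
  [/\ (Rc r ^+ p.+1)^-1
        * nabla_psi Rc (fun s' r' th' ph' => Rc r' ^+ p * u s' r' th' ph')
            s r th ph
      - (Rc r)^-1 * ang_div Rc wth wph s r th ph
      = cos th / sin th / Rc r ^+ 3 * wth s r th ph
        - p%:R / Rc r ^+ 3 * v s r th ph - F s r th ph,
      (Rc r ^+ 2)^-1 * nabla_psib Rc v s r th ph
      - (Rc r)^-1 * ang_div Rc wth wph s r th ph
      + p%:R / Rc r ^+ 2 * u s r th ph
      = cos th / sin th / Rc r ^+ 3 * wth s r th ph
        - p.+1%:R / Rc r ^+ 3 * v s r th ph - F s r th ph,
      2 * nabla_T wth s r th ph - d_th u s r th ph
        - (Rc r)^-1 * d_th v s r th ph = 0 &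
      2 * nabla_T wph s r th ph - d_ph u s r th ph
        - (Rc r)^-1 * d_ph v s r th ph = 0].

End Region.

(* All integrands below are nonnegative, so the integrals are taken in the
   extended reals (possibly +oo) and need no integrability hypothesis. *)
Section Integrals.
Variables (R : realType).
Local Notation mu := (@lebesgue_measure R).
Local Open Scope ereal_scope.

(* integral of g dOmega over the unit sphere *)
Definition int_sphere (g : R -> R -> R) : \bar R :=
  \int[mu]_(th in `[0%R, pi]) \int[mu]_(ph in `[0%R, (2 * pi)%R])
    (g th ph * sin th)%:E.

Variables (r0 rI : R) (Rc : R -> R).

(* integral of g dV, dV = R' R^2 dr dOmega, over a slice of constant time *)
Definition int_slice (g : R -> R -> R -> R) : \bar R :=
  \int[mu]_(r in `[r0, rI[)
    int_sphere (fun th ph => (g r th ph * (derive1 Rc r * Rc r ^+ 2))%R).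

(* integral of g dV dt over the region between the slices 0 and t *)
Definition int_region (t : R) (g : stfun R) : \bar R :=
  \int[mu]_(s in `[0%R, t]) int_slice (g s).

(* integral of g dOmega dt over the hypersurface of constant radius r,
   between the times 0 and t *)
Definition int_tube (r t : R) (g : stfun R) : \bar R :=
  \int[mu]_(s in `[0%R, t]) int_sphere (g s r).

(* the squared energy E^2(t) *)
Definition energy2 (Phi : fields R) (t : R) : \bar R :=
  int_slice (fun r th ph =>
    ((2 * derive1 Rc r * Rc r ^+ 2)^-1 * Phi_psib Phi t r th ph ^+ 2
     + (2 * derive1 Rc r - 1) / (2 * derive1 Rc r * Rc r ^+ 4)
         * Phi_psi Phi t r th ph ^+ 2
     + (Rc r ^+ 4)^-1 * Phi_th Phi t r th ph ^+ 2
     + (Rc r ^+ 4 * sin th ^+ 2)^-1 * Phi_ph Phi t r th ph ^+ 2)%R).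

End Integrals.

(* Main.v *)
(** Write u, z = v / R, w for the three kinds of unknowns (v being Phi_psi).  Then
    (d_t + d_r) u and ((2R' - 1) d_t - d_r) z both equal
    R' (div w / R^2 - p (u + z) / R - R F), and 2 d_t w = grad (u + z); so the
    density e = u^2/2 + (2R' - 1) z^2/2 + R' |w|^2 / R^2 satisfies
    d_t e + d_r (u^2 - z^2)/2 - div (R' (u + z) w / R^2)
      = - p R' (u + z)^2 / R - R' R F (u + z).

    The current is multiplied by exp (C (t - s)) k(R(r) + s - A), where k is a
    decreasing cutoff from 1 to 0.  The exponential absorbs the F-term, because
    R' = O(R^2), and plays the role of Gronwall's lemma.  Where R' >= 1, the surfaces
    R(r) + s = const have a favourable sign for z and w, so that nothing needs to be
    known about these near null infinity, not even that the energy is finite at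
    later times.  The mass of the derivative of the cutoff concentrates at null
    infinity as A grows, and yields the flux of u there.  The poles of the sphere
    are cut out as well; the flux through the small circles around them tends
    to 0. *)

Require Import Defs.
From mathcomp Require Import all_boot all_order all_algebra.
From mathcomp Require Import all_classical all_reals all_analysis.
From mathcomp Require Import measurable_realfun ring lra.
Set Implicit Arguments.
Unset Strict Implicit.
Unset Printing Implicit Defensive.
Import Order.TTheory GRing.Theory Num.Theory.
Import numFieldNormedType.Exports.
Local Open Scope classical_set_scope.
Local Open Scope ring_scope.

(** * Continuity and integrals of one variable *)

(** A cut along r = const would leave the flux (u^2 - z^2)/2, which has no sign while z is
    uncontrolled near null infinity. Across a surface R(r) + s = const the flux density is e + R'
    (u^2 - z^2)/2 = (1 + R') u^2/2 + (R' - 1) z^2/2 + R' |w|^2/R^2; keeping R' u^2/2 and dropping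
    the rest is legitimate once R' >= 1, which the growth rate of R' ensures near null infinity. The
    constant C comes from - R F (u + z) <= R^4 F^2 + (u^2 + z^2)/(2 R^2), combined with bounds of R'
    by C R^2 (for u) and by C R^2 (2R' - 1) (for z). The theorem compares extended integrals,
    whereas the divergence theorem is applied to real integrals over compact boxes. *)

Lemma continuous_pair (S T U : topologicalType) (f : S -> T) (g : S -> U) :
  continuous f -> continuous g -> continuous (fun x => (f x, g x)).
Proof.
move=> cf cg x W [[P Q] /= [Pf Qg] PQ].
have fP : nbhs x (f @^-1` P) := cf x _ Pf.
have gQ : nbhs x (g @^-1` Q) := cg x _ Qg.
by apply: filterS (filterI fP gQ) => y [fy gy]; exact: (PQ (f y, g y)).
Qed.

Section WithinContinuity.
Context {R : realType} {S T : topologicalType}.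
Implicit Types (A : set T) (B : set S).

(** The source of slices, permuted variables and restrictions for functions that are continuous only
    relative to a box. *)
Lemma within_comp (U : topologicalType) A B (f : S -> U) (g : T -> S) :
  {within B, continuous f} -> continuous g -> (forall x, A x -> B (g x)) ->
  {within A, continuous (fun x => f (g x))}.
Proof.
move=> /subspace_continuousP cf cg AB; apply/subspace_continuousP => x Ax.
apply: (@cvg_comp _ _ _ g f _ (within B (nbhs (g x)))); last exact/cf/AB.
move=> W /= BW; have := cg x _ BW; rewrite nbhs_simpl/= => gW.
rewrite /within/=; near_simpl; apply: filterS gW => y /= gyW Ay.
exact/gyW/AB.
Qed.

Lemma withinM A (f g : T -> R) : {within A, continuous f} ->
  {within A, continuous g} -> {within A, continuous (fun x => f x * g x)}.
Proof. by move=> cf cg x; apply: continuousM; [exact: cf|exact: cg]. Qed.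

Lemma withinD A (f g : T -> R) : {within A, continuous f} ->
  {within A, continuous g} -> {within A, continuous (fun x => f x + g x)}.
Proof.
by move=> cf cg x; apply: (@continuousD R R^o); [exact: cf|exact: cg].
Qed.

Lemma withinN A (f : T -> R) : {within A, continuous f} ->
  {within A, continuous (fun x => - f x)}.
Proof. by move=> cf x; apply: (@continuousN R R^o); exact: cf. Qed.

Lemma withinB A (f g : T -> R) : {within A, continuous f} ->
  {within A, continuous g} -> {within A, continuous (fun x => f x - g x)}.
Proof. by move=> cf cg; apply: withinD => //; exact: withinN. Qed.

Lemma within_cst A (c : R) : {within A, continuous (fun=> c)}.
Proof. by move=> x; exact: cst_continuous. Qed.

Lemma withinX A (f : T -> R) n : {within A, continuous f} ->
  {within A, continuous (fun x => f x ^+ n)}.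
Proof.
move=> cf; elim: n => [|n ih].
  by under eq_fun do rewrite expr0; exact: within_cst.
by under eq_fun do rewrite exprS; exact: withinM.
Qed.

Lemma withinV A (f : T -> R) : (forall x, A x -> f x != 0) ->
  {within A, continuous f} -> {within A, continuous (fun x => (f x)^-1)}.
Proof.
move=> f0 /subspace_continuousP cf; apply/subspace_continuousP => x Ax.
by apply: cvgV; [exact: f0|exact: cf].
Qed.

Lemma eq_within A (f g : T -> R) : (forall x, A x -> f x = g x) ->
  {within A, continuous f} -> {within A, continuous g}.
Proof.
by move=> fg; apply: subspace_eq_continuous => x /set_mem; exact: fg.
Qed.

(** Both points vary, so a compactness argument in either variable needs only two instances and the
    triangle inequality. *)
Lemma within_pair_near A (f : T * R -> R) (x : T) y0 (B1 : set R) e : 0 < e ->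
  {within A `*` B1, continuous f} -> A x -> B1 y0 ->
  \forall y \near y0 & x' \near x, A x' -> B1 y ->
    `|f (x, y0) - f (x', y)| < e.
Proof.
move=> e0 /subspace_continuousP cf Ax By0.
have /(_ (conj Ax By0)) /cvgrPdist_lt/(_ _ e0) := cf (x, y0).
rewrite /within/= => -[[P Q] /= [Px Qy] PQ].
by exists (Q, P) => // -[y x'] /= [Qy' Px'] Ax' By'; exact: (PQ (x', y)).
Qed.

End WithinContinuity.

Section SegmentIntegral.
Context {R : realType}.
Local Notation mu := (@lebesgue_measure R).
Implicit Types (a b c d : R) (f g : R -> R).

(** Real-valued, so that linear arithmetic needs no finiteness conditions; [EFin_int1] leads back to
    the extended integral. *)
Definition int1 a b f : R := \int[mu]_(x in `[a, b]) f x.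

Lemma segment_integrable a b f : {within `[a, b], continuous f} ->
  mu.-integrable `[a, b] (EFin \o f).
Proof. by move=> cf; apply: continuous_compact_integrable => //; exact: segment_compact. Qed.

Lemma eq_int1 a b f g : (forall x, a <= x <= b -> f x = g x) ->
  int1 a b f = int1 a b g.
Proof. by move=> fg; apply: eq_Rintegral => x; rewrite inE/= in_itv/=; exact: fg. Qed.

Lemma int1D a b f g : {within `[a, b], continuous f} ->
  {within `[a, b], continuous g} ->
  int1 a b (fun x => f x + g x) = int1 a b f + int1 a b g.
Proof. by move=> cf cg; apply: RintegralD => //; exact: segment_integrable. Qed.

Lemma int1B a b f g : {within `[a, b], continuous f} ->
  {within `[a, b], continuous g} ->
  int1 a b (fun x => f x - g x) = int1 a b f - int1 a b g.
Proof. by move=> cf cg; apply: RintegralB => //; exact: segment_integrable. Qed.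

Lemma int1Z a b (k : R) f : {within `[a, b], continuous f} ->
  int1 a b (fun x => k * f x) = k * int1 a b f.
Proof. by move=> cf; apply: RintegralZl => //; exact: segment_integrable. Qed.

Lemma le_int1 a b f g : {within `[a, b], continuous f} ->
  {within `[a, b], continuous g} ->
  (forall x, a <= x <= b -> f x <= g x) -> int1 a b f <= int1 a b g.
Proof.
move=> cf cg fg; apply: le_Rintegral => //.
- exact: segment_integrable.
- exact: segment_integrable.
Qed.

Lemma int1_cst a b (k : R) : a <= b -> int1 a b (fun=> k) = k * (b - a).
Proof.
move=> ab; rewrite /int1 Rintegral_cst//; congr (_ * _).
apply: (etrans (congr1 fine (lebesgue_measure_itv `[a, b]))) => /=.
case: ifPn => //.
rewrite lte_fin -leNgt => ba.
by have -> : b = a by [apply: le_anti; rewrite ab ba]; rewrite subrr.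
Qed.

Lemma EFin_int1 a b f : {within `[a, b], continuous f} ->
  (\int[mu]_(x in `[a, b]) (f x)%:E)%E = (int1 a b f)%:E.
Proof.
move=> cf; rewrite fineK//; apply: integrable_fin_num => //.
exact: segment_integrable.
Qed.

(** Compactness of [[c, d]] makes the continuity in the parameter uniform in [y]. As [T] is any
    space, the same lemma integrates out the last variable of a function of two, three or four
    variables. *)
Lemma within_int1 (T : topologicalType) (A : set T) c d (f : T * R -> R) :
  c <= d -> {within A `*` `[c, d], continuous f} ->
  {within A, continuous (fun x => int1 c d (fun y => f (x, y)))}.
Proof.
move=> cd cf; apply/subspace_continuousP => x Ax.
have cfx x' : A x' -> {within `[c, d], continuous (fun y => f (x', y))}.
  move=> Ax'; apply: (within_comp cf) => //.
  by apply: continuous_pair => z; [exact: cvg_cst|exact: cvg_id].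
apply/cvgrPdist_le => e e0.
(* The added 1 keeps the quotient meaningful when [c = d]; the half is for the triangle
   inequality. *)
have e'0 : 0 < e / (d - c + 1) / 2.
  by rewrite !divr_gt0// ltr_wpDl// subr_ge0.
have : \forall x' \near x, `[c, d] `<=`
    (fun y => A x' -> `|f (x, y) - f (x', y)| <= e / (d - c + 1)).
  have /compact_near_coveringP/near_covering_withinP H := @segment_compact R c d.
  have := H T (nbhs x) (fun x' y => A x' ->
    `|f (x, y) - f (x', y)| <= e / (d - c + 1)) _.
  apply.
  move=> y cdy {H}.
  have [[Q P] /= [Qy Px] QP] := within_pair_near e'0 cf Ax cdy.
  exists (Q, P) => // -[y' x'] /= [Qy' Px'] cdy' Ax'.
  have H1 := QP (y', x') (conj Qy' Px') Ax' cdy'.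
  have H2 := QP (y', x) (conj Qy' (nbhs_singleton Px)) Ax cdy'.
  rewrite /= in H1 H2.
  rewrite -(subrKA (f (x, y))) (splitr (e / _)).
  apply: (le_trans (ler_normD _ _)); apply: lerD; last exact: ltW.
  by rewrite distrC; exact: ltW.
rewrite /within/=; apply: filterS => x' H Ax'.
rewrite /int1 -RintegralB//; [|exact: segment_integrable (cfx _ _)..].
set h := fun y => _ - _.
have ch : {within `[c, d], continuous h} by apply: withinB; exact: cfx.
apply: (le_trans (le_normr_Rintegral _ (segment_integrable ch))) => //.
apply: (@le_trans _ _ (int1 c d (fun=> e / (d - c + 1)))).
  apply: le_int1; [|exact: within_cst|].
    by move=> y; apply: continuous_comp; [exact: ch|exact: norm_continuous].
  by move=> y cdy; apply: H.
rewrite int1_cst// mulrAC ler_pdivrMr ?ltr_wpDl ?subr_ge0//.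
by rewrite ler_wpM2l// ?ltW// ltrDl.
Unshelve. all: by end_near. Qed.

Lemma int1_derive a b f g : a <= b ->
  {within `[a, b], continuous f} -> {within `[a, b], continuous g} ->
  (forall x, a < x < b -> is_derive x 1 f (g x)) ->
  int1 a b g = f b - f a.
Proof.
rewrite le_eqVlt => /predU1P[->|ab] cf cg fg.
  by rewrite /int1 set_itv1 Rintegral_set1 subrr.
apply/EFin_inj; rewrite -EFin_int1// EFinB.
have /continuous_within_itvP := cf; move=> /(_ ab)[cf1 cf2 cf3].
apply: continuous_FTC2 => //.
  by split => // x; rewrite in_itv/= => /fg[].
by move=> x; rewrite in_itv/= => /fg fgx; rewrite derive1E derive_val.
Qed.

(** Differentiation under the integral sign: [G] is bounded on the compact rectangle, so a constant
    dominates the derivative. *)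
Lemma is_derive_int1 a b c d (F G : R * R -> R) :
  {within `[a, b] `*` `[c, d], continuous F} ->
  {within `[a, b] `*` `[c, d], continuous G} ->
  (forall x y, a < x < b -> c <= y <= d ->
    is_derive x 1 (fun x' => F (x', y)) (G (x, y))) ->
  forall x, a < x < b ->
    is_derive x 1 (fun x' => int1 c d (fun y => F (x', y)))
      (int1 c d (fun y => G (x, y))).
Proof.
move=> cF cG FG x xab.
have cslice (H : R * R -> R) z : {within `[a, b] `*` `[c, d], continuous H} ->
    a < z < b -> {within `[c, d], continuous (fun y => H (z, y))}.
  move=> cH /andP[az zb]; apply: (within_comp cH) => [|y cdy].
    by apply: continuous_pair => w; [exact: cvg_cst|exact: cvg_id].
  by split => //=; rewrite in_itv/= !ltW.
have [M [_ /(_ (M + 1))]] : bounded_set (G @` (`[a, b] `*` `[c, d])).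
  apply: compact_bounded; apply: continuous_compact => //.
  by apply: compact_setX; exact: segment_compact.
rewrite ltrDl ltr01 => /(_ isT) Mub.
pose f := fun x y => F (x, y).
have Ix : `]a, b[%classic x by rewrite /= in_itv/=.
have mB : measurable (`[c, d]%classic : set (measurableTypeR R)) by exact: measurable_itv.
have intf z : `]a, b[%classic z -> mu.-integrable `[c, d] (EFin \o f z).
  by rewrite /= in_itv/= => zab; apply: segment_integrable; exact: cslice.
have derf z y : `]a, b[%classic z -> `[c, d]%classic y -> derivable (f^~ y) z 1.
  by rewrite /= !in_itv/= => zab ycd; have [] := FG z y zab ycd.
have d1f z y : a < z < b -> c <= y <= d -> partial1of2 f z y = G (z, y).
  by move=> zab ycd; have fg := FG z y zab ycd; rewrite partial1of2E derive_val.
have intG : mu.-integrable `[c, d] (EFin \o cst (Num.max 0 (M + 1))).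
  by apply: segment_integrable; exact: within_cst.
have Gub z y : `]a, b[%classic z -> `[c, d]%classic y ->
    `|partial1of2 f z y| <= Num.max 0 (M + 1).
  rewrite /= !in_itv/= => zab ycd; rewrite d1f// le_max Mub ?orbT//=.
  exists (z, y) => //; split => /=; rewrite in_itv//=.
  by case/andP: zab => ? ?; rewrite !ltW.
have G0 (y : R) : 0 <= cst (Num.max 0 (M + 1)) y by rewrite /= le_max lexx.
apply: DeriveDef.
  have D := derivable_under_integral mB Ix intf derf G0 intG Gub.
  exact: D.
rewrite -derive1E.
rewrite (differentiation_under_integral mB Ix intf derf G0 intG Gub).
by apply: eq_int1 => y ycd; exact: d1f.
Qed.

End SegmentIntegral.

(** * Integrals over boxes *)

Section BoxIntegrals.
Context {R : realType}.
Implicit Types I J K L : R * R.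

Definition seg I : set R := `[I.1, I.2]%classic.

(** Continuity is relative to the closed box, hence one-sided at its faces. *)
Definition cont1 I (f : R -> R) := {within seg I, continuous f}.
Definition cont2 I J (f : R -> R -> R) :=
  {within seg I `*` seg J, continuous (fun x => f x.1 x.2)}.
Definition cont3 I J K (f : R -> R -> R -> R) :=
  {within seg I `*` seg J `*` seg K, continuous (fun x => f x.1.1 x.1.2 x.2)}.
Definition cont4 I J K L (f : stfun R) :=
  {within seg I `*` seg J `*` seg K `*` seg L, continuous (joint f)}.

Definition int2 I J (f : R -> R -> R) := int1 I.1 I.2 (fun x => int1 J.1 J.2 (f x)).
Definition int3 I J K (f : R -> R -> R -> R) :=
  int1 I.1 I.2 (fun x => int2 J K (f x)).
Definition int4 I J K L (f : stfun R) := int1 I.1 I.2 (fun x => int3 J K L (f x)).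

Lemma segP I x : seg I x <-> I.1 <= x <= I.2.
Proof. by rewrite /seg /= in_itv. Qed.

Lemma cont2_slice1 I J f x : cont2 I J f -> I.1 <= x <= I.2 -> cont1 J (f x).
Proof.
move=> cf xI; apply: (within_comp cf (g := fun y => (x, y))) => [|y Jy].
  by apply: continuous_pair => w; [exact: cvg_cst|exact: cvg_id].
by split => //; exact/segP.
Qed.

Lemma cont3_slice1 I J K f x : cont3 I J K f -> I.1 <= x <= I.2 -> cont2 J K (f x).
Proof.
move=> cf xI; apply: (within_comp cf (g := fun y => (x, y.1, y.2))) => [|y [Jy Ky]].
  apply: continuous_pair => [|w]; last exact: cvg_snd.
  by apply: continuous_pair => w; [exact: cvg_cst|exact: cvg_fst].
by do !split => //; exact/segP.
Qed.

Lemma cont4_slice1 I J K L f x : cont4 I J K L f -> I.1 <= x <= I.2 ->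
  cont3 J K L (f x).
Proof.
move=> cf xI; apply: (within_comp cf (g := fun y => (x, y.1.1, y.1.2, y.2)))
  => [|y [[Jy Ky] Ly]].
  apply: continuous_pair => [|w]; last exact: cvg_snd.
  apply: continuous_pair => [|w].
    apply: continuous_pair => w; first exact: cvg_cst.
    by apply: (@cvg_comp _ _ _ fst fst); exact: cvg_fst.
  by apply: (@cvg_comp _ _ _ fst snd); [exact: cvg_fst|exact: cvg_snd].
by do !split => //; exact/segP.
Qed.

Lemma cont4_slice2 I J K L f y : cont4 I J K L f -> J.1 <= y <= J.2 ->
  cont3 I K L (fun x => f x y).
Proof.
move=> cf yJ; apply: (within_comp cf (g := fun x => (x.1.1, y, x.1.2, x.2)))
  => [|x [[Ix Kx] Lx]].
  apply: continuous_pair => [|w]; last exact: cvg_snd.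
  apply: continuous_pair => [|w].
    apply: continuous_pair => w; last exact: cvg_cst.
    by apply: (@cvg_comp _ _ _ fst fst); exact: cvg_fst.
  by apply: (@cvg_comp _ _ _ fst snd); [exact: cvg_fst|exact: cvg_snd].
by do !split => //; exact/segP.
Qed.

Lemma cont4_slice3 I J K L f z : cont4 I J K L f -> K.1 <= z <= K.2 ->
  cont3 I J L (fun x y => f x y z).
Proof.
move=> cf zK; apply: (within_comp cf (g := fun x => (x.1, z, x.2)))
  => [|x [[Ix Jx] Lx]].
  apply: continuous_pair => [|w]; last exact: cvg_snd.
  by apply: continuous_pair => w; [exact: cvg_fst|exact: cvg_cst].
by do !split => //; exact/segP.
Qed.

Lemma cont2_int I J f : J.1 <= J.2 -> cont2 I J f ->
  cont1 I (fun x => int1 J.1 J.2 (f x)).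
Proof. exact: within_int1. Qed.

Lemma cont3_int I J K f : K.1 <= K.2 -> cont3 I J K f ->
  cont2 I J (fun x y => int1 K.1 K.2 (f x y)).
Proof. exact: within_int1. Qed.

Lemma cont4_int I J K L f : L.1 <= L.2 -> cont4 I J K L f ->
  cont3 I J K (fun x y z => int1 L.1 L.2 (f x y z)).
Proof. exact: within_int1. Qed.

Lemma cont3_int2 I J K f : J.1 <= J.2 -> K.1 <= K.2 -> cont3 I J K f ->
  cont1 I (fun x => int2 J K (f x)).
Proof. by move=> ? ? cf; apply: cont2_int => //; exact: cont3_int. Qed.

Lemma cont4_int2 I J K L f : K.1 <= K.2 -> L.1 <= L.2 ->
  cont4 I J K L f -> cont2 I J (fun x y => int2 K L (f x y)).
Proof.
move=> ? ? cf.
exact: (cont3_int (f := fun x y z => int1 L.1 L.2 (f x y z)) _ (cont4_int _ cf)).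
Qed.

Lemma cont4_int3 I J K L f : J.1 <= J.2 -> K.1 <= K.2 -> L.1 <= L.2 ->
  cont4 I J K L f -> cont1 I (fun x => int3 J K L (f x)).
Proof. by move=> ? ? ? cf; apply: cont2_int => //; exact: cont4_int2. Qed.

Lemma int2D I J f g : J.1 <= J.2 -> cont2 I J f -> cont2 I J g ->
  int2 I J (fun x y => f x y + g x y) = int2 I J f + int2 I J g.
Proof.
move=> J12 cf cg; rewrite /int2 -int1D; [|exact: cont2_int..].
by apply: eq_int1 => x xI; apply: int1D; exact: cont2_slice1 xI.
Qed.

Lemma int3D I J K f g : J.1 <= J.2 -> K.1 <= K.2 -> cont3 I J K f ->
  cont3 I J K g ->
  int3 I J K (fun x y z => f x y z + g x y z) = int3 I J K f + int3 I J K g.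
Proof.
move=> J12 K12 cf cg; rewrite /int3 -int1D; [|exact: cont3_int2..].
by apply: eq_int1 => x xI; apply: int2D => //; exact: cont3_slice1 xI.
Qed.

Lemma int4D I J K L f g : J.1 <= J.2 -> K.1 <= K.2 -> L.1 <= L.2 ->
  cont4 I J K L f -> cont4 I J K L g ->
  int4 I J K L (fun x y z w => f x y z w + g x y z w) =
  int4 I J K L f + int4 I J K L g.
Proof.
move=> J12 K12 L12 cf cg; rewrite /int4 -int1D; [|exact: cont4_int3..].
by apply: eq_int1 => x xI; apply: int3D => //; exact: cont4_slice1 xI.
Qed.

Lemma int2B I J f g : J.1 <= J.2 -> cont2 I J f -> cont2 I J g ->
  int2 I J (fun x y => f x y - g x y) = int2 I J f - int2 I J g.
Proof.
move=> J12 cf cg; rewrite /int2 -int1B; [|exact: cont2_int..].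
by apply: eq_int1 => x xI; apply: int1B; exact: cont2_slice1 xI.
Qed.

Lemma int3B I J K f g : J.1 <= J.2 -> K.1 <= K.2 -> cont3 I J K f ->
  cont3 I J K g ->
  int3 I J K (fun x y z => f x y z - g x y z) = int3 I J K f - int3 I J K g.
Proof.
move=> J12 K12 cf cg; rewrite /int3 -int1B; [|exact: cont3_int2..].
by apply: eq_int1 => x xI; apply: int2B => //; exact: cont3_slice1 xI.
Qed.

Lemma int2Z I J k f : J.1 <= J.2 -> cont2 I J f ->
  int2 I J (fun x y => k * f x y) = k * int2 I J f.
Proof.
move=> J12 cf; rewrite /int2 -int1Z; last exact: cont2_int.
by apply: eq_int1 => x xI; apply: int1Z; exact: cont2_slice1 xI.
Qed.

Lemma int3Z I J K k f : J.1 <= J.2 -> K.1 <= K.2 -> cont3 I J K f ->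
  int3 I J K (fun x y z => k * f x y z) = k * int3 I J K f.
Proof.
move=> J12 K12 cf; rewrite /int3 -int1Z; last exact: cont3_int2.
by apply: eq_int1 => x xI; apply: int2Z => //; exact: cont3_slice1 xI.
Qed.

Lemma int4Z I J K L k f : J.1 <= J.2 -> K.1 <= K.2 -> L.1 <= L.2 ->
  cont4 I J K L f ->
  int4 I J K L (fun x y z w => k * f x y z w) = k * int4 I J K L f.
Proof.
move=> J12 K12 L12 cf; rewrite /int4 -int1Z; last exact: cont4_int3.
by apply: eq_int1 => x xI; apply: int3Z => //; exact: cont4_slice1 xI.
Qed.

Lemma le_int2 I J f g : J.1 <= J.2 -> cont2 I J f -> cont2 I J g ->
  (forall x y, I.1 <= x <= I.2 -> J.1 <= y <= J.2 -> f x y <= g x y) ->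
  int2 I J f <= int2 I J g.
Proof.
move=> J12 cf cg fg; apply: le_int1 => [||x xI]; [exact: cont2_int..|].
by apply: le_int1 => [||y yJ]; [exact: cont2_slice1 xI..|exact: fg].
Qed.

Lemma le_int3 I J K f g : J.1 <= J.2 -> K.1 <= K.2 -> cont3 I J K f ->
  cont3 I J K g ->
  (forall x y z, I.1 <= x <= I.2 -> J.1 <= y <= J.2 -> K.1 <= z <= K.2 ->
    f x y z <= g x y z) ->
  int3 I J K f <= int3 I J K g.
Proof.
move=> J12 K12 cf cg fg; apply: le_int1 => [||x xI]; [exact: cont3_int2..|].
apply: le_int2 => // [||y z yJ zK]; [exact: cont3_slice1 xI..|exact: fg].
Qed.

Lemma le_int4 I J K L f g : J.1 <= J.2 -> K.1 <= K.2 -> L.1 <= L.2 ->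
  cont4 I J K L f -> cont4 I J K L g ->
  (forall x y z w, I.1 <= x <= I.2 -> J.1 <= y <= J.2 -> K.1 <= z <= K.2 ->
    L.1 <= w <= L.2 -> f x y z w <= g x y z w) ->
  int4 I J K L f <= int4 I J K L g.
Proof.
move=> J12 K12 L12 cf cg fg; apply: le_int1 => [||x xI]; [exact: cont4_int3..|].
apply: le_int3 => // [||y z w yJ zK wL]; [exact: cont4_slice1 xI..|exact: fg].
Qed.

Lemma int3_cst I J K (k : R) : I.1 <= I.2 -> J.1 <= J.2 -> K.1 <= K.2 ->
  int3 I J K (fun _ _ _ => k) = k * (K.2 - K.1) * (J.2 - J.1) * (I.2 - I.1).
Proof. by move=> *; rewrite /int3 /int2 !int1_cst. Qed.

(** In this lemma and the next ones, inner integrals are differentiated under the integral sign and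
    outer variables are frozen. The order of integration never changes, so the divergence theorem is
    obtained without Fubini. *)
Lemma int2_derive I J F G : I.1 <= I.2 -> J.1 <= J.2 ->
  cont2 I J F -> cont2 I J G ->
  (forall x y, I.1 < x < I.2 -> J.1 <= y <= J.2 ->
    is_derive x 1 (F ^~ y) (G x y)) ->
  int2 I J G = int1 J.1 J.2 (F I.2) - int1 J.1 J.2 (F I.1).
Proof.
move=> I12 J12 cF cG FG.
apply: (int1_derive (f := fun x => int1 J.1 J.2 (F x))) => // [||x xI].
- exact: cont2_int.
- exact: cont2_int.
- exact: (is_derive_int1 (F := fun x => F x.1 x.2) (G := fun x => G x.1 x.2) cF cG).
Qed.

Lemma int3_derive I J K F G : I.1 <= I.2 -> J.1 <= J.2 -> K.1 <= K.2 ->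
  cont3 I J K F -> cont3 I J K G ->
  (forall x y z, I.1 < x < I.2 -> J.1 <= y <= J.2 -> K.1 <= z <= K.2 ->
    is_derive x 1 (fun x => F x y z) (G x y z)) ->
  int3 I J K G = int2 J K (F I.2) - int2 J K (F I.1).
Proof.
move=> I12 J12 K12 cF cG FG.
have slice H y : cont3 I J K H -> J.1 <= y <= J.2 -> cont2 I K (fun x => H x y).
  move=> cH yJ; apply: (within_comp cH (g := fun x => (x.1, y, x.2)))
    => [|x [Ix Kx]]; last by do !split => //; exact/segP.
  apply: continuous_pair => [|w]; last exact: cvg_snd.
  by apply: continuous_pair => w; [exact: cvg_fst|exact: cvg_cst].
apply: (int2_derive (F := fun x y => int1 K.1 K.2 (F x y))
  (G := fun x y => int1 K.1 K.2 (G x y))) => // [||x y xI yJ].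
- exact: cont3_int.
- exact: cont3_int.
- apply: (is_derive_int1 (F := fun x => F x.1 y x.2) (G := fun x => G x.1 y x.2)
    (slice _ _ cF yJ) (slice _ _ cG yJ)) => // x' z x'I zK.
  exact: FG.
Qed.

Lemma int4_derive1 I J K L F G : I.1 <= I.2 -> J.1 <= J.2 -> K.1 <= K.2 ->
  L.1 <= L.2 -> cont4 I J K L F -> cont4 I J K L G ->
  (forall x y z w, I.1 < x < I.2 -> J.1 <= y <= J.2 -> K.1 <= z <= K.2 ->
    L.1 <= w <= L.2 -> is_derive x 1 (fun x => F x y z w) (G x y z w)) ->
  int4 I J K L G = int3 J K L (F I.2) - int3 J K L (F I.1).
Proof.
move=> I12 J12 K12 L12 cF cG FG.
have slice H y z : cont4 I J K L H -> J.1 <= y <= J.2 -> K.1 <= z <= K.2 ->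
    cont2 I L (fun x => H x y z).
  move=> cH yJ zK; apply: (within_comp cH (g := fun x => (x.1, y, z, x.2)))
    => [|x [Ix Lx]]; last by do !split => //; exact/segP.
  apply: continuous_pair => [|w]; last exact: cvg_snd.
  apply: continuous_pair => [|w]; last exact: cvg_cst.
  by apply: continuous_pair => w; [exact: cvg_fst|exact: cvg_cst].
apply: (int3_derive (F := fun x y z => int1 L.1 L.2 (F x y z))
  (G := fun x y z => int1 L.1 L.2 (G x y z))) => // [||x y z xI yJ zK].
- exact: cont4_int.
- exact: cont4_int.
- apply: (is_derive_int1 (F := fun x => F x.1 y z x.2) (G := fun x => G x.1 y z x.2)
    (slice _ _ _ cF yJ zK) (slice _ _ _ cG yJ zK)) => // x' w x'I wL.
  exact: FG.
Qed.

Lemma int4_derive2 I J K L F G : J.1 <= J.2 -> K.1 <= K.2 ->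
  L.1 <= L.2 -> cont4 I J K L F -> cont4 I J K L G ->
  (forall x y z w, I.1 <= x <= I.2 -> J.1 < y < J.2 -> K.1 <= z <= K.2 ->
    L.1 <= w <= L.2 -> is_derive y 1 (fun y => F x y z w) (G x y z w)) ->
  int4 I J K L G = int3 I K L (fun x => F x J.2) - int3 I K L (fun x => F x J.1).
Proof.
move=> J12 K12 L12 cF cG FG.
have slice y : J.1 <= y <= J.2 -> cont1 I (fun x => int2 K L (F x y)).
  move=> yJ; apply: (cont3_int2 (f := fun x => F x y)) => //.
  exact: cont4_slice2 cF yJ.
have J1 : J.1 <= J.1 <= J.2 by rewrite lexx J12.
have J2 : J.1 <= J.2 <= J.2 by rewrite J12 lexx.
rewrite /int3 -int1B; [|exact: slice..].
apply: eq_int1 => x xI.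
apply: int3_derive => // [||y z w yJ zK wL]; [exact: cont4_slice1 xI..|].
exact: FG.
Qed.

Lemma int4_derive3 I J K L F G : J.1 <= J.2 -> K.1 <= K.2 ->
  L.1 <= L.2 -> cont4 I J K L F -> cont4 I J K L G ->
  (forall x y z w, I.1 <= x <= I.2 -> J.1 <= y <= J.2 -> K.1 < z < K.2 ->
    L.1 <= w <= L.2 -> is_derive z 1 (fun z => F x y z w) (G x y z w)) ->
  int4 I J K L G =
    int3 I J L (fun x y => F x y K.2) - int3 I J L (fun x y => F x y K.1).
Proof.
move=> J12 K12 L12 cF cG FG.
have slice z : K.1 <= z <= K.2 -> cont3 I J L (fun x y => F x y z).
  by move=> zK; exact: cont4_slice3 cF zK.
have K1 : K.1 <= K.1 <= K.2 by rewrite lexx K12.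
have K2 : K.1 <= K.2 <= K.2 by rewrite K12 lexx.
rewrite -(int3B (f := fun x y => F x y K.2) (g := fun x y => F x y K.1) J12 L12
  (slice _ K2) (slice _ K1)).
apply: eq_int1 => x xI; apply: eq_int1 => y yJ.
have cFy := cont3_slice1 (cont4_slice1 cF xI) yJ.
have cGy := cont3_slice1 (cont4_slice1 cG xI) yJ.
rewrite (int1B (cont2_slice1 cFy K2) (cont2_slice1 cFy K1)).
apply: int2_derive => // z w zK wL.
exact: FG.
Qed.

(** The two faces of the azimuthal interval cancel in the innermost integral already. *)
Lemma int4_derive4_periodic I J K L F G : L.1 <= L.2 ->
  cont4 I J K L F -> cont4 I J K L G ->
  (forall x y z w, I.1 <= x <= I.2 -> J.1 <= y <= J.2 -> K.1 <= z <= K.2 ->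
    L.1 < w < L.2 -> is_derive w 1 (fun w => F x y z w) (G x y z w)) ->
  (forall x y z, I.1 <= x <= I.2 -> J.1 <= y <= J.2 -> K.1 <= z <= K.2 ->
    F x y z L.2 = F x y z L.1) ->
  int4 I J K L G = 0.
Proof.
move=> L12 cF cG FG F12.
have z0 a b : int1 a b (fun=> 0) = 0 :> R.
  by rewrite /int1 /Rintegral integral0.
rewrite -[RHS](z0 I.1 I.2); apply: eq_int1 => x xI.
rewrite -[RHS](z0 J.1 J.2); apply: eq_int1 => y yJ.
rewrite -[RHS](z0 K.1 K.2); apply: eq_int1 => z zK.
have -> : int1 L.1 L.2 (G x y z) = F x y z L.2 - F x y z L.1; last first.
  by rewrite F12// subrr.
apply: int1_derive => // [||w wL].
- exact: cont2_slice1 (cont3_slice1 (cont4_slice1 cF xI) yJ) zK.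
- exact: cont2_slice1 (cont3_slice1 (cont4_slice1 cG xI) yJ) zK.
- exact: FG.
Qed.

End BoxIntegrals.

(** * Extended integrals *)

Section IntegralComparison.
Context d (T : measurableType d) (R : realType) (mu : {measure set T -> \bar R}).
Implicit Types A : set T.
Local Open Scope ereal_scope.

(* Both sides are suprema over simple functions, whence no measurability. *)
Lemma le_integral_subset A B (f g : T -> \bar R) : A `<=` B ->
  (forall x, A x -> 0 <= f x <= g x) -> (forall x, B x -> 0 <= g x) ->
  \int[mu]_(x in A) f x <= \int[mu]_(x in B) g x.
Proof.
move=> AB fg g0; rewrite (integral_mkcond A) (integral_mkcond B).
have f0 x : 0 <= (f \_ A) x.
  by apply: erestrict_ge0 => y /fg /andP[].
have g0' x : 0 <= (g \_ B) x by apply: erestrict_ge0 => y /g0.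
rewrite !ge0_integralTE//; apply: ereal_sup_le => _ [h hf <-].
exists h => // x.
apply: (le_trans (hf x)); rewrite /patch; case: ifPn => xA.
  by move/set_mem : xA => Ax; rewrite mem_set; [case/andP: (fg x Ax)|exact: AB].
by case: ifPn => // /set_mem /g0.
Qed.

(** Extended by 0 outside [B n], the functions [f n] increase with [n], and monotone convergence
    applies. The integrand moves with [n] because it is itself a truncated inner integral. *)
Lemma cvg_integral_exhaustion A (B : nat -> set T) (f : nat -> T -> \bar R) (g : T -> \bar R) :
  measurable A -> (forall n, measurable (B n)) ->
  (forall n, B n `<=` A) -> (forall n m, (n <= m)%N -> B n `<=` B m) ->
  (forall n, measurable_fun (B n) (f n)) ->
  (forall n x, B n x -> 0 <= f n x) ->
  (forall n m x, (n <= m)%N -> B n x -> f n x <= f m x) ->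
  (forall x, A x -> (f n \_ (B n)) x @[n --> \oo] --> g x) ->
  \int[mu]_(x in B n) f n x @[n --> \oo] --> \int[mu]_(x in A) g x.
Proof.
move=> mA mB BA Bnd mf f0 fnd fg.
have -> : (fun n => \int[mu]_(x in B n) f n x) =
    (fun n => \int[mu]_(x in A) (f n \_ (B n)) x).
  apply/funext => n; rewrite integral_mkcond [RHS]integral_mkcond.
  congr (integral _ _ _); apply/funext => x; rewrite /patch.
  case: ifPn => [/set_mem xB|//]; first by rewrite mem_set//; exact: BA xB.
  by case: ifP.
have gE x : A x -> limn (fun n => (f n \_ (B n)) x) = g x.
  by move=> Ax; apply/cvg_lim => //; exact: fg.
rewrite -(eq_integral _ _ (fun x xA => gE x (set_mem xA))).
apply: cvg_monotone_convergence => //.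
- move=> n; apply: (measurable_funS measurableT) => //.
  exact/(measurable_restrictT _ _).1.
- by move=> n x _; apply: erestrict_ge0 => y; exact: f0.
- move=> x _ n m nm; rewrite /patch; case: ifPn => [/set_mem xB|_].
    by rewrite mem_set; [exact: fnd|exact: Bnd xB].
  by case: ifPn => // /set_mem; exact: f0.
Qed.

End IntegralComparison.

Section ExtendedIntegrals.
Context {R : realType}.
Local Notation mu := (@lebesgue_measure R).
Implicit Types I J K L : R * R.
Local Open Scope ereal_scope.

Lemma EFin_int2 I J f : (J.1 <= J.2)%R -> cont2 I J f ->
  \int[mu]_(x in seg I) \int[mu]_(y in seg J) (f x y)%:E = (int2 I J f)%:E.
Proof.
move=> J12 cf; rewrite /int2 -EFin_int1; last exact: cont2_int.
apply: eq_integral => x; rewrite inE => /segP xI.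
by rewrite -EFin_int1//; exact: cont2_slice1 xI.
Qed.

Lemma EFin_int3 I J K f : (J.1 <= J.2)%R -> (K.1 <= K.2)%R -> cont3 I J K f ->
  \int[mu]_(x in seg I) \int[mu]_(y in seg J) \int[mu]_(z in seg K)
    (f x y z)%:E = (int3 I J K f)%:E.
Proof.
move=> J12 K12 cf; rewrite /int3 -EFin_int1; last exact: cont3_int2.
apply: eq_integral => x; rewrite inE => /segP xI.
by rewrite -EFin_int2//; exact: cont3_slice1 xI.
Qed.

Lemma EFin_int4 I J K L f : (J.1 <= J.2)%R -> (K.1 <= K.2)%R ->
  (L.1 <= L.2)%R -> cont4 I J K L f ->
  \int[mu]_(x in seg I) \int[mu]_(y in seg J) \int[mu]_(z in seg K)
    \int[mu]_(w in seg L) (f x y z w)%:E = (int4 I J K L f)%:E.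
Proof.
move=> J12 K12 L12 cf; rewrite /int4 -EFin_int1; last exact: cont4_int3.
apply: eq_integral => x; rewrite inE => /segP xI.
by rewrite -EFin_int3//; exact: cont4_slice1 xI.
Qed.

End ExtendedIntegrals.

(** * The cutoff and the compactified radius *)

Section Cutoff.
Context {R : realType}.
Implicit Types x : R.

(** The difference quotient is within [|h|] of [df]. Used for the squared positive part, whose kink
    at 0 then needs no separate limit. *)
Lemma is_derive_quadratic_remainder (f : R -> R) a df :
  (forall x, `|f x - f a - df * (x - a)| <= (x - a) ^+ 2) -> is_derive a 1 f df.
Proof.
move=> fa.
have H : (fun h => h^-1 *: ((f \o shift a) (h *: 1) - f a)) @ 0^' --> df.
  apply/cvgrPdist_le => e e0; near=> h.
  have h0 : h != 0 by near: h; exact: nbhs_dnbhs_neq.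
  have := fa (h + a); rewrite /= addrK => fh.
  have -> : df - h^-1 *: (f (h *: 1 + a) - f a) =
      - (h^-1 * (f (h + a) - f a - df * h)).
    rewrite [h *: 1]mulr1 [_ *: _]/(_ * _).
    by rewrite mulrBr mulrCA mulVf// mulr1 opprB.
  rewrite normrN normrM normfV ler_pdivrMl ?normr_gt0//.
  apply: (le_trans fh); rewrite -(ger0_norm (sqr_ge0 h)) normrX expr2 ler_wpM2l//.
  by near: h; apply: dnbhs0_le.
by apply: DeriveDef; [apply/cvg_ex; exists df|exact/cvg_lim].
Unshelve. all: by end_near. Qed.

Definition pos_part x : R := Num.max 0 x.

Lemma pos_part_ge0 x : 0 <= pos_part x.
Proof. by rewrite le_max lexx. Qed.

Lemma continuous_pos_part : continuous pos_part.
Proof. by move=> x; apply: continuous_max; [exact: cvg_cst|exact: cvg_id]. Qed.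

Lemma is_derive_pos_part2 x :
  is_derive x 1 (fun x => pos_part x ^+ 2) (2 * pos_part x).
Proof.
apply: is_derive_quadratic_remainder => y; rewrite ler_norml /pos_part.
have xx := sqr_ge0 (y - x); have yy := sqr_ge0 y; have x2 := sqr_ge0 x.
by case: (leP 0 x) => x0; case: (leP 0 y) => y0; apply/andP; split; nra.
Qed.

(** A step from 1 to 0 across [0, 1]; each squared positive part removes one corner, so that it is
    C^1, as the fundamental theorem on boxes requires. *)
Definition cutoff x : R := pos_part (1 - pos_part x ^+ 2) ^+ 2.

Definition dcutoff x : R :=
  2 * pos_part (1 - pos_part x ^+ 2) * - (2 * pos_part x).

Lemma is_derive_cutoff x : is_derive x 1 cutoff (dcutoff x).
Proof.
apply: (is_derive1_comp (f := fun y => pos_part y ^+ 2)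
  (g := fun y => 1 - pos_part y ^+ 2)); first exact: is_derive_pos_part2.
have H := is_derive_pos_part2 x.
rewrite -[- _]add0r.
by apply: is_deriveB; exact: is_derive_cst.
Qed.

Lemma continuous_cutoff : continuous cutoff.
Proof.
move=> x; apply/differentiable_continuous/derivable1_diffP.
by have [] := is_derive_cutoff x.
Qed.

Lemma continuous_dcutoff : continuous dcutoff.
Proof.
have cp2 : continuous (fun y => 1 - pos_part y ^+ 2).
  move=> y; apply: cvgB; first exact: cvg_cst.
  by rewrite expr2; under eq_fun do rewrite expr2; apply: cvgM;
    exact: continuous_pos_part.
move=> x; apply: cvgM.
  apply: cvgM; first exact: cvg_cst.
  apply: (continuous_comp (f := fun y => 1 - pos_part y ^+ 2)); first exact: cp2.
  exact: continuous_pos_part.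
by apply: cvgN; apply: cvgM; [exact: cvg_cst|exact: continuous_pos_part].
Qed.

Lemma cutoff_ge0 x : 0 <= cutoff x.
Proof. exact: sqr_ge0. Qed.

Lemma cutoff_le1 x : cutoff x <= 1.
Proof.
rewrite -[leRHS](expr1n _ 2) ler_pXn2r ?nnegrE ?pos_part_ge0//.
by rewrite ge_max ler01 gerBl sqr_ge0.
Qed.

Lemma cutoff1 x : x <= 0 -> cutoff x = 1.
Proof.
move=> x0; rewrite /cutoff /pos_part (max_idPl x0) expr0n/= subr0.
by rewrite (max_idPr ler01) expr1n.
Qed.

Lemma cutoff0 x : 1 <= x -> cutoff x = 0.
Proof.
move=> x1; have x0 := le_trans ler01 x1.
rewrite /cutoff /pos_part (max_idPr x0) (max_idPl _) ?expr0n//.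
by rewrite subr_le0 expr_ge1.
Qed.

Lemma dcutoff_le0 x : dcutoff x <= 0.
Proof. by rewrite /dcutoff mulrN oppr_le0 !mulr_ge0 ?pos_part_ge0. Qed.

Lemma dcutoff0 x : x <= 0 -> dcutoff x = 0.
Proof. by move=> x0; rewrite /dcutoff /pos_part (max_idPl x0) mulr0 oppr0 mulr0. Qed.

End Cutoff.

(** * Bounds on R and R' from the hyperboloidal coordinates *)

Section Hyperboloidal.
Context {R : realType} (n r0 rI : R) (Rc H : R -> R).
Hypothesis hyp : hyperboloidal n r0 rI Rc H.
Hypothesis n12 : 1 < n <= 2.

Lemma left_nbhs_segment (P : R -> Prop) a b : a < b ->
  (\forall x \near b^'-, P x) -> exists2 c, a <= c < b & forall x, c <= x < b -> P x.
Proof.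
move=> ab [e /= e0 eP]; exists (Num.max a (b - e / 2)).
  by rewrite le_max lexx/= gt_max ab/= ltrBlDr ltrDl divr_gt0.
move=> x /andP[]; rewrite ge_max => /andP[_ ex] xb; apply: eP => //.
by rewrite /ball/= ger0_norm ?subr_ge0 ?ltW//; lra.
Qed.

(** [|1 - 1/R'| < 1] says 0 < 1/R' < 2, which gives the sign of R' together with the bound. *)
Lemma dRc_gt_half r : r0 <= r < rI -> 1 < 2 * derive1 Rc r.
Proof.
move=> rr; have := hyp_spacelike hyp rr.
have Hd := hyp_height hyp rr.
rewrite derive1E derive_val ltr_norml => /andP[h1 h2].
have i0 : 0 < (derive1 Rc r)^-1 by lra.
have i2 : (derive1 Rc r)^-1 < 2 by lra.
have d0 : 0 < derive1 Rc r by rewrite -invr_gt0.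
by move: i2; rewrite invf_plt ?posrE// => i2; lra.
Qed.

Lemma dRc_gt0 r : r0 <= r < rI -> 0 < derive1 Rc r.
Proof. by move=> /dRc_gt_half; lra. Qed.

Lemma Rc_continuous r1 : r1 < rI -> {within `[r0, r1], continuous Rc}.
Proof.
move=> r1I; apply: derivable_within_continuous => r; rewrite in_itv/= => /andP[h1 h2].
by apply: (hyp_derivable hyp); rewrite h1 (le_lt_trans h2).
Qed.

Lemma dRc_continuous r1 : r1 < rI -> {within `[r0, r1], continuous (derive1 Rc)}.
Proof.
move=> r1I; apply: continuous_subspaceW (hyp_C1 hyp) => r /=.
by rewrite !in_itv/= => /andP[-> /le_lt_trans]; exact.
Qed.

Lemma Rc_lt x y : r0 <= x -> x < y -> y < rI -> Rc x < Rc y.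
Proof.
move=> rx xy yI; apply: (@gtr0_derive1_incr _ Rc r0 y) => // [z|z|].
- rewrite in_itv/= => /andP[z1 z2]; apply: (hyp_derivable hyp).
  by rewrite ltW//= (lt_trans z2).
- by rewrite in_itv/= => /andP[z1 z2]; apply: dRc_gt0; rewrite ltW//= (lt_trans z2).
- exact: Rc_continuous.
Qed.

Lemma Rc_le x y : r0 <= x -> x <= y -> y < rI -> Rc x <= Rc y.
Proof.
move=> rx; rewrite le_eqVlt => /predU1P[->//|xy] yI.
exact/ltW/Rc_lt.
Qed.

Lemma Rc_gt0 r : r0 <= r < rI -> 0 < Rc r.
Proof.
move=> /andP[r1 r2]; apply: lt_le_trans (hyp_pos hyp) _.
exact: Rc_le.
Qed.

(** Once R >= 1 and R >= 1/c1, one has R' >= c1 R^n >= c1 R >= 1. The cutoff will vary only in this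
    range. *)
Lemma dRc_eventually_ge1 : exists2 r1, r0 <= r1 < rI &
  forall r, r1 <= r < rI -> 1 <= derive1 Rc r.
Proof.
have [c1 [c2 [c10 c20 c12]]] := hyp_rate hyp.
apply: left_nbhs_segment; first exact: hyp_lt hyp.
have /cvgryPge Roo := hyp_infinity hyp.
near=> r; apply: (@le_trans _ _ (c1 * Rc r `^ n)); last first.
  by have /andP[] : c1 * (Rc r `^ n) <= derive1 Rc r <= c2 * (Rc r `^ n) by near: r.
have R1 : 1 <= Rc r by near: r; exact: Roo.
have Rc1 : c1^-1 <= Rc r by near: r; exact: Roo.
rewrite -(@ler_pM2l _ c1^-1) ?invr_gt0// mulr1 mulKf ?gt_eqF//.
apply: (le_trans Rc1); rewrite -{1}[Rc r]powRr1 ?(le_trans ler01)//.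
by apply: ler_powR => //; apply: ltW; case/andP: n12.
Unshelve. all: by end_near. Qed.

(** This provides the [C] of the theorem. Near null infinity R' <= c2 R^n <= c2 R^2; on the
    remaining compact range the extreme value theorem bounds R' and R' / (2R' - 1). The second
    inequality serves z, whose coefficient 2R' - 1 in the energy may be small. *)
Lemma dRc_quadratic_bound : exists2 C, 0 < C & forall r, r0 <= r < rI ->
  derive1 Rc r <= C * Rc r ^+ 2 /\
  derive1 Rc r <= C * Rc r ^+ 2 * (2 * derive1 Rc r - 1).
Proof.
have [c1 [c2 [c10 c20 c12]]] := hyp_rate hyp.
have /cvgryPge Roo := hyp_infinity hyp.
have [r1 r1I tail1] := dRc_eventually_ge1.
have [r2 /andP[r02 r2I] tail2] : exists2 r2, r0 <= r2 < rI &
    forall r, r2 <= r < rI -> 1 <= Rc r /\ derive1 Rc r <= c2 * Rc r ^+ 2.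
  apply: left_nbhs_segment; first exact: hyp_lt hyp.
  near=> r; have R1 : 1 <= Rc r by near: r; exact: Roo.
  split => //; have /andP[_ /le_trans] :
    c1 * (Rc r `^ n) <= derive1 Rc r <= c2 * (Rc r `^ n) by near: r.
  apply; rewrite ler_pM2l// -powR_mulrn ?(le_trans ler01)//.
  by apply: ler_powR => //; case/andP: n12.
pose r3 := Num.max r1 r2.
have r03 : r0 <= r3 by rewrite le_max r02 orbT.
have r3I : r3 < rI by rewrite gt_max r2I; case/andP: r1I => _ ->.
have r03I r : r \in `[r0, r3] -> r0 <= r < rI.
  by rewrite in_itv/= => /andP[-> /le_lt_trans]; exact.
have cd := dRc_continuous r3I.
have [M1 M1r maxM1] := EVT_max r03 cd.
have [M2 M2r maxM2] : exists2 c, c \in `[r0, r3] & forall t, t \in `[r0, r3] ->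
    derive1 Rc t / (2 * derive1 Rc t - 1) <= derive1 Rc c / (2 * derive1 Rc c - 1).
  apply: (EVT_max (f := fun t => derive1 Rc t / (2 * derive1 Rc t - 1))) => //.
  apply: withinM => //; apply: withinV.
    by move=> r /= /r03I /dRc_gt_half h; rewrite gt_eqF// subr_gt0.
  by apply: withinB; [apply: withinM => //|]; exact: within_cst.
set m1 := derive1 Rc M1 in maxM1; set m2 := (_ / _) in maxM2.
have m10 : 0 < m1 by apply: dRc_gt0; exact: r03I.
have m20 : 0 < m2.
  rewrite divr_gt0//; first by apply: dRc_gt0; exact: r03I.
  by rewrite subr_gt0; apply: dRc_gt_half; exact: r03I.
have R00 := hyp_pos hyp.
have R02 : 0 < Rc r0 ^+ 2 by rewrite exprn_gt0.
have q1 : 0 < m1 / Rc r0 ^+ 2 by rewrite divr_gt0.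
have q2 : 0 < m2 / Rc r0 ^+ 2 by rewrite divr_gt0.
(* One summand for each of the four inequalities: two on the compact range, two near null
   infinity. *)
exists (m1 / Rc r0 ^+ 2 + m2 / Rc r0 ^+ 2 + c2 + 1); first by rewrite !addr_gt0.
move=> r /[dup] rI' /andP[r0r rI''].
have d1 := dRc_gt_half rI'; have d0 := dRc_gt0 rI'.
have Rge : Rc r0 ^+ 2 <= Rc r ^+ 2.
  have Rr0 := ltW (Rc_gt0 rI').
  by rewrite ler_pXn2r ?nnegrE//; [exact: Rc_le|exact: ltW].
have R2 : 0 < Rc r ^+ 2 by exact: lt_le_trans Rge.
have [rr3|r3r] := leP r r3.
  have rin : r \in `[r0, r3] by rewrite in_itv/= r0r.
  have e1 : derive1 Rc r <= m1 / Rc r0 ^+ 2 * Rc r ^+ 2.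
    apply: (le_trans (maxM1 _ rin)); rewrite mulrAC ler_pdivlMr//.
    by rewrite ler_pM2l.
  have e2 : derive1 Rc r <= m2 / Rc r0 ^+ 2 * Rc r ^+ 2 * (2 * derive1 Rc r - 1).
    have := maxM2 _ rin; rewrite ler_pdivrMr ?subr_gt0// => /le_trans; apply.
    rewrite ler_pM2r ?subr_gt0// mulrAC ler_pdivlMr//.
    by rewrite ler_pM2l.
  split; first by apply: (le_trans e1); rewrite ler_pM2r//; lra.
  apply: (le_trans e2); rewrite ler_pM2r ?subr_gt0// ler_pM2r//; lra.
have /andP[r1r r2r] : (r1 <= r) && (r2 <= r).
  by move: (ltW r3r); rewrite ge_max.
have := tail1 r; rewrite r1r rI'' => /(_ isT) t1.
have := tail2 r; rewrite r2r rI'' => /(_ isT) [t2 t3].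
split; first by apply: (le_trans t3); rewrite ler_pM2r//; lra.
have R21 : 1 <= Rc r ^+ 2 by rewrite expr_ge1// ltW// Rc_gt0.
(* Here R' >= 1, so R' <= 2R' - 1 already; both [C] and R^2 are at least 1. *)
apply: (@le_trans _ _ (1 * 1 * (2 * derive1 Rc r - 1))); first by lra.
by rewrite ler_pM2r ?subr_gt0// ler_pM//; lra.
Unshelve. all: by end_near. Qed.

End Hyperboloidal.

(** * Pointwise identities *)

Section PointwiseIdentities.
Context {R : realType}.

(** With [a], [rho], [S] standing for R', R, sin(theta): the integrand of E^2 times the factor R'
    R^2 of dV, to be integrated against dr dOmega. *)
Definition energy_density (a rho S u v w1 w2 : R) : R :=
  2^-1 * u ^+ 2 + (2 * a - 1) / (2 * rho ^+ 2) * v ^+ 2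
  + a / rho ^+ 2 * w1 ^+ 2 + a / (rho ^+ 2 * S ^+ 2) * w2 ^+ 2.

(** Discarding the angular terms leaves what absorbs the source and fixes the sign of the cutoff
    term. *)
Lemma energy_density_ge (a rho S u v w1 w2 : R) : 1 < 2 * a -> 0 < rho ->
  2^-1 * u ^+ 2 + (2 * a - 1) / 2 * (v / rho) ^+ 2
    <= energy_density a rho S u v w1 w2.
Proof.
move=> a1 rho0; have a0 : 0 <= a by lra.
have -> : (2 * a - 1) / 2 * (v / rho) ^+ 2 =
    (2 * a - 1) / (2 * rho ^+ 2) * v ^+ 2 by field; lra.
rewrite /energy_density -[leRHS]addrA lerDl addr_ge0//.
  by rewrite mulr_ge0 ?sqr_ge0// divr_ge0 ?sqr_ge0.
by rewrite mulr_ge0 ?sqr_ge0// divr_ge0// mulr_ge0 ?sqr_ge0.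
Qed.

Lemma energy_density_ge0 (a rho S u v w1 w2 : R) : 1 < 2 * a -> 0 < rho ->
  0 <= energy_density a rho S u v w1 w2.
Proof.
move=> a1 rho0; apply: le_trans (energy_density_ge S u v w1 w2 a1 rho0).
by rewrite addr_ge0// mulr_ge0 ?sqr_ge0//; lra.
Qed.

(* [ut], [ur] are the derivatives of [u] in [t], [r]; [uA], [uB] those in the
   two angles, and similarly for the other fields. *)
Lemma weighted_divergence_identity (a rho p S Co chi chis chir : R)
    (u ut ur uA uB v vt vr vA vB w1 w1t w1A w2 w2t w2B F : R) :
  a != 0 -> rho != 0 -> S != 0 ->
  rho^-1 * (a^-1 * (ut + ur) + p / rho * u)
    - rho^-1 * ((rho ^+ 2)^-1 * (w1A + (S ^+ 2)^-1 * w2B))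
    = Co / S / rho ^+ 3 * w1 - p / rho ^+ 3 * v - F ->
  (rho ^+ 2)^-1 * ((2 * a - 1) / a * vt - a^-1 * vr)
    - rho^-1 * ((rho ^+ 2)^-1 * (w1A + (S ^+ 2)^-1 * w2B)) + p / rho ^+ 2 * u
    = Co / S / rho ^+ 3 * w1 - (p + 1) / rho ^+ 3 * v - F ->
  2 * w1t - uA - rho^-1 * vA = 0 ->
  2 * w2t - uB - rho^-1 * vB = 0 ->
  (chis * energy_density a rho S u v w1 w2
   + chi * (u * ut + (2 * a - 1) / rho ^+ 2 * (v * vt)
            + 2 * (a / rho ^+ 2) * (w1 * w1t)
            + 2 * (a / (rho ^+ 2 * S ^+ 2)) * (w2 * w2t))) * S
  + (chir * (2^-1 * (u ^+ 2 - (v / rho) ^+ 2))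
     + chi * (u * ur - v * vr / rho ^+ 2 + v ^+ 2 * a / rho ^+ 3)) * S
  - chi * a / rho ^+ 2 * ((uA + vA / rho) * (w1 * S)
      + (u + v / rho) * (w1A * S + w1 * Co))
  - chi * a / rho ^+ 2 / S * ((uB + vB / rho) * w2 + (u + v / rho) * w2B)
  = S * (chis * energy_density a rho S u v w1 w2
         + chir * (2^-1 * (u ^+ 2 - (v / rho) ^+ 2))
         - chi * (a * (p / rho * (u + v / rho) ^+ 2 + rho * F * (u + v / rho)))).
Proof.
move=> a0 rho0 S0 E1 E2 E3 E4.
(* Each equation is solved for one derivative, and a rational identity remains. The cotangent terms
   cancel against the derivative of sin(theta) in the theta-current, and the extra 1 in [p + 1]
   against the derivative of 1/R in z. *)
have -> : ut = - ur + a * rho * (rho^-1 * ((rho ^+ 2)^-1 * (w1A + (S ^+ 2)^-1 * w2B))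
    + (Co / S / rho ^+ 3 * w1 - p / rho ^+ 3 * v - F)) - a * (p / rho * u).
  by rewrite -E1; field; rewrite a0 S0 rho0.
have -> : vr = (2 * a - 1) * vt - a * rho ^+ 2 *
    (rho^-1 * ((rho ^+ 2)^-1 * (w1A + (S ^+ 2)^-1 * w2B)) - p / rho ^+ 2 * u
     + (Co / S / rho ^+ 3 * w1 - (p + 1) / rho ^+ 3 * v - F)).
  by rewrite -E2; field; rewrite a0 S0 rho0.
have -> : w1t = 2^-1 * (uA + rho^-1 * vA) by move: E3; lra.
have -> : w2t = 2^-1 * (uB + rho^-1 * vB) by move: E4; lra.
by rewrite /energy_density; field; rewrite S0 rho0.
Qed.

Lemma weighted_source_bound (a rho p S C E k dk u v w1 w2 F : R) :
  1 < 2 * a -> 0 < rho -> 0 < C -> 0 <= E -> 0 <= k -> dk <= 0 ->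
  (dk = 0 \/ 1 <= a) ->
  a <= C * rho ^+ 2 -> a <= C * rho ^+ 2 * (2 * a - 1) ->
  E * (- C * k + dk) * energy_density a rho S u v w1 w2
    + E * dk * a * (2^-1 * (u ^+ 2 - (v / rho) ^+ 2))
    - E * k * (a * (p / rho * (u + v / rho) ^+ 2 + rho * F * (u + v / rho)))
  <= - (E * k * (a * p / rho * (u + v / rho) ^+ 2))
     + E * k * (a * rho ^+ 4 * F ^+ 2) + 2^-1 * (E * dk * a * u ^+ 2).
Proof.
move=> a1 rho0 C0 E0 k0 dk0 dka aC1 aC2.
have := energy_density_ge S u v w1 w2 a1 rho0.
set e := energy_density _ _ _ _ _ _ _; set z := v / rho => ge_e.
have a0 : 0 < a by lra.
have H1 : E * dk * (e - 2^-1 * a * z ^+ 2) <= 0.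
  case: dka => [->|a1']; first by rewrite mulr0 mul0r.
  rewrite mulr_le0_ge0 ?mulr_ge0_le0//.
  rewrite subr_ge0; apply: le_trans ge_e.
  have := sqr_ge0 z; have := sqr_ge0 u; nra.
have H2 : - (a * (rho * F * (u + z))) <= a * rho ^+ 4 * F ^+ 2 + C * e.
  have H3 : - (rho * F * (u + z)) <= rho ^+ 4 * F ^+ 2 + (u ^+ 2 + z ^+ 2) / 2 / rho ^+ 2.
    (* The powers of [rho] are balanced so that F gets R' R^4 F^2, the density of R^2 F^2 dV, and
       the fields get the weight R'/R^2, which is bounded. *)
    have := sqr_ge0 (rho ^+ 2 * F + (u + z) / (2 * rho)).
    have -> : (rho ^+ 2 * F + (u + z) / (2 * rho)) ^+ 2 =
      rho ^+ 4 * F ^+ 2 + rho * F * (u + z) + (u + z) ^+ 2 / 4 / rho ^+ 2.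
      by field; lra.
    have : 0 <= (u - z) ^+ 2 / 4 / rho ^+ 2 by rewrite !divr_ge0 ?sqr_ge0.
    have : (u + z) ^+ 2 / 4 / rho ^+ 2 + (u - z) ^+ 2 / 4 / rho ^+ 2 =
      (u ^+ 2 + z ^+ 2) / 2 / rho ^+ 2 by field; lra.
    lra.
  have H4 : a * ((u ^+ 2 + z ^+ 2) / 2 / rho ^+ 2) <= C * e.
    have r2 : 0 < rho ^+ 2 by rewrite exprn_gt0.
    rewrite mulrA ler_pdivrMr//.
    apply: (@le_trans _ _ (C * (2^-1 * u ^+ 2 + (2 * a - 1) / 2 * z ^+ 2) * rho ^+ 2)).
      have := ler_wpM2r (sqr_ge0 u) aC1; have := ler_wpM2r (sqr_ge0 z) aC2.
      nra.
    by rewrite ler_pM2r// ler_pM2l.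
  have := ler_wpM2l (ltW a0) H3; lra.
have Ek : 0 <= E * k by rewrite mulr_ge0.
have := ler_wpM2l Ek H2.
have -> : a * p / rho = a * (p / rho) by rewrite mulrA.
move: H1; lra.
Qed.

End PointwiseIdentities.

(** * Derivatives of explicit expressions *)

Section DerivativeRules.
Context {R : realType}.
Implicit Types (f g : R -> R) (x : R).

(** These rules conclude on explicit functions and compose as terms: each current is differentiated
    by one such term, and a [ring] or [field] step then normalises the derivative. *)
Lemma is_derive_mul f g x df dg : is_derive x 1 f df -> is_derive x 1 g dg ->
  is_derive x 1 (fun y => f y * g y) (df * g x + f x * dg).
Proof.
move=> hf hg; have := is_deriveM hf hg => h.
by apply: is_derive_eq h _; rewrite addrC [_ *: _]mulrC.
Qed.

Lemma is_derive_add f g x df dg : is_derive x 1 f df -> is_derive x 1 g dg ->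
  is_derive x 1 (fun y => f y + g y) (df + dg).
Proof. by move=> hf hg; exact: is_deriveD. Qed.

Lemma is_derive_opp f x df : is_derive x 1 f df ->
  is_derive x 1 (fun y => - f y) (- df).
Proof. by move=> hf; exact: is_deriveN. Qed.

Lemma is_derive_const (c x : R) : is_derive x 1 (fun=> c) 0.
Proof. exact: is_derive_cst. Qed.

Lemma is_derive_scale (c : R) f x df : is_derive x 1 f df ->
  is_derive x 1 (fun y => c * f y) (c * df).
Proof. by move=> hf; exact: is_deriveZ. Qed.

Lemma is_derive_sqr f x df : is_derive x 1 f df ->
  is_derive x 1 (fun y => f y ^+ 2) (2 * (f x * df)).
Proof.
move=> hf; apply: is_derive_eq (is_derive_mul hf hf) _.
by ring.
Qed.

Lemma is_derive_exprn f x df n : is_derive x 1 f df ->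
  is_derive x 1 (fun y => f y ^+ n) (n%:R * f x ^+ n.-1 * df).
Proof.
move=> hf; elim: n => [|n ih].
  by rewrite !mul0r; under eq_fun do rewrite expr0; exact: is_derive_const.
under eq_fun do rewrite exprS.
apply: is_derive_eq (is_derive_mul hf ih) _.
case: n {ih} => [|n] /=; first by rewrite expr0; ring.
by rewrite -[in RHS]natr1 !exprS; ring.
Qed.

Lemma is_derive_inv f x df : f x != 0 -> is_derive x 1 f df ->
  is_derive x 1 (fun y => (f y)^-1) (- df / f x ^+ 2).
Proof.
move=> fx0 [df1 df2]; apply: DeriveDef; first exact: derivableV.
by rewrite deriveV// df2 /GRing.scale/=; field.
Qed.

Lemma is_derive_chain f g x df dg : is_derive x 1 g dg -> is_derive (g x) 1 f df ->
  is_derive x 1 (fun y => f (g y)) (df * dg).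
Proof. by move=> hg hf; exact: is_derive1_comp. Qed.

Lemma is_derive_ident x : is_derive x 1 (fun y => y) 1.
Proof. exact: is_derive_id. Qed.

End DerivativeRules.

(** * Continuity of expressions on boxes, and comparison of integrals over nested boxes *)

Section BoxContinuity.
Context {R : realType}.
Implicit Types I J K L : R * R.

Lemma cont4D I J K L f g : cont4 I J K L f -> cont4 I J K L g ->
  cont4 I J K L (fun s r th ph => f s r th ph + g s r th ph).
Proof. exact: withinD. Qed.

Lemma cont4M I J K L f g : cont4 I J K L f -> cont4 I J K L g ->
  cont4 I J K L (fun s r th ph => f s r th ph * g s r th ph).
Proof. exact: withinM. Qed.

Lemma cont4N I J K L f : cont4 I J K L f ->
  cont4 I J K L (fun s r th ph => - f s r th ph).
Proof. exact: withinN. Qed.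

Lemma cont4X I J K L f n : cont4 I J K L f ->
  cont4 I J K L (fun s r th ph => f s r th ph ^+ n).
Proof. exact: withinX. Qed.

Lemma cont4_cst I J K L (c : R) : cont4 I J K L (fun _ _ _ _ => c).
Proof. exact: within_cst. Qed.

Lemma cont4V I J K L f :
  (forall s r th ph, I.1 <= s <= I.2 -> J.1 <= r <= J.2 -> K.1 <= th <= K.2 ->
    L.1 <= ph <= L.2 -> f s r th ph != 0) ->
  cont4 I J K L f -> cont4 I J K L (fun s r th ph => (f s r th ph)^-1).
Proof.
move=> f0; apply: withinV => -[[[s r] th] ph] [[[/segP sI /segP rJ] /segP thK] /segP phL].
exact: f0.
Qed.

Lemma eq_cont4 I J K L f g :
  (forall s r th ph, I.1 <= s <= I.2 -> J.1 <= r <= J.2 -> K.1 <= th <= K.2 ->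
    L.1 <= ph <= L.2 -> f s r th ph = g s r th ph) ->
  cont4 I J K L f -> cont4 I J K L g.
Proof.
move=> fg; apply: eq_within => -[[[s r] th] ph].
by move=> [[[/segP sI /segP rJ] /segP thK] /segP phL]; exact: fg.
Qed.

Lemma cont4_comp I J K L (h : R -> R) f : continuous h -> cont4 I J K L f ->
  cont4 I J K L (fun s r th ph => h (f s r th ph)).
Proof. by move=> ch cf x; apply: continuous_comp; [exact: cf|exact: ch]. Qed.

Lemma cont4_fun1 I J K L (h : R -> R) : cont1 I h ->
  cont4 I J K L (fun s _ _ _ => h s).
Proof.
move=> ch; apply: (within_comp ch (g := fun x => x.1.1.1)) => [|x [[[? ?] ?] ?] //].
have c2 : continuous (fun x : R * R * R * R => x.1.1).
  by move=> x; apply: (@cvg_comp _ _ _ fst fst); exact: cvg_fst.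
move=> x; apply: (continuous_comp (f := fun x : R * R * R * R => x.1.1) (g := fst)).
  exact: c2.
exact: cvg_fst.
Qed.

Lemma cont4_fun2 I J K L (h : R -> R) : cont1 J h ->
  cont4 I J K L (fun _ r _ _ => h r).
Proof.
move=> ch; apply: (within_comp ch (g := fun x => x.1.1.2)) => [|x [[[? ?] ?] ?] //].
have c2 : continuous (fun x : R * R * R * R => x.1.1).
  by move=> x; apply: (@cvg_comp _ _ _ fst fst); exact: cvg_fst.
move=> x; apply: (continuous_comp (f := fun x : R * R * R * R => x.1.1) (g := snd)).
  exact: c2.
exact: cvg_snd.
Qed.

Lemma cont4_fun3 I J K L (h : R -> R) : cont1 K h ->
  cont4 I J K L (fun _ _ th _ => h th).
Proof.
move=> ch; apply: (within_comp ch (g := fun x => x.1.2)) => [|x [[? ?] ?] //].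
by move=> x; apply: (@cvg_comp _ _ _ fst snd); [exact: cvg_fst|exact: cvg_snd].
Qed.

(** Proved through extended integrals, where enlarging the domain of a nonnegative integrand is
    direct. This and its iterates let the left-hand terms live on a smaller box than the energy
    inequality. *)
Lemma le_int1_sub (I I' : R * R) f g : cont1 I' f -> cont1 I g ->
  I.1 <= I'.1 -> I'.2 <= I.2 ->
  (forall x, I'.1 <= x <= I'.2 -> 0 <= f x <= g x) ->
  (forall x, I.1 <= x <= I.2 -> 0 <= g x) ->
  int1 I'.1 I'.2 f <= int1 I.1 I.2 g.
Proof.
move=> cf cg I1 I2 fg g0; rewrite -lee_fin -!EFin_int1//.
apply: le_integral_subset => [x|x|x] /=; rewrite !in_itv/=.
- by move=> /andP[x1 x2]; rewrite (le_trans I1)//= (le_trans x2).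
- by rewrite !lee_fin; exact: fg.
- by rewrite lee_fin; exact: g0.
Qed.

Lemma int1_ge0 a b (f : R -> R) : (forall x, a <= x <= b -> 0 <= f x) ->
  0 <= int1 a b f.
Proof. by move=> f0; apply: Rintegral_ge0 => x /=; rewrite in_itv/=; exact: f0. Qed.

Lemma le_int2_sub I I' J J' f g : J.1 <= J.2 -> J'.1 <= J'.2 ->
  cont2 I' J' f -> cont2 I J g ->
  I.1 <= I'.1 -> I'.2 <= I.2 -> J.1 <= J'.1 -> J'.2 <= J.2 ->
  (forall x y, I'.1 <= x <= I'.2 -> J'.1 <= y <= J'.2 -> 0 <= f x y <= g x y) ->
  (forall x y, I.1 <= x <= I.2 -> J.1 <= y <= J.2 -> 0 <= g x y) ->
  int2 I' J' f <= int2 I J g.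
Proof.
move=> J12 J12' cf cg I1 I2 J1 J2 fg g0; apply: le_int1_sub => //.
- exact: cont2_int.
- exact: cont2_int.
- move=> x xI'; have xI : I.1 <= x <= I.2.
    by case/andP: xI' => x1 x2; rewrite (le_trans I1)//= (le_trans x2).
  apply/andP; split; first by apply: int1_ge0 => y yJ; case/andP: (fg x y xI' yJ).
  apply: le_int1_sub => // [||y yJ|y yJ]; [|..|exact: fg|exact: g0].
    exact: cont2_slice1 cf xI'.
  exact: cont2_slice1 cg xI.
- by move=> x xI; apply: int1_ge0 => y yJ; exact: g0.
Qed.

Lemma le_int3_sub I I' J J' K K' f g : J.1 <= J.2 -> J'.1 <= J'.2 ->
  K.1 <= K.2 -> K'.1 <= K'.2 -> cont3 I' J' K' f -> cont3 I J K g ->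
  I.1 <= I'.1 -> I'.2 <= I.2 -> J.1 <= J'.1 -> J'.2 <= J.2 ->
  K.1 <= K'.1 -> K'.2 <= K.2 ->
  (forall x y z, I'.1 <= x <= I'.2 -> J'.1 <= y <= J'.2 -> K'.1 <= z <= K'.2 ->
    0 <= f x y z <= g x y z) ->
  (forall x y z, I.1 <= x <= I.2 -> J.1 <= y <= J.2 -> K.1 <= z <= K.2 ->
    0 <= g x y z) ->
  int3 I' J' K' f <= int3 I J K g.
Proof.
move=> J12 J12' K12 K12' cf cg I1 I2 J1 J2 K1 K2 fg g0; apply: le_int1_sub => //.
- exact: cont3_int2.
- exact: cont3_int2.
- move=> x xI'; have xI : I.1 <= x <= I.2.
    by case/andP: xI' => x1 x2; rewrite (le_trans I1)//= (le_trans x2).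
  apply/andP; split.
    apply: int1_ge0 => y yJ; apply: int1_ge0 => z zK.
    by case/andP: (fg x y z xI' yJ zK).
  apply: le_int2_sub => // [||y z yJ zK|y z yJ zK]; [|..|exact: fg|exact: g0].
    exact: cont3_slice1 cf xI'.
  exact: cont3_slice1 cg xI.
- move=> x xI; apply: int1_ge0 => y yJ; apply: int1_ge0 => z zK; exact: g0.
Qed.

Lemma le_int4_sub I I' J J' K K' L L' f g : J.1 <= J.2 -> J'.1 <= J'.2 ->
  K.1 <= K.2 -> K'.1 <= K'.2 -> L.1 <= L.2 -> L'.1 <= L'.2 ->
  cont4 I' J' K' L' f -> cont4 I J K L g ->
  I.1 <= I'.1 -> I'.2 <= I.2 -> J.1 <= J'.1 -> J'.2 <= J.2 ->
  K.1 <= K'.1 -> K'.2 <= K.2 -> L.1 <= L'.1 -> L'.2 <= L.2 ->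
  (forall x y z w, I'.1 <= x <= I'.2 -> J'.1 <= y <= J'.2 -> K'.1 <= z <= K'.2 ->
    L'.1 <= w <= L'.2 -> 0 <= f x y z w <= g x y z w) ->
  (forall x y z w, I.1 <= x <= I.2 -> J.1 <= y <= J.2 -> K.1 <= z <= K.2 ->
    L.1 <= w <= L.2 -> 0 <= g x y z w) ->
  int4 I' J' K' L' f <= int4 I J K L g.
Proof.
move=> J12 J12' K12 K12' L12 L12' cf cg I1 I2 J1 J2 K1 K2 L1 L2 fg g0.
apply: le_int1_sub => //.
- exact: cont4_int3.
- exact: cont4_int3.
- move=> x xI'; have xI : I.1 <= x <= I.2.
    by case/andP: xI' => x1 x2; rewrite (le_trans I1)//= (le_trans x2).
  apply/andP; split.
    apply: int1_ge0 => y yJ; apply: int1_ge0 => z zK; apply: int1_ge0 => w wL.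
    by case/andP: (fg x y z w xI' yJ zK wL).
  apply: le_int3_sub => // [||y z w yJ zK wL|y z w yJ zK wL]; [|..|exact: fg|exact: g0].
    exact: cont4_slice1 cf xI'.
  exact: cont4_slice1 cg xI.
- move=> x xI; apply: int1_ge0 => y yJ; apply: int1_ge0 => z zK.
  apply: int1_ge0 => w wL; exact: g0.
Qed.

End BoxContinuity.

(** * The weighted energy current *)

Section EnergyCurrents.
Context {R : realType} (n r0 rI : R) (Rc H : R -> R).
Hypothesis hyp : hyperboloidal n r0 rI Rc H.
Context (p : nat) (F u v w1 w2 : stfun R) (t : R).
Hypothesis t0 : 0 <= t.
Hypothesis reg : regular_fields r0 rI t (Fields u v w1 w2).
Hypothesis sys : ugly_system r0 rI t Rc p F (Fields u v w1 w2).
Local Notation a := (derive1 Rc).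
Local Notation region := (region r0 rI t).

Lemma region_cont4 f I J K L : {within region, continuous (joint f)} ->
  0 <= I.1 -> I.2 <= t -> r0 <= J.1 -> J.2 < rI -> 0 < K.1 -> K.2 < pi ->
  cont4 I J K L f.
Proof.
move=> cf I1 I2 J1 J2 K1 K2; apply: continuous_subspaceW cf => -[[[s r] th] ph].
move=> [[[/segP/andP[s1 s2] /segP/andP[q1 q2]] /segP/andP[k1 k2]] _].
split => /=.
- by rewrite (le_trans I1)// (le_trans s2).
- by rewrite (le_trans J1)// (le_lt_trans q2).
- by rewrite (lt_le_trans K1)// (le_lt_trans k2).
Qed.

Lemma C1_region_derivatives f (s r th ph : R) : C1_region r0 rI t f ->
  region (s, r, th, ph) ->
  [/\ is_derive s 1 (fun x => f x r th ph) (d_t f s r th ph),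
      is_derive r 1 (fun x => f s x th ph) (d_r f s r th ph),
      is_derive th 1 (fun x => f s r x ph) (d_th f s r th ph) &
      is_derive ph 1 (fun x => f s r th x) (d_ph f s r th ph)].
Proof.
move=> [df _ _ _ _] /df [d1 d2 d3 d4].
by split; [exact: (DeriveDef d1 (esym (derive1E _ _)))
  |exact: (DeriveDef d2 (esym (derive1E _ _)))
  |exact: (DeriveDef d3 (esym (derive1E _ _)))
  |exact: (DeriveDef d4 (esym (derive1E _ _)))].
Qed.

Let Cu : C1_region r0 rI t u. Proof. have [h _ _ _] := reg_C1 reg; exact: h. Qed.
Let Cv : C1_region r0 rI t v. Proof. have [_ h _ _] := reg_C1 reg; exact: h. Qed.
Let Cw1 : C1_region r0 rI t w1. Proof. have [_ _ h _] := reg_C1 reg; exact: h. Qed.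
Let Cw2 : C1_region r0 rI t w2. Proof. have [_ _ _ h] := reg_C1 reg; exact: h. Qed.

Lemma is_derive_Rc (r : R) : r0 <= r < rI -> is_derive r 1 Rc (a r).
Proof.
by move=> rr; apply: DeriveDef; [exact: (hyp_derivable hyp)|rewrite -derive1E].
Qed.

(** Once the product R^p u is differentiated, R^p divides out and leaves the damping term p u /
    R. *)
Lemma ugly_system_expanded (s r th ph : R) : region (s, r, th, ph) ->
  [/\ (Rc r)^-1 * ((a r)^-1 * (d_t u s r th ph + d_r u s r th ph)
          + p%:R / Rc r * u s r th ph)
        - (Rc r)^-1 * ((Rc r ^+ 2)^-1 * (d_th w1 s r th ph
            + (sin th ^+ 2)^-1 * d_ph w2 s r th ph))
      = cos th / sin th / Rc r ^+ 3 * w1 s r th ph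
        - p%:R / Rc r ^+ 3 * v s r th ph - F s r th ph,
      (Rc r ^+ 2)^-1 * ((2 * a r - 1) / a r * d_t v s r th ph
          - (a r)^-1 * d_r v s r th ph)
        - (Rc r)^-1 * ((Rc r ^+ 2)^-1 * (d_th w1 s r th ph
            + (sin th ^+ 2)^-1 * d_ph w2 s r th ph))
        + p%:R / Rc r ^+ 2 * u s r th ph
      = cos th / sin th / Rc r ^+ 3 * w1 s r th ph
        - (p%:R + 1) / Rc r ^+ 3 * v s r th ph - F s r th ph,
      2 * d_t w1 s r th ph - d_th u s r th ph - (Rc r)^-1 * d_th v s r th ph = 0 &
      2 * d_t w2 s r th ph - d_ph u s r th ph - (Rc r)^-1 * d_ph v s r th ph = 0].
Proof.
move=> reg'; have [E1 E2 E3 E4] := sys reg'; split => //; last first.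
  by move: E2; rewrite -natr1.
have [_ rr _] : [/\ 0 <= s <= t, r0 <= r < rI & 0 < th < pi] := reg'.
have Rc0 := Rc_gt0 hyp rr; have Rn0 : Rc r != 0 by rewrite gt_eqF.
rewrite -E1 /nabla_psi /ang_div; congr (_ - _).
have [ut ur _ _] := C1_region_derivatives Cu reg'.
have -> : d_t (fun s' r' th' ph' => Rc r' ^+ p * u s' r' th' ph') s r th ph =
    Rc r ^+ p * d_t u s r th ph.
  rewrite {1}/d_t derive1E.
  by have h := is_derive_scale (Rc r ^+ p) ut; rewrite derive_val.
have -> : d_r (fun s' r' th' ph' => Rc r' ^+ p * u s' r' th' ph') s r th ph =
    p%:R * Rc r ^+ p.-1 * a r * u s r th ph + Rc r ^+ p * d_r u s r th ph.
  rewrite {1}/d_r derive1E.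
  by have h := is_derive_mul (is_derive_exprn p (is_derive_Rc rr)) ur; rewrite derive_val.
have a0 : a r != 0 by rewrite gt_eqF// (dRc_gt0 hyp rr).
(* The exponent [p.-1] from the power rule makes [p = 0] a separate case. *)
case: (p) => [|q] /=; first by rewrite expr1 expr0; field; rewrite a0 Rn0.
have Rq : Rc r ^+ q != 0 by rewrite expf_neq0.
by rewrite !exprS; field; rewrite a0 Rn0 Rq.
Qed.

Variables (C A : R).

Definition growth s := expR (C * (t - s)).
(** The sum R + s makes the support of the weight shrink as time passes: at time s the weight
    vanishes where R >= A + 1 - s. *)
Definition phase s r := Rc r + s - A.
Definition weight s r := growth s * cutoff (phase s r).
Definition weight_t s r := growth s * (- C * cutoff (phase s r) + dcutoff (phase s r)).
Definition weight_r s r := growth s * dcutoff (phase s r) * a r.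

Lemma is_derive_weight_t (s r : R) : is_derive s 1 (fun s => weight s r) (weight_t s r).
Proof.
have h1 := is_derive_chain (is_derive_scale C (is_derive_add (is_derive_const t s)
  (is_derive_opp (is_derive_ident s)))) (is_derive_expR _).
have h2 := is_derive_chain (is_derive_add (is_derive_add (is_derive_const (Rc r) s)
  (is_derive_ident s)) (is_derive_const (- A) s)) (is_derive_cutoff _).
apply: is_derive_eq (is_derive_mul h1 h2) _.
by rewrite /weight_t /growth /phase; ring.
Qed.

Lemma is_derive_weight_r (s r : R) : r0 <= r < rI ->
  is_derive r 1 (weight s) (weight_r s r).
Proof.
move=> rr; have h2 := is_derive_chain (is_derive_add (is_derive_add (is_derive_Rc rr)
  (is_derive_const s r)) (is_derive_const (- A) r)) (is_derive_cutoff _).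
apply: is_derive_eq (is_derive_scale (growth s) h2) _.
by rewrite /weight_r /phase; ring.
Qed.

Definition edens s r th ph := energy_density (a r) (Rc r) (sin th)
  (u s r th ph) (v s r th ph) (w1 s r th ph) (w2 s r th ph).

Definition zf s r th ph := v s r th ph / Rc r.

(** All four currents contain the factor sin(theta) of dOmega, so that the divergence is the plain
    sum of coordinate derivatives. *)
Definition current_t s r th ph := weight s r * edens s r th ph * sin th.

Definition current_r s r th ph :=
  weight s r * (2^-1 * (u s r th ph ^+ 2 - zf s r th ph ^+ 2)) * sin th.

Definition current_th s r th ph := - (weight s r * a r / Rc r ^+ 2
  * ((u s r th ph + zf s r th ph) * (w1 s r th ph * sin th))).

Definition current_ph s r th ph := - (weight s r * a r / Rc r ^+ 2 / sin th
  * ((u s r th ph + zf s r th ph) * w2 s r th ph)).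

(** The four derivatives are written in the shape of the left side of
    [weighted_divergence_identity], which is later applied by rewriting. *)
Definition dcurrent_t s r th ph :=
  (weight_t s r * edens s r th ph
   + weight s r * (u s r th ph * d_t u s r th ph
      + (2 * a r - 1) / Rc r ^+ 2 * (v s r th ph * d_t v s r th ph)
      + 2 * (a r / Rc r ^+ 2) * (w1 s r th ph * d_t w1 s r th ph)
      + 2 * (a r / (Rc r ^+ 2 * sin th ^+ 2)) * (w2 s r th ph * d_t w2 s r th ph)))
  * sin th.

Definition dcurrent_r s r th ph :=
  (weight_r s r * (2^-1 * (u s r th ph ^+ 2 - zf s r th ph ^+ 2))
   + weight s r * (u s r th ph * d_r u s r th ph
      - v s r th ph * d_r v s r th ph / Rc r ^+ 2
      + v s r th ph ^+ 2 * a r / Rc r ^+ 3)) * sin th.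

Definition dcurrent_th s r th ph := - (weight s r * a r / Rc r ^+ 2
  * ((d_th u s r th ph + d_th v s r th ph / Rc r) * (w1 s r th ph * sin th)
     + (u s r th ph + zf s r th ph)
       * (d_th w1 s r th ph * sin th + w1 s r th ph * cos th))).

Definition dcurrent_ph s r th ph := - (weight s r * a r / Rc r ^+ 2 / sin th
  * ((d_ph u s r th ph + d_ph v s r th ph / Rc r) * w2 s r th ph
     + (u s r th ph + zf s r th ph) * d_ph w2 s r th ph)).

Section AtPoint.
Variables (s r th ph : R).
Hypothesis x_in : region (s, r, th, ph).

Let rr : r0 <= r < rI. Proof. by case: x_in. Qed.
Let Rn0 : Rc r != 0. Proof. by rewrite gt_eqF// (Rc_gt0 hyp rr). Qed.
Let an0 : a r != 0. Proof. by rewrite gt_eqF// (dRc_gt0 hyp rr). Qed.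
Let S0 : 0 < sin th. Proof. by case: x_in => _ _ /=; exact: sin_gt0_pi. Qed.
Let Sn0 : sin th != 0. Proof. by rewrite gt_eqF. Qed.

Lemma is_derive_current_t :
  is_derive s 1 (fun s => current_t s r th ph) (dcurrent_t s r th ph).
Proof.
have [u1 _ _ _] := C1_region_derivatives Cu x_in.
have [v1 _ _ _] := C1_region_derivatives Cv x_in.
have [w11 _ _ _] := C1_region_derivatives Cw1 x_in.
have [w21 _ _ _] := C1_region_derivatives Cw2 x_in.
have he := is_derive_add (is_derive_add (is_derive_add
  (is_derive_scale 2^-1 (is_derive_sqr u1))
  (is_derive_scale ((2 * a r - 1) / (2 * Rc r ^+ 2)) (is_derive_sqr v1)))
  (is_derive_scale (a r / Rc r ^+ 2) (is_derive_sqr w11)))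
  (is_derive_scale (a r / (Rc r ^+ 2 * sin th ^+ 2)) (is_derive_sqr w21)).
have h := is_derive_mul (is_derive_mul (is_derive_weight_t s r) he)
  (is_derive_const (sin th) s).
apply: is_derive_eq h _.
by rewrite /dcurrent_t /edens /energy_density; field; rewrite Rn0 Sn0.
Qed.

Lemma is_derive_current_r :
  is_derive r 1 (fun r => current_r s r th ph) (dcurrent_r s r th ph).
Proof.
have [_ u1 _ _] := C1_region_derivatives Cu x_in.
have [_ v1 _ _] := C1_region_derivatives Cv x_in.
have hz := is_derive_mul v1 (is_derive_inv Rn0 (is_derive_Rc rr)).
have h := is_derive_mul (is_derive_mul (is_derive_weight_r s rr)
  (is_derive_scale 2^-1 (is_derive_add (is_derive_sqr u1)
    (is_derive_opp (is_derive_sqr hz)))))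
  (is_derive_const (sin th) r).
apply: is_derive_eq h _.
by rewrite /dcurrent_r /zf; field; rewrite Rn0.
Qed.

Lemma is_derive_current_th :
  is_derive th 1 (fun th => current_th s r th ph) (dcurrent_th s r th ph).
Proof.
have [_ _ u1 _] := C1_region_derivatives Cu x_in.
have [_ _ v1 _] := C1_region_derivatives Cv x_in.
have [_ _ w11 _] := C1_region_derivatives Cw1 x_in.
have h := is_derive_opp (is_derive_scale (weight s r * a r / Rc r ^+ 2)
  (is_derive_mul (is_derive_add u1 (is_derive_mul v1 (is_derive_const (Rc r)^-1 th)))
    (is_derive_mul w11 (is_derive_sin th)))).
apply: is_derive_eq h _.
by rewrite /dcurrent_th /zf; field; rewrite Rn0.
Qed.

Lemma is_derive_current_ph :
  is_derive ph 1 (fun ph => current_ph s r th ph) (dcurrent_ph s r th ph).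
Proof.
have [_ _ _ u1] := C1_region_derivatives Cu x_in.
have [_ _ _ v1] := C1_region_derivatives Cv x_in.
have [_ _ _ w21] := C1_region_derivatives Cw2 x_in.
have h := is_derive_opp (is_derive_scale (weight s r * a r / Rc r ^+ 2 / sin th)
  (is_derive_mul (is_derive_add u1 (is_derive_mul v1 (is_derive_const (Rc r)^-1 ph)))
    w21)).
apply: is_derive_eq h _.
by rewrite /dcurrent_ph /zf; field; rewrite Rn0 Sn0.
Qed.

Lemma current_divergence_le : 0 < C ->
  (0 < phase s r -> 1 <= a r) ->
  a r <= C * Rc r ^+ 2 -> a r <= C * Rc r ^+ 2 * (2 * a r - 1) ->
  dcurrent_t s r th ph + dcurrent_r s r th ph + dcurrent_th s r th ph
    + dcurrent_ph s r th ph
  <= - (weight s r * (a r * p%:R / Rc r * (u s r th ph + zf s r th ph) ^+ 2 * sin th))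
     + weight s r * (a r * Rc r ^+ 4 * F s r th ph ^+ 2 * sin th)
     + 2^-1 * (growth s * dcutoff (phase s r) * a r * u s r th ph ^+ 2 * sin th).
Proof.
move=> C0 dka aC1 aC2.
have [E1 E2 E3 E4] := ugly_system_expanded x_in.
have := weighted_divergence_identity (weight s r) (weight_t s r) (weight_r s r)
  (w2 s r th ph) an0 Rn0 Sn0 E1 E2 E3 E4.
rewrite /dcurrent_t /dcurrent_r /dcurrent_th /dcurrent_ph => ->.
(* Where the phase is nonpositive the derivative of the cutoff is 0; elsewhere R' >= 1 by
   hypothesis. *)
have dkc : dcutoff (phase s r) = 0 \/ 1 <= a r.
  by have [ph0|/dka] := leP (phase s r) 0; [left; exact: dcutoff0|right].
have := weighted_source_bound p%:R (sin th) (u s r th ph) (v s r th ph)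
  (w1 s r th ph) (w2 s r th ph) (F s r th ph) (dRc_gt_half hyp rr) (Rc_gt0 hyp rr)
  C0 (expR_ge0 _ : 0 <= growth s) (cutoff_ge0 (phase s r)) (dcutoff_le0 (phase s r))
  dkc aC1 aC2.
move=> /(ler_wpM2l (ltW S0)) /le_trans; apply; rewrite le_eqVlt; apply/orP; left.
by apply/eqP; rewrite /weight /zf; ring.
Qed.

End AtPoint.
End EnergyCurrents.

(** * The energy inequality on a box *)

Section BoxEnergy.
Context {R : realType} (n r0 rI : R) (Rc H : R -> R).
Hypothesis hyp : hyperboloidal n r0 rI Rc H.
Context (p : nat) (F u v w1 w2 : stfun R) (t : R).
Hypothesis t0 : 0 <= t.
Hypothesis reg : regular_fields r0 rI t (Fields u v w1 w2).
Hypothesis sys : ugly_system r0 rI t Rc p F (Fields u v w1 w2).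
Local Notation a := (derive1 Rc).
Variables (C A r2 d1 d2 : R).
Hypotheses (C0 : 0 < C) (r2_in : r0 <= r2 < rI).
Hypotheses (d10 : 0 < d1) (d12 : d1 <= d2) (d2pi : d2 < pi).

Local Notation I := (0, t).
Local Notation J := (r0, r2).
Local Notation K := (d1, d2).
Local Notation L := (0, 2 * pi).
Local Notation growth := (growth t C).
Local Notation phase := (phase Rc A).
Local Notation weight := (weight Rc t C A).
Local Notation zf := (zf Rc v).
Local Notation edens := (edens Rc u v w1 w2).
Local Notation current_t := (current_t Rc u v w1 w2 t C A).
Local Notation current_r := (current_r Rc u v t C A).
Local Notation current_th := (current_th Rc u v w1 t C A).
Local Notation current_ph := (current_ph Rc u v w2 t C A).
Local Notation dcurrent_t := (dcurrent_t Rc u v w1 w2 t C A).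
Local Notation dcurrent_r := (dcurrent_r Rc u v t C A).
Local Notation dcurrent_th := (dcurrent_th Rc u v w1 t C A).
Local Notation dcurrent_ph := (dcurrent_ph Rc u v w2 t C A).
Local Notation cbox := (cont4 I J K L).

Lemma box_region s r th ph : 0 <= s <= t -> r0 <= r <= r2 -> d1 <= th <= d2 ->
  region r0 rI t (s, r, th, ph).
Proof.
move=> st /andP[rr1 rr2] /andP[h1 h2]; split => //=.
- by rewrite rr1; case/andP: r2_in => _; exact: le_lt_trans.
- by rewrite (lt_le_trans d10)//= (le_lt_trans h2).
Qed.

Lemma box_slice r : r0 <= r <= r2 -> r0 <= r < rI.
Proof.
by case/andP: r2_in => _ h /andP[-> r1]/=; exact: le_lt_trans h.
Qed.

Lemma box_cont4 f : {within region r0 rI t, continuous (joint f)} -> cbox f.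
Proof. by case/andP: r2_in => *; exact: region_cont4. Qed.

Lemma box_sin_gt0 th : d1 <= th <= d2 -> 0 < sin th.
Proof.
move=> /andP[h1 h2]; apply: sin_gt0_pi.
by rewrite (lt_le_trans d10)//= (le_lt_trans h2).
Qed.

Lemma box_Rc : cbox (fun _ r _ _ => Rc r).
Proof. by apply: cont4_fun2; case/andP: r2_in => *; exact: (Rc_continuous hyp). Qed.

Lemma box_dRc : cbox (fun _ r _ _ => a r).
Proof. by apply: cont4_fun2; case/andP: r2_in => *; exact: (dRc_continuous hyp). Qed.

Lemma box_sin : cbox (fun _ _ th _ => sin th).
Proof. by apply: cont4_fun3; apply: continuous_subspaceT; exact: continuous_sin. Qed.

Lemma box_cos : cbox (fun _ _ th _ => cos th).
Proof. by apply: cont4_fun3; apply: continuous_subspaceT; exact: continuous_cos. Qed.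

Lemma box_time : cbox (fun s _ _ _ => s).
Proof. by apply: cont4_fun1; apply: continuous_subspaceT => x; exact: cvg_id. Qed.

Lemma box_phase : cbox (fun s r _ _ => phase s r).
Proof.
apply: cont4D; last exact: cont4_cst.
by apply: cont4D; [exact: box_Rc|exact: box_time].
Qed.

Lemma box_growth : cbox (fun s _ _ _ => growth s).
Proof.
apply: (cont4_comp (f := fun s _ _ _ => C * (t - s))); first exact: continuous_expR.
apply: cont4M; first exact: cont4_cst.
by apply: cont4D; [exact: cont4_cst|apply: cont4N; exact: box_time].
Qed.

Lemma box_cutoff : cbox (fun s r _ _ => cutoff (phase s r)).
Proof.
by apply: (cont4_comp (f := fun s r _ _ => phase s r)); [exact: continuous_cutoff|exact: box_phase].
Qed.

Lemma box_dcutoff : cbox (fun s r _ _ => dcutoff (phase s r)).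
Proof.
by apply: (cont4_comp (f := fun s r _ _ => phase s r)); [exact: continuous_dcutoff|exact: box_phase].
Qed.

Lemma box_C1 f : C1_region r0 rI t f ->
  [/\ cbox f, cbox (d_t f), cbox (d_r f), cbox (d_th f) & cbox (d_ph f)].
Proof. by move=> [_ c1 c2 c3 [c4 c5]]; split; exact: box_cont4. Qed.

Lemma box_neq0 r th : r0 <= r <= r2 -> d1 <= th <= d2 ->
  [/\ Rc r != 0, a r != 0 & sin th != 0].
Proof.
move=> rJ thK; have rr := box_slice rJ.
split; apply: lt0r_neq0.
- exact: (Rc_gt0 hyp rr).
- exact: (dRc_gt0 hyp rr).
- exact: box_sin_gt0.
Qed.

Ltac box_neq0_tac := move=> ? ? ? ? _ /= /box_neq0 /[apply] -[? ? ?] _;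
  by rewrite ?mulf_neq0 ?expf_neq0 ?pnatr_eq0.

Local Opaque cont4 d_t d_r d_th d_ph derive1 sin cos cutoff dcutoff.

(** Recursion on the syntax of the integrand. Denominators are built from R, R', sin(theta) and
    numerals, nonzero on the box by [box_neq0]; continuity of the fields is looked up in the
    context. *)
Ltac box_cont := lazymatch goal with
  | |- cont4 _ _ _ _ (fun s r th ph => @?f s r th ph + @?g s r th ph) =>
    apply: (cont4D (f := f) (g := g)); box_cont
  | |- cont4 _ _ _ _ (fun s r th ph => @?f s r th ph * @?g s r th ph) =>
    apply: (cont4M (f := f) (g := g)); box_cont
  | |- cont4 _ _ _ _ (fun s r th ph => - @?f s r th ph) =>
    apply: (cont4N (f := f)); box_cont
  | |- cont4 _ _ _ _ (fun s r th ph => @?f s r th ph ^+ ?k) =>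
    apply: (cont4X (f := f)); box_cont
  | |- cont4 _ _ _ _ (fun s r th ph => (@?f s r th ph)^-1) =>
    apply: (cont4V (f := f)); [box_neq0_tac|box_cont]
  | |- cont4 _ _ _ _ (fun s r th ph => Rc r) => exact: box_Rc
  | |- cont4 _ _ _ _ (fun s r th ph => derive1 Rc r) => exact: box_dRc
  | |- cont4 _ _ _ _ (fun s r th ph => sin th) => exact: box_sin
  | |- cont4 _ _ _ _ (fun s r th ph => cos th) => exact: box_cos
  | |- cont4 _ _ _ _ (fun s r th ph => cutoff _) => exact: box_cutoff
  | |- cont4 _ _ _ _ (fun s r th ph => dcutoff _) => exact: box_dcutoff
  | |- cont4 _ _ _ _ (fun s r th ph => growth s) => exact: box_growth
  | |- cont4 _ _ _ _ (fun s r th ph => ?h s r th ph) =>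
    match goal with hc : cont4 _ _ _ _ h |- _ => exact hc end
  | |- _ => exact: cont4_cst
  end.

(** Continuity of [F] is inherited: the first equation expresses it through the fields and their
    first derivatives. *)
Lemma box_source_continuous : cbox F.
Proof.
have [Hu Hv Hw1 Hw2] := reg_C1 reg.
have [cu cu1 cu2 cu3 cu4] := box_C1 Hu.
have [cv cv1 cv2 cv3 cv4] := box_C1 Hv.
have [cw cw1 cw2 cw3 cw4] := box_C1 Hw1.
have [cx cx1 cx2 cx3 cx4] := box_C1 Hw2.
rewrite /= in cu cu1 cu2 cv cw cw3 cx4.
apply: (eq_cont4 (f := fun s r th ph =>
  cos th / sin th / Rc r ^+ 3 * w1 s r th ph - p%:R / Rc r ^+ 3 * v s r th ph
  - ((Rc r)^-1 * ((a r)^-1 * (d_t u s r th ph + d_r u s r th ph)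
          + p%:R / Rc r * u s r th ph)
        - (Rc r)^-1 * ((Rc r ^+ 2)^-1 * (d_th w1 s r th ph
            + (sin th ^+ 2)^-1 * d_ph w2 s r th ph))))).
  move=> s r th ph sI rJ thK phL.
  have x_in := box_region ph sI rJ thK.
  by have [-> _ _ _] := ugly_system_expanded hyp reg sys x_in; ring.
box_cont.
Qed.

(** This and [source_density] are the bulk integrands of the theorem times R' R^2 sin(theta), the
    density of dV. *)
Definition damping_density s r th ph :=
  a r * p%:R / Rc r * (u s r th ph + zf s r th ph) ^+ 2 * sin th.

Definition source_density s r th ph :=
  a r * Rc r ^+ 4 * F s r th ph ^+ 2 * sin th.

Definition damping s r th ph := weight s r * damping_density s r th ph.

Definition source s r th ph := weight s r * source_density s r th ph.

(** Minus twice the [dcutoff] term of [current_divergence_le]. It is nonnegative and takes the place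
    of a flux at the outer end, where the weight vanishes. *)
Definition outflow s r th ph :=
  growth s * - dcutoff (phase s r) * a r * u s r th ph ^+ 2 * sin th.

Lemma box_currents_continuous :
  [/\ cbox current_t, cbox current_r, cbox current_th & cbox current_ph] /\
  [/\ cbox dcurrent_t, cbox dcurrent_r, cbox dcurrent_th & cbox dcurrent_ph].
Proof.
have [Hu Hv Hw1 Hw2] := reg_C1 reg.
have [cu cu1 cu2 cu3 cu4] := box_C1 Hu.
have [cv cv1 cv2 cv3 cv4] := box_C1 Hv.
have [cw cw1 cw2 cw3 cw4] := box_C1 Hw1.
have [cx cx1 cx2 cx3 cx4] := box_C1 Hw2.
rewrite /= in cu cu1 cu2 cu3 cu4 cv cv1 cv2 cv3 cv4 cw cw1 cw2 cw3 cw4 cx cx1 cx2 cx3 cx4.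
rewrite /current_t /current_r /current_th /current_ph /dcurrent_t /dcurrent_r
  /dcurrent_th /dcurrent_ph /weight_t /weight_r /weight /edens /zf /energy_density.
split; split; box_cont.
Qed.

Lemma box_terms_continuous :
  [/\ cbox damping, cbox source & cbox outflow].
Proof.
have [Hu Hv Hw1 Hw2] := reg_C1 reg.
have [cu _ _ _ _] := box_C1 Hu.
have [cv _ _ _ _] := box_C1 Hv.
have cF := box_source_continuous.
rewrite /= in cu cv.
rewrite /damping /source /damping_density /source_density /outflow /weight /zf.
split; box_cont.
Qed.

Lemma box_densities_continuous :
  [/\ cbox (fun s r th ph => edens s r th ph * sin th), cbox damping_density
    & cbox source_density].
Proof.
have [Hu Hv Hw1 Hw2] := reg_C1 reg.
have [cu _ _ _ _] := box_C1 Hu.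
have [cv _ _ _ _] := box_C1 Hv.
have [cw _ _ _ _] := box_C1 Hw1.
have [cx _ _ _ _] := box_C1 Hw2.
have cF := box_source_continuous.
rewrite /= in cu cv cw cx.
rewrite /damping_density /source_density /edens /energy_density /zf.
split; box_cont.
Qed.

End BoxEnergy.

(** The bookkeeping of the divergence theorem over bare numbers, for [lra]: [e1], [e0] are energies,
    [b1], [b0] the fluxes of u and z at the world-tube, [th1], [th2] those around the poles. *)
Lemma flux_balance (R : realFieldType) (dm sc ou m e1 e0 b1 b0 th2 th1 : R) :
  th1 <= m -> - m <= th2 ->
  e1 - e0 + (0 - (b1 - b0)) + (th2 - th1) + 0 <= - dm + sc - 2^-1 * ou ->
  e1 + b0 + dm + 2^-1 * ou <= e0 + b1 + sc + 2 * m.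
Proof. by move=> ? ? ?; lra. Qed.

Section BoxEnergyInequality.
Context {R : realType} (n r0 rI : R) (Rc H : R -> R).
Hypothesis hyp : hyperboloidal n r0 rI Rc H.
Context (p : nat) (F u v w1 w2 : stfun R) (t : R).
Hypothesis t0 : 0 <= t.
Hypothesis reg : regular_fields r0 rI t (Fields u v w1 w2).
Hypothesis sys : ugly_system r0 rI t Rc p F (Fields u v w1 w2).
Local Notation a := (derive1 Rc).
Variables (C A r2 d1 d2 : R).
Hypotheses (C0 : 0 < C) (r2_in : r0 <= r2 < rI).
Hypotheses (d10 : 0 < d1) (d12 : d1 <= d2) (d2pi : d2 < pi).

Local Notation I := (0 : R, t).
Local Notation J := (r0, r2).
Local Notation K := (d1, d2).
Local Notation L := (0 : R, 2 * pi : R).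
Local Notation weight := (weight Rc t C A).
Local Notation zf := (zf Rc v).
Local Notation current_t := (current_t Rc u v w1 w2 t C A).
Local Notation current_r := (current_r Rc u v t C A).
Local Notation current_th := (current_th Rc u v w1 t C A).
Local Notation current_ph := (current_ph Rc u v w2 t C A).
Local Notation dcurrent_t := (dcurrent_t Rc u v w1 w2 t C A).
Local Notation dcurrent_r := (dcurrent_r Rc u v t C A).
Local Notation dcurrent_th := (dcurrent_th Rc u v w1 t C A).
Local Notation dcurrent_ph := (dcurrent_ph Rc u v w2 t C A).
Local Notation damping := (damping Rc p u v t C A).
Local Notation source := (source Rc F t C A).
Local Notation outflow := (outflow Rc u t C A).
Local Notation cbox := (cont4 I J K L).

Hypothesis bound_dRc : forall r, r0 <= r < rI ->
  a r <= C * Rc r ^+ 2 /\ a r <= C * Rc r ^+ 2 * (2 * a r - 1).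
Hypothesis phase_dRc : forall s r : R, 0 <= s <= t -> r0 <= r <= r2 ->
  0 < phase Rc A s r -> 1 <= a r.
Hypothesis weight_r2 : forall s : R, 0 <= s <= t -> weight s r2 = 0.

Let r02 : r0 <= r2. Proof. by case/andP: r2_in. Qed.
Let L12 : 0 <= 2 * pi :> R. Proof. by rewrite mulr_ge0// pi_ge0. Qed.

(** The suffixes refer to the direction of propagation: the ingoing z leaves the region through r =
    r0 and is counted on the left, the outgoing u enters there and is counted on the right. *)
Definition inner_in s th ph := weight s r0 * (2^-1 * zf s r0 th ph ^+ 2) * sin th.
Definition inner_out s th ph := weight s r0 * (2^-1 * u s r0 th ph ^+ 2) * sin th.

Lemma box_zf_continuous : cbox u /\ cbox zf.
Proof.
have [Hu Hv _ _] := reg_C1 reg.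
have [cu _ _ _ _] := box_C1 r2_in d10 d2pi Hu.
have [cv _ _ _ _] := box_C1 r2_in d10 d2pi Hv.
split => //; apply: cont4M => //; apply: cont4V; last exact: (box_Rc hyp r2_in).
move=> s r th ph _ /= rJ _ _; apply: lt0r_neq0.
exact: (Rc_gt0 hyp (box_slice r2_in rJ)).
Qed.

Lemma box_inner_continuous : cont3 I K L inner_in /\ cont3 I K L inner_out.
Proof.
have [cu cz] := box_zf_continuous.
have r0J : r0 <= r0 <= r2 by rewrite lexx.
have cw : cbox (fun s r _ _ => weight s r).
  by apply: cont4M; [exact: box_growth|exact: (box_cutoff hyp r2_in)].
have cs : cbox (fun _ _ th _ => sin th) by exact: box_sin.
split.
  apply: (cont4_slice2 (f := fun s r th ph => weight s r * (2^-1 * zf s r th ph ^+ 2) * sin th)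
    (J := J)) => //.
  by apply: cont4M => //; apply: cont4M => //; apply: cont4M; [exact: cont4_cst|exact: cont4X].
apply: (cont4_slice2 (f := fun s r th ph => weight s r * (2^-1 * u s r th ph ^+ 2) * sin th)
  (J := J)) => //.
by apply: cont4M => //; apply: cont4M => //; apply: cont4M; [exact: cont4_cst|exact: cont4X].
Qed.

(** The pointwise divergence inequality integrated over the box. The weight removes the flux at
    [r2], periodicity the azimuthal one, and [M] controls the circles around the two poles. *)
Lemma box_energy_inequality (M : R) :
  (forall s r ph : R, 0 <= s <= t -> r0 <= r <= r2 ->
    `|current_th s r d1 ph| <= M /\ `|current_th s r d2 ph| <= M) ->
  int3 J K L (current_t t) + int3 I K L inner_in
    + int4 I J K L damping + 2^-1 * int4 I J K L outflow
  <= int3 J K L (current_t 0) + int3 I K L inner_out + int4 I J K L source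
     + 2 * (M * (2 * pi) * (r2 - r0) * t).
Proof.
move=> HM.
have [[c1 c2 c3 c4] [e1 e2 e3 e4]] :=
  box_currents_continuous hyp reg C A r2_in d10 d2pi.
have [cd cs co] := box_terms_continuous hyp reg sys C A r2_in d10 d2pi.
have x_in (s r th ph : R) : I.1 <= s <= I.2 -> J.1 <= r <= J.2 -> K.1 <= th <= K.2 ->
    L.1 <= ph <= L.2 -> region r0 rI t (s, r, th, ph).
  by move=> sI rJ thK _; exact: (box_region r2_in d10 d2pi ph sI rJ thK).
have loc (q : R) (X : R * R) : X.1 < q < X.2 -> X.1 <= q <= X.2.
  by move=> /andP[q1 q2]; rewrite (ltW q1) (ltW q2).
have D1 := int4_derive1 (I := I) (J := J) (K := K) (L := L) t0 r02 d12 L12 c1 e1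
  (fun s r th ph sI rJ thK phL => is_derive_current_t hyp reg C A
    (x_in _ _ _ _ (loc _ _ sI) rJ thK phL)).
have D2 := int4_derive2 (I := I) (J := J) (K := K) (L := L) r02 d12 L12 c2 e2
  (fun s r th ph sI rJ thK phL => is_derive_current_r hyp reg C A
    (x_in _ _ _ _ sI (loc _ _ rJ) thK phL)).
have D3 := int4_derive3 (I := I) (J := J) (K := K) (L := L) r02 d12 L12 c3 e3
  (fun s r th ph sI rJ thK phL => is_derive_current_th hyp reg C A
    (x_in _ _ _ _ sI rJ (loc _ _ thK) phL)).
have per (s r th : R) : I.1 <= s <= I.2 -> J.1 <= r <= J.2 -> K.1 <= th <= K.2 ->
    current_ph s r th L.2 = current_ph s r th L.1.
  move=> sI rJ thK; have [p1 p2 _ p4] := reg_periodic reg.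
  have x0 := x_in s r th 0 sI rJ thK; rewrite /= lexx L12 in x0.
  have := (p1 s r th 0 (x0 isT), p2 s r th 0 (x0 isT), p4 s r th 0 (x0 isT)).
  by rewrite /= add0r /current_ph /zf => -[[-> ->] ->].
have D4 := int4_derive4_periodic (I := I) (J := J) (K := K) (L := L) L12 c4 e4
  (fun s r th ph sI rJ thK phL => is_derive_current_ph hyp reg C A
    (x_in _ _ _ _ sI rJ thK (loc _ _ phL))) per.
have e12 := cont4D e1 e2; have e123 := cont4D e12 e3.
have S1 := int4D (I := I) (J := J) (K := K) (L := L) r02 d12 L12 e1 e2.
have S2 := int4D (I := I) (J := J) (K := K) (L := L) r02 d12 L12 e12 e3.
have S3 := int4D (I := I) (J := J) (K := K) (L := L) r02 d12 L12 e123 e4.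
have le_sum := le_int4 (I := I) (J := J) (K := K) (L := L) r02 d12 L12 (cont4D e123 e4)
  (cont4D (cont4D (cont4N cd) cs) (cont4M (@cont4_cst _ I J K L (- 2^-1)) co)).
have {le_sum} : int4 I J K L (fun s r th ph => dcurrent_t s r th ph +
    dcurrent_r s r th ph + dcurrent_th s r th ph + dcurrent_ph s r th ph) <=
  int4 I J K L (fun s r th ph => - damping s r th ph + source s r th ph
    + - 2^-1 * outflow s r th ph).
  apply: le_sum => s r th ph sI rJ thK phL; have rr := box_slice r2_in rJ.
  have [b1 b2] := bound_dRc rr.
  have := current_divergence_le hyp reg sys (A := A) (x_in _ _ _ _ sI rJ thK phL)
    C0 (phase_dRc sI rJ) b1 b2.
  move/le_trans; apply; rewrite lerD2l /outflow.
  by rewrite mulrN !mulNr mulrN opprK.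
rewrite S3 S2 S1 D1 D2 D3 D4.
have cdN : cbox (fun s r th ph => - 1 * damping s r th ph).
  by apply: cont4M => //; exact: cont4_cst.
have coN := cont4M (@cont4_cst _ I J K L (- 2^-1)) co.
have -> : int4 I J K L (fun s r th ph => - damping s r th ph + source s r th ph
    + - 2^-1 * outflow s r th ph) = - int4 I J K L damping + int4 I J K L source
    - 2^-1 * int4 I J K L outflow.
  have N1 := int4Z (I := I) (J := J) (K := K) (L := L) (- 1) r02 d12 L12 cd.
  have N2 := int4Z (I := I) (J := J) (K := K) (L := L) (- 2^-1) r02 d12 L12 co.
  have S4 := int4D (I := I) (J := J) (K := K) (L := L) r02 d12 L12 cdN cs.
  have S5 := int4D (I := I) (J := J) (K := K) (L := L) r02 d12 L12 (cont4D cdN cs) coN.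
  rewrite mulN1r in N1; rewrite mulNr in N2; rewrite -N1 -N2 -S4 -S5.
  congr (int4 _ _ _ _ _); apply/funext => s; apply/funext => r; apply/funext => th.
  by apply/funext => ph; rewrite (mulN1r (damping s r th ph)).
have [ci1 ci2] := box_inner_continuous.
have -> : int3 I K L (fun s => current_r s J.1) = int3 I K L inner_out - int3 I K L inner_in.
  have B := int3B (I := I) (J := K) (K := L) d12 L12 ci2 ci1.
  rewrite -B; congr (int3 _ _ _ _); apply/funext => s; apply/funext => th.
  apply/funext => ph; rewrite /current_r /inner_in /inner_out /=.
  by move: (weight s r0) (u s r0 th ph) (zf s r0 th ph) (sin th) => W U Z S; ring.
have -> : int3 I K L (fun s => current_r s J.2) = 0.
  apply: (@etrans _ _ (int3 I K L (fun _ _ _ => 0))).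
    apply: eq_int1 => s sI; apply: eq_int1 => th _; apply: eq_int1 => ph _.
    by rewrite /current_r weight_r2// !mul0r.
  by rewrite int3_cst//= !mul0r.
have vol q : int3 I J L (fun _ _ _ => q) = q * (2 * pi) * (r2 - r0) * t.
  by rewrite int3_cst//= !subr0.
have K1 : K.1 <= K.1 <= K.2 by rewrite /= lexx.
have K2 : K.1 <= K.2 <= K.2 by rewrite /= lexx andbT.
have ub : int3 I J L (fun s r => current_th s r K.1) <= M * (2 * pi) * (r2 - r0) * t.
  rewrite -vol; apply: le_int3 => //; [exact: cont4_slice3 c3 K1|exact: within_cst|].
  move=> s r ph sI rJ _; have [h _] := HM s r ph sI rJ.
  exact: le_trans (ler_norm _) h.
have lb : - (M * (2 * pi) * (r2 - r0) * t) <= int3 I J L (fun s r => current_th s r K.2).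
  rewrite -!mulNr -vol; apply: le_int3 => //; [exact: within_cst|exact: cont4_slice3 c3 K2|].
  move=> s r ph sI rJ _; have [_ h] := HM s r ph sI rJ.
  by rewrite lerNl; apply: le_trans h; rewrite -normrN; exact: ler_norm.
rewrite /= in ub lb *.
move: ub lb.
(* The integrals become variables before the linear arithmetic. *)
move: (int3 _ _ _ _) (int3 _ _ _ _) (int3 _ _ _ _) (int3 _ _ _ _) (int3 _ _ _ _) (int3 _ _ _ _).
move: (int4 _ _ _ _ _) (int4 _ _ _ _ _) (int4 _ _ _ _ _) (M * _ * _ * _).
move=> x1 x2 x3 x4 x5 x6 x7 x8 x9 x10 h1 h2 h3.
have h4 := flux_balance h1 h2 h3; exact: h4.
Qed.

End BoxEnergyInequality.

(** * Removing the cutoff *)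

(** [U] will be the trace u^2 at null infinity minus an error and may be negative; it is therefore
    replaced by [V] before the factor [g >= 1] is inserted. *)
Lemma outflow_density_ge (R : realFieldType) (k b g U V S : R) :
  k <= 0 -> 0 <= b -> 0 <= S -> 0 <= V -> 1 <= g -> k = 0 \/ U <= V ->
  -1 * (k * b * (U * S)) <= g * - k * b * V * S.
Proof.
move=> k0 b0 S0 V0 g1 [->|UV]; first by rewrite oppr0 !(mul0r, mulr0).
have -> : -1 * (k * b * (U * S)) = 1 * (- k * b * U * S) by ring.
have -> : g * - k * b * V * S = g * (- k * b * V * S) by ring.
have nk : 0 <= - k * b by rewrite mulr_ge0// oppr_ge0.
apply: (@le_trans _ _ (1 * (- k * b * V * S))).
  by rewrite !mul1r ler_wpM2r// ler_wpM2l.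
by rewrite ler_wpM2r// !mulr_ge0// oppr_ge0.
Qed.

Section TruncatedEstimate.
Context {R : realType} (n r0 rI : R) (Rc H : R -> R).
Hypothesis hyp : hyperboloidal n r0 rI Rc H.
Hypothesis n12 : 1 < n <= 2.
Context (p : nat) (F u v w1 w2 : stfun R) (t : R).
Hypothesis t0 : 0 <= t.
Hypothesis reg : regular_fields r0 rI t (Fields u v w1 w2).
Hypothesis sys : ugly_system r0 rI t Rc p F (Fields u v w1 w2).
Local Notation a := (derive1 Rc).
Variable C : R.
Hypothesis C0 : 0 < C.
Hypothesis bound_dRc : forall r, r0 <= r < rI ->
  a r <= C * Rc r ^+ 2 /\ a r <= C * Rc r ^+ 2 * (2 * a r - 1).

Local Notation I := (0 : R, t).
Local Notation L := (0 : R, 2 * pi : R).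
Local Notation zf := (zf Rc v).
Local Notation edens := (edens Rc u v w1 w2).
Local Notation damping_density := (damping_density Rc p u v).
Local Notation source_density := (source_density Rc F).

Let L12 : 0 <= 2 * pi :> R. Proof. by rewrite mulr_ge0// pi_ge0. Qed.

Lemma growth_ge1 (s : R) : s <= t -> 1 <= growth t C s.
Proof.
by move=> st; rewrite -expR0 ler_expR mulr_ge0 ?(ltW C0)// subr_ge0.
Qed.

Lemma weight_ge0 (A s r : R) : 0 <= weight Rc t C A s r.
Proof. by rewrite mulr_ge0 ?expR_ge0// cutoff_ge0. Qed.

Lemma weight_ge1 (A s r : R) : s <= t -> phase Rc A s r <= 0 ->
  1 <= weight Rc t C A s r.
Proof. by move=> st ph0; rewrite /weight cutoff1// mulr1 growth_ge1. Qed.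

Lemma weight_le (A s r : R) : 0 <= s -> weight Rc t C A s r <= expR (C * t).
Proof.
move=> s0; rewrite -[leRHS]mulr1 ler_pM ?expR_ge0 ?cutoff_ge0 ?cutoff_le1//.
by rewrite ler_expR ler_pM2l// gerBl.
Qed.

Lemma scri_continuous J K : 0 < K.1 -> K.2 < pi ->
  r0 <= J.1 -> J.2 <= rI -> cont4 I J K L u.
Proof.
move=> K1 K2 J1 J2; apply: continuous_subspaceW (reg_scri reg) => -[[[s r] th] ph].
move=> [[[/segP sI /segP/andP[q1 q2]] /segP/andP[h1 h2]] _].
split => //=.
- by rewrite (le_trans J1)// (le_trans q2).
- by rewrite (lt_le_trans K1)// (le_lt_trans h2).
Qed.

Lemma scri_trace_continuous K : 0 < K.1 -> K.2 < pi ->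
  cont3 I K L (fun s th ph => u s rI th ph).
Proof.
move=> K1 K2; have r0I := hyp_lt hyp.
have cu := scri_continuous (J := (r0, rI)) K1 K2 (lexx _) (lexx _).
by apply: (cont4_slice2 cu); rewrite /= lexx ltW.
Qed.

(** Continuity of u up to r = rI is uniform over the compact set of times and angles; this is why
    the polar angle must stay away from 0 and pi. *)
Lemma scri_uniform_limit (K : R * R) (e : R) : 0 < K.1 -> K.2 < pi -> 0 < e ->
  exists2 c, r0 <= c < rI & forall r s th ph, c <= r < rI -> 0 <= s <= t ->
    K.1 <= th <= K.2 -> 0 <= ph <= 2 * pi ->
    u s rI th ph ^+ 2 - e <= u s r th ph ^+ 2.
Proof.
move=> K1 K2 e0; have r0I := hyp_lt hyp.
have cu := cont4X (n := 2) (scri_continuous (J := (r0, rI)) K1 K2 (lexx _) (lexx _)).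
pose D : set (R * R * R) := seg I `*` seg K `*` seg L.
(* The radius moves to the last slot, so that the compact set [D] is the first factor. *)
pose h (x : R * R * R * R) := u x.1.1.1 x.2 x.1.1.2 x.1.2 ^+ 2.
have ch : {within D `*` seg (r0, rI), continuous h}.
  apply: (within_comp cu (g := fun x : R * R * R * R => (x.1.1.1, x.2, x.1.1.2, x.1.2))).
    have c1 : continuous (fun x : R * R * R * R => x.1.1).
      by move=> x; apply: (@cvg_comp _ _ _ fst fst); exact: cvg_fst.
    apply: continuous_pair.
      apply: continuous_pair.
        apply: continuous_pair => [x|x]; last exact: cvg_snd.
        apply: (continuous_comp (f := fun x : R * R * R * R => x.1.1) (g := fst)).
          exact: c1.
        exact: cvg_fst.
      move=> x; apply: (continuous_comp (f := fun x : R * R * R * R => x.1.1) (g := snd)).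
        exact: c1.
      exact: cvg_snd.
    by move=> x; apply: (@cvg_comp _ _ _ fst snd); [exact: cvg_fst|exact: cvg_snd].
  by move=> [[[s th] ph] r] [[[sI thK] phL] rJ].
have cD : compact D by do 2 (apply: compact_setX; last exact: segment_compact);
  exact: segment_compact.
have rIJ : seg (r0, rI) rI by apply/segP; rewrite /= lexx ltW.
have /compact_near_coveringP/near_covering_withinP cover := cD.
have near_rI : \forall r \near rI, D `<=` (fun x =>
    seg (r0, rI) r -> `|h (x, rI) - h (x, r)| <= e).
  have := cover R (nbhs rI) (fun r x => seg (r0, rI) r -> `|h (x, rI) - h (x, r)| <= e) _.
  apply => x Dx; have e2 : 0 < e / 2 by rewrite divr_gt0.
  have [[Q P] /= [Qr Px] QP] := within_pair_near e2 ch Dx rIJ.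
  exists (P, Q) => // -[x' r] /= [Px' Qr'] Dx' rJ.
  have H1 := QP (r, x') (conj Qr' Px') Dx' rJ.
  have H2 := QP (rI, x') (conj (nbhs_singleton Qr) Px') Dx' rIJ.
  rewrite -(subrKA (h (x, rI))) (splitr e).
  apply: (le_trans (ler_normD _ _)); apply: lerD; last exact: ltW.
  by rewrite distrC; exact: ltW.
have /left_nbhs_segment : \forall r \near rI^'-, D `<=` (fun x =>
    seg (r0, rI) r -> `|h (x, rI) - h (x, r)| <= e).
  exact: cvg_within near_rI.
move=> /(_ _ r0I) [c crI cP]; exists c => // r s th ph crr sI thK phL.
have rJ : seg (r0, rI) r.
  apply/segP; rewrite /=; case/andP: crI => c1 _; case/andP: crr => c2 c3.
  by rewrite (le_trans c1)//= ltW.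
have Dx : D (s, th, ph) by do !split; apply/segP.
have := cP r crr (s, th, ph) Dx rJ.
by rewrite /h /= lerBlDr -lerBlDl; exact: le_trans (ler_norm _).
Qed.

(** The function - R' times [dcutoff] of the phase is minus the radial derivative of the cutoff,
    hence has integral 1 over [r0, r2]. Its mass lies where the phase is positive, and there u^2 is
    at least its trace minus [e]. *)
Lemma outflow_ge (A r2 : R) (K : R * R) (e : R) : r0 <= r2 < rI ->
  0 < K.1 -> K.1 <= K.2 -> K.2 < pi ->
  (forall s, 0 <= s <= t -> phase Rc A s r0 <= 0 /\ 1 <= phase Rc A s r2) ->
  (forall s r th ph, 0 <= s <= t -> r0 <= r <= r2 -> K.1 <= th <= K.2 ->
    0 <= ph <= 2 * pi -> 0 < phase Rc A s r ->
    u s rI th ph ^+ 2 - e <= u s r th ph ^+ 2) ->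
  int3 I K L (fun s th ph => (u s rI th ph ^+ 2 - e) * sin th)
    <= int4 I (r0, r2) K L (outflow Rc u t C A).
Proof.
case: K => d1 d2 /= r2_in d10 d12 d2pi phase02 uI.
have /andP[r02 r2I] := r2_in.
pose J := (r0, r2); pose K := (d1, d2).
have ci := scri_trace_continuous (K := K) d10 d2pi.
have cI : cont4 I J K L (fun s _ th ph => u s rI th ph).
  apply: (within_comp ci (g := fun x => (x.1.1.1, x.1.2, x.2))).
    have c1 : continuous (fun x : R * R * R * R => x.1.1).
      by move=> x; apply: (@cvg_comp _ _ _ fst fst); exact: cvg_fst.
    apply: continuous_pair; last by move=> x; exact: cvg_snd.
    apply: continuous_pair.
      move=> x; apply: (continuous_comp (f := fun x : R * R * R * R => x.1.1) (g := fst)).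
        exact: c1.
      exact: cvg_fst.
    by move=> x; apply: (@cvg_comp _ _ _ fst snd); [exact: cvg_fst|exact: cvg_snd].
  by move=> [[[s r] th] ph] [[[sI rJ] thK] phL].
have [_ _ co] := box_terms_continuous hyp reg sys C A r2_in d10 d2pi.
have cs : cont4 I J K L (fun _ _ th _ => sin th) by exact: box_sin.
have cg : cont4 I J K L (fun s _ th ph => (u s rI th ph ^+ 2 - e) * sin th).
  by apply: cont4M => //; apply: cont4D; [exact: cont4X|exact: cont4_cst].
have ck : cont4 I J K L (fun s r _ _ => cutoff (phase Rc A s r)).
  exact: (box_cutoff hyp r2_in).
have cdk : cont4 I J K L (fun s r _ _ => dcutoff (phase Rc A s r) * a r).
  by apply: cont4M; [exact: (box_dcutoff hyp r2_in)|exact: (box_dRc hyp r2_in)].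
have cf := cont4M ck cg; have cG := cont4M cdk cg.
have loc (q : R) (X : R * R) : X.1 < q < X.2 -> X.1 <= q <= X.2.
  by move=> /andP[q1 q2]; rewrite (ltW q1) (ltW q2).
have dk s r th ph : r0 < r < r2 ->
    is_derive r 1 (fun r => cutoff (phase Rc A s r) * ((u s rI th ph ^+ 2 - e) * sin th))
      (dcutoff (phase Rc A s r) * a r * ((u s rI th ph ^+ 2 - e) * sin th)).
  move=> /(loc r (r0, r2)) rJ.
  have h := is_derive_mul (is_derive_chain (is_derive_add (is_derive_add
      (is_derive_Rc hyp (box_slice r2_in rJ))
      (is_derive_const s r)) (is_derive_const (- A) r)) (is_derive_cutoff _))
      (is_derive_const ((u s rI th ph ^+ 2 - e) * sin th) r).
  apply: is_derive_eq h _.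
  by rewrite !addr0 mulr0 addr0.
have D := int4_derive2 (I := I) (J := J) (K := K) (L := L) r02 d12 L12 cf cG
  (fun s r th ph _ rJ _ _ => dk s r th ph rJ).
have Z2 : int3 I K L (fun s th ph => cutoff (phase Rc A s r2) *
    ((u s rI th ph ^+ 2 - e) * sin th)) = 0.
  apply: (@etrans _ _ (int3 I K L (fun _ _ _ => 0))); last by rewrite int3_cst//= !mul0r.
  apply: eq_int1 => s sI; apply: eq_int1 => th _; apply: eq_int1 => ph _.
  by have [_ h] := phase02 s sI; rewrite cutoff0 ?mul0r.
have Z1 : int3 I K L (fun s th ph => cutoff (phase Rc A s r0) *
    ((u s rI th ph ^+ 2 - e) * sin th)) =
    int3 I K L (fun s th ph => (u s rI th ph ^+ 2 - e) * sin th).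
  apply: eq_int1 => s sI; apply: eq_int1 => th _; apply: eq_int1 => ph _.
  by have [h _] := phase02 s sI; rewrite cutoff1 ?mul1r.
have {}D : int4 I J K L (fun s r th ph => dcutoff (phase Rc A s r) * a r *
    ((u s rI th ph ^+ 2 - e) * sin th)) =
   - int3 I K L (fun s th ph => (u s rI th ph ^+ 2 - e) * sin th).
  apply: (etrans D); apply: (etrans (congr2 (fun x y => x - y) Z2 Z1)).
  exact: sub0r.
have cm1 : cont4 I J K L (fun _ _ _ _ => -1) by exact: cont4_cst.
have N := int4Z (I := I) (J := J) (K := K) (L := L) (-1) r02 d12 L12 cG.
rewrite D mulN1r opprK in N; rewrite -N.
apply: (le_int4 (I := I) (J := J) (K := K) (L := L) r02 d12 L12 (cont4M cm1 cG) co).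
move=> s r th ph sI rJ thK phL /=; rewrite /outflow.
have sin0 : 0 <= sin th by apply: ltW; exact: (box_sin_gt0 d10 d2pi thK).
have a0 : 0 <= a r by apply/ltW/(dRc_gt0 hyp)/(box_slice r2_in rJ).
have g1 : 1 <= growth t C s by apply: growth_ge1; case/andP: sI.
apply: (outflow_density_ge (dcutoff_le0 _) a0 sin0 (sqr_ge0 _) g1).
have [ph0|ph0] := leP (phase Rc A s r) 0; first by left; exact: dcutoff0.
by right; exact: (uI s r th ph sI rJ thK phL ph0).
Qed.

(** By [reg_poles] the fields in the theta-current are bounded up to the poles, so its factor
    sin(theta) makes the flux small. The bound is uniform in the angle [d] but depends on [r2]. *)
Lemma pole_flux_le (A r2 : R) : r0 <= r2 < rI -> exists2 M, 0 <= M &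
  forall d s r ph, 0 < d < pi -> 0 <= s <= t -> r0 <= r <= r2 ->
    `|current_th Rc u v w1 t C A s r d ph| <= M * sin d.
Proof.
move=> r2_in; have /andP[r02 r2I] := r2_in.
have [k0 hk0] := reg_poles reg r2I.
pose k := Num.max 0 k0; have k_ge0 : 0 <= k by rewrite le_max lexx.
have R00 := hyp_pos hyp.
have q0 : 0 <= k + k / Rc r0 by rewrite addr_ge0// divr_ge0// ltW.
(* The factors bound, in order, the weight, R'/R^2, u + z and the theta-component. *)
exists (expR (C * t) * C * ((k + k / Rc r0) * k)).
  by rewrite !mulr_ge0 ?expR_ge0// ltW.
move=> d s r ph dpi sI rJ; have rr := box_slice r2_in rJ.
have x_in : region r0 rI t (s, r, d, ph) by [].
have /andP[rr1 rr2] := rJ.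
have [b1 b2 b3 _] := hk0 s r d ph x_in rr2.
rewrite /= in b1 b2 b3.
have kk : k0 <= k by rewrite le_max lexx orbT.
have sin0 : 0 <= sin d by apply: ltW; exact: sin_gt0_pi.
have Rc0 := Rc_gt0 hyp rr.
have a0 := ltW (dRc_gt0 hyp rr).
have zk : `|zf s r d ph| <= k / Rc r0.
  rewrite normrM normfV (gtr0_norm Rc0).
  apply: ler_pM; [by []|by rewrite invr_ge0 ltW|exact: le_trans kk|].
  by rewrite lef_pV2 ?posrE//; case/andP: rr => ? ?; exact: (Rc_le hyp).
rewrite /current_th normrN normrM -[leRHS]mulrA; apply: ler_pM => //.
  rewrite -mulrA normrM (ger0_norm (weight_ge0 _ _ _)).
  apply: ler_pM => //; first exact: weight_ge0.
    by apply: weight_le; case/andP: sI.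
  rewrite ger0_norm; last by rewrite divr_ge0// sqr_ge0.
  by rewrite ler_pdivrMr ?exprn_gt0//; have [] := bound_dRc rr.
rewrite mulrA normrM (ger0_norm sin0) ler_wpM2r// normrM; apply: ler_pM => //.
  apply: (le_trans (ler_normD _ _)); apply: lerD => //; exact: le_trans kk.
exact: le_trans kk.
Qed.

Lemma small_sin (q e : R) : 0 < q -> 0 < e -> exists2 d, 0 < d <= q & sin d <= e.
Proof.
move=> q0 e0; have /cvgrPdist_lt/(_ e e0)[x /= x0 xP] := @continuous_sin R 0.
exists (Num.min q (x / 2)); first by rewrite lt_min q0 divr_gt0//= ge_min lexx.
set y := Num.min _ _; have y0 : 0 < y by rewrite lt_min q0 divr_gt0.
have : ball 0 x y.
  rewrite /ball/= sub0r normrN gtr0_norm//.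
  apply: (@le_lt_trans _ _ (x / 2)); first by rewrite ge_min lexx orbT.
  by rewrite ltr_pdivrMr// ltr_pMr// ltr1n.
move=> /xP; rewrite sin0 sub0r normrN => h.
exact: le_trans (ler_norm _) (ltW h).
Qed.

Lemma edens_sin_ge0 s r th ph : r0 <= r < rI -> 0 < th < pi ->
  0 <= edens s r th ph * sin th.
Proof.
move=> rr thpi; apply: mulr_ge0; last exact/ltW/sin_gt0_pi.
by apply: energy_density_ge0; [exact: (dRc_gt_half hyp)|exact: (Rc_gt0 hyp)].
Qed.

Lemma damping_density_ge0 s r th ph : r0 <= r < rI -> 0 < th < pi ->
  0 <= damping_density s r th ph.
Proof.
move=> rr thpi; apply: mulr_ge0; last exact/ltW/sin_gt0_pi.
apply: mulr_ge0; last exact: sqr_ge0.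
apply: divr_ge0; last exact/ltW/(Rc_gt0 hyp).
by apply: mulr_ge0 => //; exact/ltW/(dRc_gt0 hyp).
Qed.

Lemma source_density_ge0 s r th ph : r0 <= r < rI -> 0 < th < pi ->
  0 <= source_density s r th ph.
Proof.
move=> rr thpi; apply: mulr_ge0; last exact/ltW/sin_gt0_pi.
apply: mulr_ge0; last exact: sqr_ge0.
apply: mulr_ge0; first exact/ltW/(dRc_gt0 hyp).
by apply: exprn_ge0; exact/ltW/(Rc_gt0 hyp).
Qed.

Lemma box_theta (d1 d2 th : R) : 0 < d1 -> d2 < pi -> d1 <= th <= d2 -> 0 < th < pi.
Proof. by move=> h1 h2 /andP[h3 h4]; rewrite (lt_le_trans h1)// (le_lt_trans h4). Qed.

End TruncatedEstimate.

(** The [x] are left-hand integrals over the small box, the [y] and [q] weighted integrals over the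
    large one, the [g] unweighted data. Half of the error [e] is spent at the poles and half at null
    infinity. *)
Lemma truncation_balance (R : realFieldType)
    (x1 x2 x3 x4 y1 y2 y3 y4 q1 q2 q3 g1 g2 g3 E m e e' c : R) :
  x1 <= y1 -> x2 <= y2 -> x3 - e' * c <= y3 -> x4 <= y4 ->
  y1 + y4 + y2 + 2^-1 * y3 <= q1 + q2 + q3 + 2 * m ->
  q1 <= E * g1 -> q2 <= E * g2 -> q3 <= E * g3 ->
  2 * m <= e / 2 -> e' * c <= e ->
  x1 + x2 + 2^-1 * x3 + x4 <= E * (g1 + g2 + g3) + e.
Proof. by move=> *; lra. Qed.

Section TruncatedEstimate.
Context {R : realType} (n r0 rI : R) (Rc H : R -> R).
Hypothesis hyp : hyperboloidal n r0 rI Rc H.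
Hypothesis n12 : 1 < n <= 2.
Context (p : nat) (F u v w1 w2 : stfun R) (t : R).
Hypothesis t0 : 0 <= t.
Hypothesis reg : regular_fields r0 rI t (Fields u v w1 w2).
Hypothesis sys : ugly_system r0 rI t Rc p F (Fields u v w1 w2).
Local Notation a := (derive1 Rc).
Variable C : R.
Hypothesis C0 : 0 < C.
Hypothesis bound_dRc : forall r, r0 <= r < rI ->
  a r <= C * Rc r ^+ 2 /\ a r <= C * Rc r ^+ 2 * (2 * a r - 1).

Local Notation I := (0 : R, t).
Local Notation L := (0 : R, 2 * pi : R).
Local Notation zf := (zf Rc v).
Local Notation edens := (edens Rc u v w1 w2).
Local Notation damping_density := (damping_density Rc p u v).
Local Notation source_density := (source_density Rc F).

Let L12 : 0 <= 2 * pi :> R. Proof. by rewrite mulr_ge0// pi_ge0. Qed.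

(* The cutoff equals 1 up to the radius [rs] and vanishes from [r2] on, at all
   times in [0, t]. *)
Lemma cutoff_radii (rN e : R) (K : R * R) : r0 <= rN < rI ->
  0 < K.1 -> K.2 < pi -> 0 < e ->
  exists A rs r2, [/\ rN <= rs, rs <= r2, r2 < rI,
    [/\ forall s r, s <= t -> r0 <= r <= rs -> phase Rc A s r <= 0,
        forall s, 0 <= s -> 1 <= phase Rc A s r2 &
        forall s r, s <= t -> r0 <= r <= r2 -> 0 < phase Rc A s r -> 1 <= a r] &
    forall s r th ph, 0 <= s <= t -> r0 <= r <= r2 -> K.1 <= th <= K.2 ->
      0 <= ph <= 2 * pi -> 0 < phase Rc A s r ->
      u s rI th ph ^+ 2 - e <= u s r th ph ^+ 2].
Proof.
move=> /andP[r0N rNI] K1 K2 e0.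
have [r1 /andP[r01 r1I] tail1] := dRc_eventually_ge1 hyp n12.
have [c /andP[r0c cI] cu] := scri_uniform_limit hyp reg K1 K2 e0.
(* Beyond [rs] both R' >= 1 and the lower bound on u^2 by its trace hold, so the cutoff may start to
   decrease there. *)
pose rs := Num.max rN (Num.max r1 c).
have rsI : rs < rI by rewrite !gt_max rNI r1I.
have rNs : rN <= rs by rewrite le_max lexx.
have r1s : r1 <= rs by rewrite !le_max lexx orbT.
have cs : c <= rs by rewrite !le_max lexx !orbT.
have r0s : r0 <= rs := le_trans r0N rNs.
(* With A = R(rs) + t the phase is nonpositive up to [rs] even at the last time; R(r2) >= A + 1
   makes it at least 1 at [r2] already at time 0. *)
have /cvgryPge/(_ (Rc rs + t + 1)) := hyp_infinity hyp.
move=> /(left_nbhs_segment rsI)[r2 /andP[rs2 r2I] r2P].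
have phase0 s r : s <= t -> r0 <= r <= rs -> phase Rc (Rc rs + t) s r <= 0.
  move=> st /andP[rr1 rr2]; rewrite subr_le0 lerD//.
  exact: (Rc_le hyp).
have phase1 s r : s <= t -> r0 <= r <= r2 -> 0 < phase Rc (Rc rs + t) s r -> rs <= r.
  move=> st /andP[rr1 rr2]; have [//|/ltW rrs] := leP rs r.
  by rewrite ltNge phase0// rr1.
exists (Rc rs + t), rs, r2; split => //; first split => //.
- move=> s s0; rewrite /phase; have := r2P r2; rewrite lexx r2I => /(_ isT) h.
  by rewrite lerBrDl (le_trans h)// lerDl.
- move=> s r st rr /(phase1 _ _ st rr) rsr; apply: tail1.
  by rewrite (le_trans r1s)//=; case/andP: rr => _ /le_lt_trans; exact.
- move=> s r th ph /[dup] sI /andP[_ st] rr thK phL /(phase1 _ _ st rr) rsr.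
  apply: cu => //; rewrite (le_trans cs)//=.
  by case/andP: rr => _ /le_lt_trans; exact.
Qed.

(** The choices must be made in this order: the error at null infinity fixes A and [r2], these fix
    the bound [M] of the polar flux, and only then is the polar gap [d] taken small enough. On the
    inner box the weight is at least 1; everywhere it is at most exp (C t). *)
Lemma truncated_estimate (rN k1 k2 e : R) : r0 <= rN < rI -> 0 < k1 -> k1 <= k2 ->
  k2 < pi -> 0 < e ->
  exists r2 d, [/\ r0 <= r2 < rI, 0 < d, d <= pi - d &
    int3 (r0, rN) (k1, k2) L (fun r th ph => edens t r th ph * sin th)
    + int4 I (r0, rN) (k1, k2) L damping_density
    + 2^-1 * int3 I (k1, k2) L (fun s th ph => u s rI th ph ^+ 2 * sin th)
    + 2^-1 * int3 I (k1, k2) L (fun s th ph => zf s r0 th ph ^+ 2 * sin th)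
  <= expR (C * t) *
     (int3 (r0, r2) (d, pi - d) L (fun r th ph => edens 0 r th ph * sin th)
      + 2^-1 * int3 I (d, pi - d) L (fun s th ph => u s r0 th ph ^+ 2 * sin th)
      + int4 I (r0, r2) (d, pi - d) L source_density) + e].
Proof.
move=> rN_in k10 k12 k2pi e0; have /andP[r0N rNI] := rN_in.
pose K' := (k1, k2).
have cS : cont3 I K' L (fun _ th _ => sin th).
  apply: (cont4_slice1 (I := I) (f := fun _ _ th _ => sin th) (x := 0)); last by rewrite /= lexx.
  by apply: cont4_fun3; apply: continuous_subspaceT; exact: continuous_sin.
pose c := int3 I K' L (fun _ th _ => sin th).
have c0 : 0 <= c.
  rewrite /c; apply: int1_ge0 => s _; apply: int1_ge0 => th thK; apply: int1_ge0 => ph _.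
  exact/ltW/sin_gt0_pi/(box_theta k10 k2pi thK).
(* Lowering u^2 by [e'] costs [e' * c <= e] in the integral; the added 1 avoids dividing by 0 when
   [c] vanishes. *)
pose e' := e / (c + 1).
have e'0 : 0 < e' by rewrite divr_gt0// ltr_wpDl.
have e'c : e' * c <= e.
  by rewrite mulrAC ler_pdivrMr ?ltr_wpDl// ler_wpM2l ?lerDl// ltW.
have [A [rs [r2 [rNs rs2 r2I [phs ph2 pha] uI]]]] :=
  cutoff_radii (K := K') rN_in k10 k2pi e'0.
have r0s := le_trans r0N rNs; have r02 := le_trans r0s rs2.
have r2_in : r0 <= r2 < rI by rewrite r02.
have [M M0 HM] := pole_flux_le hyp reg C0 bound_dRc A r2_in.
pose V := M * (2 * pi) * (r2 - r0) * t.
have V0 : 0 <= V by rewrite !mulr_ge0// ?pi_ge0// subr_ge0.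
have q0 : 0 < Num.min k1 (pi - k2) by rewrite lt_min k10 subr_gt0.
(* With sin d below this value the two polar fluxes total at most [2 * V * sin d <= e / 2]; [V] may
   be 0, whence the 1. *)
have e4 : 0 < e / 4 / (V + 1) by rewrite !divr_gt0// ltr_wpDl.
have [d /andP[d0 dq] sind] := small_sin q0 e4.
have dk1 : d <= k1 by apply: (le_trans dq); rewrite ge_min lexx.
have k2d : k2 <= pi - d.
  by rewrite lerBrDl -lerBrDr; apply: (le_trans dq); rewrite ge_min lexx orbT.
have dd : d <= pi - d by rewrite (le_trans dk1)// (le_trans k12).
have pid : pi - d < pi by rewrite ltrBlDr ltrDl.
exists r2, d; split => //.
pose J := (r0, r2); pose K := (d, pi - d); pose J' := (r0, rN).
have dpi : 0 < d < pi by rewrite d0 (le_lt_trans dd).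
have HM' s r ph : 0 <= s <= t -> r0 <= r <= r2 ->
    `|current_th Rc u v w1 t C A s r d ph| <= M * sin d /\
    `|current_th Rc u v w1 t C A s r (pi - d) ph| <= M * sin d.
  move=> sI rJ; split; first exact: HM.
  have -> : sin d = sin (pi - d) by rewrite sinB sinpi cospi; ring.
  by apply: HM => //; rewrite pid andbT (lt_le_trans d0).
have wr2 s : 0 <= s <= t -> weight Rc t C A s r2 = 0.
  by move=> /andP[s0 _]; rewrite /weight cutoff0 ?mulr0// ph2.
have BE := box_energy_inequality hyp t0 reg sys C0 r2_in d0 dd pid bound_dRc
  (fun s r sI => pha s r (andP sI).2) wr2 HM'.
have thK th : d <= th <= pi - d -> 0 < th < pi by exact: box_theta.
have thK' th : k1 <= th <= k2 -> 0 < th < pi by exact: box_theta.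
have rJ' r : r0 <= r <= rN -> r0 <= r <= rs.
  by move=> /andP[-> /le_trans]; exact.
have [c1 _ _ _] := (box_currents_continuous hyp reg C A r2_in d0 pid).1.
have [cd cs co] := box_terms_continuous hyp reg sys C A r2_in d0 pid.
have [ce cdd csd] := box_densities_continuous hyp reg sys r2_in d0 pid.
have [ce' cdd' _] := box_densities_continuous hyp reg sys rN_in k10 k2pi.
have [ci co'] := box_inner_continuous hyp reg C A r2_in d0 pid.
have [cu cz] := box_zf_continuous hyp reg r2_in d0 pid.
have [_ cz'] := box_zf_continuous hyp reg rN_in k10 k2pi.
have sS : cont4 I J K L (fun _ _ th _ => sin th) by exact: box_sin.
have sS' : cont4 I J' K' L (fun _ _ th _ => sin th) by exact: box_sin.
have tI : I.1 <= t <= I.2 by rewrite /= t0 lexx.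
have zI : I.1 <= 0 <= I.2 by rewrite /= t0 lexx.
have r0J : J.1 <= r0 <= J.2 by rewrite /= lexx.
have r0J' : J'.1 <= r0 <= J'.2 by rewrite /= lexx.
have cur0 : cont3 I K L (fun s th ph => u s r0 th ph ^+ 2 * sin th).
  exact: (cont4_slice2 (cont4M (cont4X (n := 2) cu) sS) r0J).
have czr0 : cont3 I K' L (fun s th ph => zf s r0 th ph ^+ 2 * sin th).
  exact: (cont4_slice2 (cont4M (cont4X (n := 2) cz') sS') r0J').
have cuI := scri_trace_continuous hyp reg (K := K') k10 k2pi.
have cuIs : cont3 I K' L (fun s th ph => u s rI th ph ^+ 2 * sin th).
  by apply: withinM => //; exact: withinX.
have wge1 s r : s <= t -> r0 <= r <= rN -> 1 <= weight Rc t C A s r.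
  by move=> st /rJ' rr; apply: weight_ge1 => //; exact: phs.
have P1 : int3 J' K' L (fun r th ph => edens t r th ph * sin th) <=
    int3 J K L (current_t Rc u v w1 w2 t C A t).
  apply: le_int3_sub => //=; [exact: cont4_slice1 ce' tI|exact: cont4_slice1 c1 tI|exact: le_trans rs2| |].
    move=> r th ph rr thI _; have := edens_sin_ge0 hyp u v w1 w2 t ph (box_slice rN_in rr) (thK' _ thI).
    move=> h; rewrite h /= /current_t -mulrA ler_peMl// wge1//.
  move=> r th ph rr thI _; rewrite /current_t -mulrA mulr_ge0 ?weight_ge0//.
  exact: (edens_sin_ge0 hyp u v w1 w2 t ph (box_slice r2_in rr) (thK _ thI)).
have P2 : int4 I J' K' L damping_density <= int4 I J K L (damping Rc p u v t C A).
  apply: le_int4_sub => //=; [exact: le_trans rs2| |].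
    move=> s r th ph /andP[_ st] rr thI _.
    have := damping_density_ge0 hyp p u v s ph (box_slice rN_in rr) (thK' _ thI).
    by move=> h; rewrite h /= /damping ler_peMl// wge1.
  move=> s r th ph _ rr thI _; rewrite /damping mulr_ge0 ?weight_ge0//.
  exact: (damping_density_ge0 hyp p u v s ph (box_slice r2_in rr) (thK _ thI)).
have P3 : int3 I K' L (fun s th ph => u s rI th ph ^+ 2 * sin th) - e' * c <=
    int4 I J K L (outflow Rc u t C A).
  (* The lower bound is available only on the polar range [K'], where the approach to null infinity
     is uniform. As the outflow is nonnegative, passing to the larger range [K] preserves it. *)
  have [_ _ co''] := box_terms_continuous hyp reg sys C A r2_in k10 k2pi.
  have := outflow_ge (K := K') hyp t0 reg sys C0 r2_in k10 k12 k2pi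
    (fun s sI => conj (phs s r0 (andP sI).2 (introT andP (conj (lexx _) r0s)))
      (ph2 s (andP sI).1)) uI.
  have ceS : cont3 I K' L (fun _ th _ => e' * sin th).
    by apply: withinM => //; exact: within_cst.
  have Z := int3Z (I := I) (J := K') (K := L) e' k12 L12 cS.
  have B := int3B (I := I) (J := K') (K := L) k12 L12 cuIs ceS.
  rewrite /c -Z -B => h; apply: le_trans (le_trans _ h) _.
    rewrite le_eqVlt; apply/orP; left; apply/eqP.
    by congr (int3 _ _ _ _); apply/funext => s; apply/funext => th; apply/funext => ph;
      rewrite mulrBl.
  have o0 d1 d2 s r th ph : 0 < d1 -> d2 < pi -> 0 <= s <= t -> r0 <= r <= r2 ->
      d1 <= th <= d2 -> 0 <= outflow Rc u t C A s r th ph.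
    move=> d10 d2pi /andP[_ st] rr thI; apply: mulr_ge0; last first.
      exact/ltW/sin_gt0_pi/(box_theta d10 d2pi thI).
    apply: mulr_ge0; last exact: sqr_ge0.
    apply: mulr_ge0; last exact/ltW/(dRc_gt0 hyp)/(box_slice r2_in rr).
    apply: mulr_ge0; last by rewrite oppr_ge0 dcutoff_le0.
    exact: expR_ge0.
  apply: le_int4_sub => //= [s r th ph sI rr thI _|s r th ph sI rr thI _].
    by rewrite lexx andbT; exact: (o0 k1 k2).
  exact: (o0 d (pi - d)).
have P4 : 2^-1 * int3 I K' L (fun s th ph => zf s r0 th ph ^+ 2 * sin th) <=
    int3 I K L (inner_in r0 Rc v t C A).
  have Z := int3Z (I := I) (J := K') (K := L) 2^-1 k12 L12 czr0.
  rewrite -Z; apply: le_int3_sub => //= [|s th ph sI thI _|s th ph sI thI _].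
  - by apply: withinM => //; exact: within_cst.
  - have sin0 := ltW (sin_gt0_pi (thK' _ thI)).
    have h : 0 <= 2^-1 * (zf s r0 th ph ^+ 2 * sin th).
      by rewrite mulr_ge0// mulr_ge0// sqr_ge0.
    apply/andP; split => //.
    have -> : inner_in r0 Rc v t C A s th ph = weight Rc t C A s r0 *
        (2^-1 * (zf s r0 th ph ^+ 2 * sin th)) by rewrite /inner_in !mulrA.
    by rewrite ler_peMl//; apply: wge1; [case/andP: sI|rewrite lexx].
  - have sin0 := ltW (sin_gt0_pi (thK _ thI)).
    by rewrite /inner_in mulr_ge0// mulr_ge0 ?weight_ge0// mulr_ge0// sqr_ge0.
have Q1 : int3 J K L (current_t Rc u v w1 w2 t C A 0) <= expR (C * t) *
    int3 J K L (fun r th ph => edens 0 r th ph * sin th).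
  have Z := int3Z (I := J) (J := K) (K := L) (expR (C * t)) dd L12 (cont4_slice1 ce zI).
  rewrite -Z; apply: le_int3 => //=.
  - exact: cont4_slice1 c1 zI.
  - by apply: withinM; [exact: within_cst|exact: (cont4_slice1 ce zI)].
  - move=> r th ph rr thI _; rewrite /current_t -mulrA ler_wpM2r ?weight_le//.
    exact: (edens_sin_ge0 hyp u v w1 w2 0 ph (box_slice r2_in rr) (thK _ thI)).
have Q2 : int3 I K L (inner_out r0 Rc u t C A) <= expR (C * t) *
    (2^-1 * int3 I K L (fun s th ph => u s r0 th ph ^+ 2 * sin th)).
  have Z := int3Z (I := I) (J := K) (K := L) (expR (C * t) * 2^-1) dd L12 cur0.
  rewrite mulrA -Z; apply: le_int3 => //=.
  - by apply: withinM; [exact: within_cst|exact: cur0].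
  - move=> s th ph /andP[s0 _] thI _.
    have sin0 := ltW (sin_gt0_pi (thK _ thI)).
    have -> : inner_out r0 Rc u t C A s th ph = weight Rc t C A s r0 *
        (2^-1 * (u s r0 th ph ^+ 2 * sin th)) by rewrite /inner_out !mulrA.
    rewrite -mulrA; apply: ler_wpM2r; last exact: weight_le.
    by rewrite mulr_ge0// mulr_ge0// sqr_ge0.
have Q3 : int4 I J K L (source Rc F t C A) <= expR (C * t) * int4 I J K L source_density.
  have Z := int4Z (I := I) (J := J) (K := K) (L := L) (expR (C * t)) r02 dd L12 csd.
  rewrite -Z; apply: le_int4 => //=.
  - by apply: cont4M; [exact: cont4_cst|exact: csd].
  - move=> s r th ph /andP[s0 _] rr thI _; rewrite /source ler_wpM2r ?weight_le//.
    exact: (source_density_ge0 hyp F s ph (box_slice r2_in rr) (thK _ thI)).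
have Qm : 2 * (M * sin d * (2 * pi) * (r2 - r0) * t) <= e / 2.
  have -> : M * sin d * (2 * pi) * (r2 - r0) * t = V * sin d by rewrite /V; ring.
  apply: (@le_trans _ _ (2 * (V * (e / 4 / (V + 1))))).
    by rewrite ler_pM2l// ler_wpM2l.
  have -> : 2 * (V * (e / 4 / (V + 1))) = V / (V + 1) * (e / 2).
    by field; rewrite gt_eqF// ltr_wpDl.
  apply: ler_piMl; first by rewrite divr_ge0// ltW.
  by rewrite ler_pdivrMr ?ltr_wpDl// mul1r lerDl.
exact: (truncation_balance P1 P2 P3 P4 BE Q1 Q2 Q3 Qm e'c).
Qed.

End TruncatedEstimate.

(** * Exhaustion of the slices and of the region *)

Section IteratedExhaustion.
Context {R : realType}.
Local Notation mu := (@lebesgue_measure R).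
Local Notation L := (0 : R, 2 * pi : R).

(** One integration variable of the exhaustion, with [F N] an inner integral truncated at the same
    stage. The second alternative of the last hypothesis is for the poles, which belong to [A] but
    to no [B N]. *)
Lemma cvg_layer (A : set (measurableTypeR R)) (B : nat -> R * R) (F : nat -> R -> R)
    (G : R -> \bar R) :
  measurable A -> (forall N, seg (B N) `<=` A) ->
  (forall N M, (N <= M)%N -> seg (B N) `<=` seg (B M)) ->
  (forall N, cont1 (B N) (F N)) ->
  (forall N x, seg (B N) x -> 0 <= F N x) ->
  (forall N M x, (N <= M)%N -> seg (B N) x -> F N x <= F M x) ->
  (forall x, A x -> ((exists N0, forall N, (N0 <= N)%N -> seg (B N) x) /\
       (F N x)%:E @[N --> \oo] --> G x) \/
     ((forall N, ~ seg (B N) x) /\ G x = 0%E)) ->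
  (int1 (B N).1 (B N).2 (F N))%:E @[N --> \oo] --> (\int[mu]_(x in A) G x)%E.
Proof.
move=> mA BA Bnd cF F0 Fnd FG.
have -> : (fun N => (int1 (B N).1 (B N).2 (F N))%:E) =
    (fun N => \int[mu]_(x in seg (B N)) (F N x)%:E)%E.
  by apply/funext => N; exact: (esym (EFin_int1 (cF N))).
apply: (@cvg_integral_exhaustion _ _ _ mu A (fun N => seg (B N))
  (fun N x => (F N x)%:E) G mA) => //.
- by move=> N; exact: measurable_itv.
- move=> N; apply/measurable_EFinP.
  by apply: subspace_continuous_measurable_fun; [exact: measurable_itv|exact: cF].
- move=> x Ax; have [[[N0 xB] FGx]|[xB ->]] := FG x Ax.
    apply: cvg_trans FGx; apply: near_eq_cvg; near=> N.
    rewrite /patch mem_set//; apply: xB; near: N; exact: nbhs_infty_ge.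
  apply: cvg_near_cst; near=> N; rewrite /patch; case: ifPn => // /set_mem.
  by move=> /xB.
Unshelve. all: by end_near. Qed.

(** * Compact segments exhausting (0, pi) and [r0, rI) *)

Lemma div_natS_small (c e : R) : 0 <= c -> 0 < e ->
  exists N0, forall N, (N0 <= N)%N -> c / N.+1%:R <= e.
Proof.
move=> c0 e0; have e'0 : 0 < e / (c + 1) by rewrite divr_gt0// ltr_wpDl.
have [N0 _ hN] := near_infty_natSinv_lt (PosNum e'0).
exists N0 => N /hN /= /ltW h; apply: (@le_trans _ _ (c * (e / (c + 1)))).
  by rewrite ler_wpM2l.
rewrite mulrCA; apply: ler_piMr; first exact: ltW.
by rewrite ler_pdivrMr ?ltr_wpDl// mul1r lerDl.
Qed.

(** At [N = 0] the polar segment is the single point pi/2, so no segment is ever empty. *)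
Definition polar_gap (N : nat) : R := (pi / 2) / N.+1%:R.
Definition polar_seg N : R * R := (polar_gap N, pi - polar_gap N).

Lemma polar_gap_gt0 N : 0 < polar_gap N.
Proof. by rewrite !divr_gt0// pi_gt0. Qed.

Lemma polar_gap_le N : polar_gap N <= pi / 2.
Proof.
rewrite ler_pdivrMr//; apply: ler_peMr; last by rewrite ler1n.
by rewrite divr_ge0// pi_ge0.
Qed.

Lemma polar_gap_mono N M : (N <= M)%N -> polar_gap M <= polar_gap N.
Proof.
move=> NM; rewrite ler_wpM2l ?divr_ge0 ?pi_ge0//.
by rewrite lef_pV2 ?posrE// ler_nat.
Qed.

Lemma polar_segW N : (polar_seg N).1 <= (polar_seg N).2.
Proof.
rewrite /= lerBrDr; have := polar_gap_le N; have := polar_gap_le N.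
by move=> h1 h2; apply: (le_trans (lerD h1 h2)); rewrite -splitr.
Qed.

Lemma polar_seg_lt N : (polar_seg N).2 < pi.
Proof. by rewrite /= ltrBlDr ltrDl polar_gap_gt0. Qed.

Lemma polar_seg_mono N M : (N <= M)%N ->
  (polar_seg M).1 <= (polar_seg N).1 /\ (polar_seg N).2 <= (polar_seg M).2.
Proof. by move=> NM; split; [|rewrite lerD2l lerN2]; exact: polar_gap_mono. Qed.

Lemma polar_seg_sub N M : (N <= M)%N -> seg (polar_seg N) `<=` seg (polar_seg M).
Proof.
move=> /polar_seg_mono[h1 h2] x /segP/andP[x1 x2]; apply/segP.
by rewrite (le_trans h1)// (le_trans x2).
Qed.

Lemma polar_seg_open N th : (polar_seg N).1 <= th <= (polar_seg N).2 -> 0 < th < pi.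
Proof.
move=> /andP[h1 h2]; rewrite (lt_le_trans (polar_gap_gt0 N))//=.
exact: le_lt_trans (polar_seg_lt N).
Qed.

Lemma polar_seg_exhaust th : 0 < th < pi ->
  exists N0, forall N, (N0 <= N)%N -> seg (polar_seg N) th.
Proof.
move=> /andP[th0 thpi].
have m0 : 0 < Num.min th (pi - th) by rewrite lt_min th0 subr_gt0.
have [N0 hN] := div_natS_small (divr_ge0 (pi_ge0 R) (ler0n R 2)) m0.
exists N0 => N /hN; rewrite le_min => /andP[h1 h2]; apply/segP.
by rewrite h1/= lerBrDr -lerBrDl.
Qed.

(** At [N = 0] this is the single point [r0]. *)
Definition radial_seg (r0 rI : R) (N : nat) : R * R :=
  (r0, rI - (rI - r0) / N.+1%:R).

Section Radial.
Variables (r0 rI : R).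
Hypothesis r0I : r0 < rI.

Lemma radial_seg_in N : r0 <= (radial_seg r0 rI N).2 < rI.
Proof.
have d0 : 0 < rI - r0 by rewrite subr_gt0.
rewrite /= ltrBlDr ltrDl divr_gt0// andbT lerBrDl -lerBrDr.
by rewrite ler_pdivrMr// ler_peMr ?ler1n// ltW.
Qed.

Lemma radial_seg_mono N M : (N <= M)%N ->
  (radial_seg r0 rI N).2 <= (radial_seg r0 rI M).2.
Proof.
move=> NM; rewrite /= lerD2l lerN2 ler_wpM2l ?subr_ge0 ?(ltW r0I)//.
by rewrite lef_pV2 ?posrE// ler_nat.
Qed.

Lemma radial_seg_sub N M : (N <= M)%N ->
  seg (radial_seg r0 rI N) `<=` seg (radial_seg r0 rI M).
Proof.
move=> /radial_seg_mono h x /segP/andP[x1 x2]; apply/segP.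
by rewrite x1/= (le_trans x2).
Qed.

Lemma radial_seg_exhaust r : r0 <= r < rI ->
  exists N0, forall N, (N0 <= N)%N -> seg (radial_seg r0 rI N) r.
Proof.
move=> /andP[rr0 rrI]; have d0 : 0 < rI - r by rewrite subr_gt0.
have d1 : 0 <= rI - r0 by rewrite subr_ge0 ltW.
have [N0 hN] := div_natS_small d1 d0.
exists N0 => N /hN h; apply/segP; rewrite /= rr0/=.
by rewrite lerBrDr -lerBrDl.
Qed.

End Radial.

Let L12 : L.1 <= L.2. Proof. by rewrite /= mulr_ge0// pi_ge0. Qed.

(** The sphere integrals run over the closed interval [0, pi], and nothing is known of the fields at
    its ends; the factor sin(theta) makes the integrands 0 there. *)
Definition polar_vanishing (g : R -> R -> R) :=
  (forall th ph, 0 < th < pi -> 0 <= g th ph) /\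
  (forall ph, g 0 ph = 0 /\ g pi ph = 0).

Lemma polar_vanishing_ge0 g th ph : polar_vanishing g -> 0 <= th <= pi -> 0 <= g th ph.
Proof.
move=> [g0 gE] /andP[]; have [g1 g2] := gE ph.
rewrite le_eqVlt => /predU1P[<-|th0]; first by rewrite g1.
rewrite le_eqVlt => /predU1P[->|thpi]; first by rewrite g2.
by apply: g0; rewrite th0.
Qed.

Local Open Scope ereal_scope.

Definition sphere_integral (g : R -> R -> R) : \bar R :=
  \int[mu]_(th in `[0%R, pi]) \int[mu]_(ph in `[0%R, (2 * pi)%R]) (g th ph)%:E.

Lemma cvg_sphere_integral g : (forall N, cont2 (polar_seg N) L g) ->
  polar_vanishing g ->
  (int2 (polar_seg N) L g)%:E @[N --> \oo] --> sphere_integral g.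
Proof.
move=> cg g_pos; have [g0 gE] := g_pos.
apply: (cvg_layer (B := polar_seg) (F := fun N th => int1 L.1 L.2 (g th))) => //.
- move=> N th /segP /polar_seg_open /andP[h1 h2] /=; rewrite in_itv/=.
  by rewrite !ltW.
- exact: polar_seg_sub.
- by move=> N; exact: cont2_int.
- move=> N th /segP /polar_seg_open thpi; apply: int1_ge0 => ph _.
  exact: g0.
- move=> th /=; rewrite in_itv/= => /andP[]; rewrite le_eqVlt => /predU1P[<-|th0] thpi.
    right; split.
      by move=> N /segP /polar_seg_open; rewrite ltxx.
    by apply: integral0_eq => ph _; have [-> _] := gE ph.
  move: thpi; rewrite le_eqVlt => /predU1P[->|thpi].
    right; split.
      by move=> N /segP /polar_seg_open; rewrite ltxx andbF.
    by apply: integral0_eq => ph _; have [_ ->] := gE ph.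
  have thp : (0 < th < pi)%R by rewrite th0.
  left; have [N0 hN] := polar_seg_exhaust thp; split; first by exists N0.
  rewrite -(EFin_int1 (a := L.1) (b := L.2)); first exact: cvg_cst.
  by apply: cont2_slice1 (cg N0) _; apply/segP; exact: hN.
Qed.

Lemma sphere_integral_ge0 g : polar_vanishing g -> 0 <= sphere_integral g.
Proof.
move=> gv; apply: integral_ge0 => th /=; rewrite in_itv/= => thpi.
by apply: integral_ge0 => ph _; rewrite lee_fin polar_vanishing_ge0.
Qed.

(** The data terms only have to be bounded by the full integrals, for which inclusion of the domains
    is enough. *)
Lemma int2_le_sphere_integral K g : (0 <= K.1)%R -> (K.2 <= pi)%R ->
  cont2 K L g -> polar_vanishing g -> (int2 K L g)%:E <= sphere_integral g.
Proof.
move=> K1 K2 cg gv; rewrite -EFin_int2//.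
have sub (th : R) : seg K th -> (0 <= th <= pi)%R.
  by move=> /segP/andP[h1 h2]; rewrite (le_trans K1)// (le_trans h2).
apply: le_integral_subset => [th /sub thpi|th /sub thpi|th] /=; rewrite ?in_itv//=.
  apply/andP; split; last exact: lexx.
  by apply: integral_ge0 => ph _; rewrite lee_fin polar_vanishing_ge0.
move=> thpi; apply: integral_ge0 => ph _; by rewrite lee_fin polar_vanishing_ge0.
Qed.

Lemma int2_polar_mono g N M : (N <= M)%N -> (forall N, cont2 (polar_seg N) L g) ->
  polar_vanishing g -> (int2 (polar_seg N) L g <= int2 (polar_seg M) L g)%R.
Proof.
move=> NM cg [g0 _]; have [h1 h2] := polar_seg_mono NM.
apply: le_int2_sub => // [th ph /polar_seg_open thpi _|th ph /polar_seg_open thpi _].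
  by rewrite lexx andbT; exact: g0.
exact: g0.
Qed.

Lemma int2_polar_ge0 g N : polar_vanishing g -> (0 <= int2 (polar_seg N) L g)%R.
Proof.
move=> [g0 _]; apply: int1_ge0 => th /polar_seg_open thpi.
by apply: int1_ge0 => ph _; exact: g0.
Qed.

Lemma cvg_tube_integral (t : R) g : (0 <= t)%R ->
  (forall N, cont3 (0%R, t) (polar_seg N) L g) ->
  (forall s, (0 <= s <= t)%R -> polar_vanishing (g s)) ->
  (int3 (0%R, t) (polar_seg N) L g)%:E @[N --> \oo] -->
    \int[mu]_(s in `[0%R, t]) sphere_integral (g s).
Proof.
move=> t0 cg gv.
have cgs s : (0 <= s <= t)%R -> forall N, cont2 (polar_seg N) L (g s).
  by move=> sI N; exact: cont3_slice1 (cg N) sI.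
apply: (cvg_layer (B := fun _ => (0%R, t))
  (F := fun N s => int2 (polar_seg N) L (g s))) => //.
- by move=> N x.
- by move=> N M _ x.
- by move=> N; exact: (cont3_int2 (polar_segW N) L12 (cg N)).
- by move=> N s /segP sI; apply: int2_polar_ge0; exact: gv.
- by move=> N M s NM /segP sI; apply: int2_polar_mono => //; [exact: cgs|exact: gv].
- move=> s /=; rewrite in_itv/= => sI; left; split.
    by exists 0%N => N _; apply/segP.
  by apply: cvg_sphere_integral; [exact: cgs|exact: gv].
Qed.

Lemma int3_le_tube_integral (t : R) K g : (0 <= K.1)%R -> (K.1 <= K.2)%R ->
  (K.2 <= pi)%R -> cont3 (0%R, t) K L g ->
  (forall s, (0 <= s <= t)%R -> polar_vanishing (g s)) ->
  (int3 (0%R, t) K L g)%:E <= \int[mu]_(s in `[0%R, t]) sphere_integral (g s).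
Proof.
move=> K1 K12 K2 cg gv; rewrite -(EFin_int3 K12 L12 cg).
have gs s : `[0%R, t]%classic s -> 0 <= sphere_integral (g s).
  by rewrite /= in_itv/= => sI; apply: sphere_integral_ge0; exact: gv.
apply: le_integral_subset => // s /segP sI.
rewrite (EFin_int2 L12 (cont3_slice1 cg sI)).
rewrite int2_le_sphere_integral ?andbT//; [|exact: cont3_slice1 cg sI|exact: gv].
rewrite lee_fin; apply: int1_ge0 => th /andP[h1 h2]; apply: int1_ge0 => ph _.
by apply: polar_vanishing_ge0; [exact: gv|rewrite (le_trans K1)// (le_trans h2)].
Qed.

Section Slices.
Variables (r0 rI : R).
Hypothesis r0I : (r0 < rI)%R.
Local Notation radial_seg := (radial_seg r0 rI).

Definition slice_integral (g : R -> R -> R -> R) : \bar R :=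
  \int[mu]_(r in `[r0, rI[) sphere_integral (g r).

Lemma int3_radial_ge0 g N : (forall r, (r0 <= r < rI)%R -> polar_vanishing (g r)) ->
  (0 <= int3 (radial_seg N) (polar_seg N) L g)%R.
Proof.
move=> gv; apply: int1_ge0 => r /andP[h1 h2]; apply: int2_polar_ge0; apply: gv.
by have /andP[_ h] := radial_seg_in r0I N; rewrite h1 (le_lt_trans h2).
Qed.

Lemma radial_in N r : ((radial_seg N).1 <= r <= (radial_seg N).2)%R ->
  (r0 <= r < rI)%R.
Proof.
move=> /andP[h1 h2]; have /andP[_ h] := radial_seg_in r0I N.
by rewrite h1 (le_lt_trans h2).
Qed.

(** Continuity is asked for independent [N] and [M]: at a fixed radius, in some radial segment, the
    inner convergence involves all polar segments. *)
Lemma cvg_slice_integral g :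
  (forall N M, cont3 (radial_seg M) (polar_seg N) L g) ->
  (forall r, (r0 <= r < rI)%R -> polar_vanishing (g r)) ->
  (int3 (radial_seg N) (polar_seg N) L g)%:E @[N --> \oo] --> slice_integral g.
Proof.
move=> cg gv.
have cgr r : (r0 <= r < rI)%R -> forall N, cont2 (polar_seg N) L (g r).
  move=> rr N; have [M hM] := radial_seg_exhaust r0I rr.
  by apply: cont3_slice1 (cg N M) _; apply/segP; exact: hM.
apply: (cvg_layer (B := radial_seg)
  (F := fun N r => int2 (polar_seg N) L (g r))) => //.
- by move=> N r /segP /radial_in; rewrite /= in_itv.
- exact: radial_seg_sub.
- by move=> N; exact: (cont3_int2 (polar_segW N) L12 (cg N N)).
- by move=> N r /segP /radial_in rr; apply: int2_polar_ge0; exact: gv.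
- by move=> N M r NM /segP /radial_in rr; apply: int2_polar_mono => //; [exact: cgr|exact: gv].
- move=> r /=; rewrite in_itv/= => rr; left; split; first exact: radial_seg_exhaust.
  by apply: cvg_sphere_integral; [exact: cgr|exact: gv].
Qed.

Lemma slice_integral_ge0 g : (forall r, (r0 <= r < rI)%R -> polar_vanishing (g r)) ->
  0 <= slice_integral g.
Proof.
move=> gv; apply: integral_ge0 => r /=; rewrite in_itv/= => rr.
by apply: sphere_integral_ge0; exact: gv.
Qed.

Lemma int3_le_slice_integral J K g : (r0 <= J.1)%R -> (J.2 < rI)%R -> (0 <= K.1)%R ->
  (K.1 <= K.2)%R -> (K.2 <= pi)%R -> cont3 J K L g ->
  (forall r, (r0 <= r < rI)%R -> polar_vanishing (g r)) ->
  (int3 J K L g)%:E <= slice_integral g.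
Proof.
move=> J1 J2 K1 K12 K2 cg gv; rewrite -(EFin_int3 K12 L12 cg).
have sub (r : R) : seg J r -> (r0 <= r < rI)%R.
  by move=> /segP/andP[h1 h2]; rewrite (le_trans J1)// (le_lt_trans h2).
apply: le_integral_subset => [r /sub|r /[dup] /sub rr /segP rJ|r] /=; rewrite ?in_itv//=.
  rewrite (EFin_int2 L12 (cont3_slice1 cg rJ)).
  rewrite int2_le_sphere_integral ?andbT//; [|exact: cont3_slice1 cg rJ|exact: gv].
  rewrite lee_fin; apply: int1_ge0 => th /andP[h1 h2]; apply: int1_ge0 => ph _.
  by apply: polar_vanishing_ge0; [exact: gv|rewrite (le_trans K1)// (le_trans h2)].
by move=> rr; apply: sphere_integral_ge0; exact: gv.
Qed.

Lemma cvg_region_integral (t : R) g : (0 <= t)%R ->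
  (forall N M, cont4 (0%R, t) (radial_seg M) (polar_seg N) L g) ->
  (forall s r, (0 <= s <= t)%R -> (r0 <= r < rI)%R -> polar_vanishing (g s r)) ->
  (int4 (0%R, t) (radial_seg N) (polar_seg N) L g)%:E @[N --> \oo] -->
    \int[mu]_(s in `[0%R, t]) slice_integral (g s).
Proof.
move=> t0 cg gv.
have cgs s : (0 <= s <= t)%R -> forall N M, cont3 (radial_seg M) (polar_seg N) L (g s).
  by move=> sI N M; exact: cont4_slice1 (cg N M) sI.
have rW N : ((radial_seg N).1 <= (radial_seg N).2)%R.
  by have /andP[] := radial_seg_in r0I N.
apply: (cvg_layer (B := fun _ => (0%R, t))
  (F := fun N s => int3 (radial_seg N) (polar_seg N) L (g s))).
- exact: measurable_itv.
- by move=> N x.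
- by move=> N M _ x.
- by move=> N; exact: (cont4_int3 (rW N) (polar_segW N) L12 (cg N N)).
- by move=> N s /segP sI; apply: int3_radial_ge0 => r rr; exact: gv.
- move=> N M s NM /segP sI; have [h1 h2] := polar_seg_mono NM.
  apply: le_int3_sub => //; [exact: polar_segW|exact: polar_segW|exact: cgs|exact: cgs
    |exact: radial_seg_mono|..].
    move=> r th ph /radial_in rr /polar_seg_open thpi _; rewrite lexx andbT.
    exact: (gv s r sI rr).1.
  move=> r th ph /radial_in rr /polar_seg_open thpi _; exact: (gv s r sI rr).1.
- move=> s /=; rewrite in_itv/= => sI; left; split.
    by exists 0%N => N _; apply/segP.
  by apply: cvg_slice_integral; [exact: cgs|move=> r rr; exact: gv].
Qed.

Lemma int4_le_region_integral (t : R) J K g : (r0 <= J.1)%R -> (J.1 <= J.2)%R ->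
  (J.2 < rI)%R -> (0 <= K.1)%R -> (K.1 <= K.2)%R -> (K.2 <= pi)%R ->
  cont4 (0%R, t) J K L g ->
  (forall s r, (0 <= s <= t)%R -> (r0 <= r < rI)%R -> polar_vanishing (g s r)) ->
  (int4 (0%R, t) J K L g)%:E <= \int[mu]_(s in `[0%R, t]) slice_integral (g s).
Proof.
move=> J1 J12 J2 K1 K12 K2 cg gv; rewrite -(EFin_int4 J12 K12 L12 cg).
have gs s : `[0%R, t]%classic s -> 0 <= slice_integral (g s).
  rewrite /= in_itv/= => sI; apply: slice_integral_ge0 => r rr; exact: gv.
apply: le_integral_subset => // s /segP sI.
rewrite (EFin_int3 K12 L12 (cont4_slice1 cg sI)).
rewrite int3_le_slice_integral ?andbT//; last 2 first.
- exact: cont4_slice1 cg sI.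
- by move=> r rr; exact: gv.
rewrite lee_fin; apply: int1_ge0 => r /andP[q1 q2]; apply: int1_ge0 => th /andP[h1 h2].
apply: int1_ge0 => ph _; apply: polar_vanishing_ge0.
  by apply: gv => //; rewrite (le_trans J1)// (le_lt_trans q2).
by rewrite (le_trans K1)// (le_trans h2).
Qed.

End Slices.
End IteratedExhaustion.

(** * The energy estimate *)

Section EnergyIntegrals.
Context {R : realType} (n r0 rI : R) (Rc H : R -> R).
Hypothesis hyp : hyperboloidal n r0 rI Rc H.
Context (p : nat) (F u v w1 w2 : stfun R).
Local Notation a := (derive1 Rc).

(** Equalities of integrands containing sin(theta) need to be checked only off the poles, where
    [field] may divide by it. *)
Lemma sin0_mul (S x y : R) : (S != 0 -> x = y) -> x * S = y * S.
Proof. by have [->|S0 xy] := eqVneq S 0; [rewrite !mulr0|rewrite xy]. Qed.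

Lemma energy2E t : energy2 r0 rI Rc (Fields u v w1 w2) t =
  slice_integral r0 rI (fun r th ph => edens Rc u v w1 w2 t r th ph * sin th).
Proof.
apply: eq_integral => r; rewrite inE/= in_itv/= => rr.
have Rn0 := lt0r_neq0 (Rc_gt0 hyp rr); have an0 := lt0r_neq0 (dRc_gt0 hyp rr).
apply: eq_integral => th _; apply: eq_integral => ph _; congr (_%:E).
apply: sin0_mul => S0; rewrite /edens /energy_density.
by field; rewrite an0 Rn0 S0.
Qed.

Lemma damping_integralE t :
  int_region r0 rI Rc t (fun s r th ph =>
    p%:R / Rc r ^+ 3 * (u s r th ph + v s r th ph / Rc r) ^+ 2) =
  (\int[@lebesgue_measure R]_(s in `[0%R, t])
    slice_integral r0 rI (damping_density Rc p u v s))%E.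
Proof.
apply: eq_integral => s _; apply: eq_integral => r; rewrite inE/= in_itv/= => rr.
have Rn0 := lt0r_neq0 (Rc_gt0 hyp rr).
apply: eq_integral => th _; apply: eq_integral => ph _; congr (_%:E).
congr (_ * _); rewrite /zf; move: (u s r th ph) (v s r th ph) => U V.
by field.
Qed.

Lemma source_integralE t :
  int_region r0 rI Rc t (fun s r th ph => Rc r ^+ 2 * F s r th ph ^+ 2) =
  (\int[@lebesgue_measure R]_(s in `[0%R, t])
    slice_integral r0 rI (source_density Rc F s))%E.
Proof.
apply: eq_integral => s _; apply: eq_integral => r _.
apply: eq_integral => th _; apply: eq_integral => ph _; congr (_%:E).
by congr (_ * _); ring.
Qed.

Lemma outgoing_integralE r t :
  int_tube r t (fun s r th ph => u s r th ph ^+ 2) =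
  (\int[@lebesgue_measure R]_(s in `[0%R, t])
    sphere_integral (fun th ph => u s r th ph ^+ 2 * sin th)%R)%E.
Proof. reflexivity. Qed.

Lemma ingoing_integralE t :
  int_tube r0 t (fun s r th ph => v s r th ph ^+ 2 / Rc r ^+ 2) =
  (\int[@lebesgue_measure R]_(s in `[0%R, t])
    sphere_integral (fun th ph => zf Rc v s r0 th ph ^+ 2 * sin th)%R)%E.
Proof.
apply: eq_integral => s _; apply: eq_integral => th _; apply: eq_integral => ph _.
by rewrite /zf expr_div_n.
Qed.

Lemma polar_vanishing_sin (g : R -> R -> R) :
  (forall th ph, 0 < th < pi -> 0 <= g th ph * sin th) ->
  polar_vanishing (fun th ph => g th ph * sin th).
Proof. by move=> g0; split => // ph; rewrite sin0 sinpi !mulr0. Qed.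

Lemma polar_vanishing_sqr (g : R -> R -> R) :
  polar_vanishing (fun th ph => g th ph ^+ 2 * sin th).
Proof.
apply: polar_vanishing_sin => th ph thpi.
by rewrite mulr_ge0 ?sqr_ge0//; exact/ltW/sin_gt0_pi.
Qed.

End EnergyIntegrals.

(** If the right side is +oo, the claim holds since [c > 0]. Otherwise it is a real number [b], and
    the truncated bounds pass to the limit; nonnegativity keeps the extended sums well defined. *)
Lemma limit_estimate (R : realType) (X1 X2 X3 X4 : nat -> R)
    (E1 D UI Z E0 U0 S : \bar R) (c : R) :
  (X1 N)%:E @[N --> \oo] --> E1 -> (X2 N)%:E @[N --> \oo] --> D ->
  (X3 N)%:E @[N --> \oo] --> UI -> (X4 N)%:E @[N --> \oo] --> Z ->
  (0 <= E1)%E -> (0 <= D)%E -> (0 <= UI)%E -> (0 <= Z)%E ->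
  (0 <= E0)%E -> (0 <= U0)%E -> (0 <= S)%E -> 0 < c ->
  (forall b, (E0 + (2^-1)%:E * U0 + S)%E = b%:E ->
    forall N, X1 N + X2 N + 2^-1 * X3 N + 2^-1 * X4 N <= c * b) ->
  (E1 + D + (2^-1)%:E * UI + (2^-1)%:E * Z <= (E0 + (2^-1)%:E * U0 + S) * c%:E)%E.
Proof.
move=> C1 C2 C3 C4 E1_0 D_0 UI_0 Z_0 E0_0 U0_0 S_0 c0 bound.
have half0 : (0 <= (2^-1)%:E :> \bar R)%E by rewrite lee_fin.
have [->|fin] := eqVneq (E0 + (2^-1)%:E * U0 + S)%E +oo%E.
  by rewrite gt0_mulye ?leey// lte_fin.
have rhs0 : (0 <= E0 + (2^-1)%:E * U0 + S)%E.
  by apply: adde_ge0 => //; apply: adde_ge0 => //; exact: mule_ge0.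
have bE : (E0 + (2^-1)%:E * U0 + S)%E = (fine (E0 + (2^-1)%:E * U0 + S))%:E.
  by rewrite fineK// ge0_fin_numE// lt_neqAle fin leey.
have {}bound := bound _ bE; rewrite bE -EFinM mulrC.
have halfC (X : nat -> R) (l : \bar R) : (X N)%:E @[N --> \oo] --> l ->
    ((2^-1)%:E * (X N)%:E)%E @[N --> \oo] --> ((2^-1)%:E * l)%E.
  by move=> cX; apply: cvgeZl.
have CC : ((X1 N)%:E + (X2 N)%:E + (2^-1)%:E * (X3 N)%:E
    + (2^-1)%:E * (X4 N)%:E)%E @[N --> \oo] -->
    (E1 + D + (2^-1)%:E * UI + (2^-1)%:E * Z)%E.
  apply: cvgeD; last exact: halfC.
    by rewrite ge0_adde_def// inE ?adde_ge0// mule_ge0.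
  apply: cvgeD; last exact: halfC.
    by rewrite ge0_adde_def// inE ?adde_ge0// mule_ge0.
  by apply: cvgeD => //; rewrite ge0_adde_def// inE.
apply: (cvge_to_le CC); apply: nearW => N.
by rewrite -!EFinM -!EFinD lee_fin bound.
Qed.

Theorem mainTheorem3 (R : realType) (n r0 rI : R) (Rc H : R -> R)
    (hn : 1 < n <= 2) (hcoord : hyperboloidal n r0 rI Rc H) (p : nat) :
  exists2 C : R, 0 < C &
  forall (F : stfun R) (Phi : fields R) (t : R), 0 <= t ->
    bigO_Rm3 rI t Rc F ->
    regular_fields r0 rI t Phi ->
    ugly_system r0 rI t Rc p F Phi ->
    (energy2 r0 rI Rc Phi t
     + int_region r0 rI Rc t (fun s r th ph =>
         p%:R / Rc r ^+ 3
           * (Phi_psib Phi s r th ph + Phi_psi Phi s r th ph / Rc r) ^+ 2)%R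
     + (2^-1)%:E * int_tube rI t (fun s r th ph => Phi_psib Phi s r th ph ^+ 2)%R
     + (2^-1)%:E * int_tube r0 t (fun s r th ph =>
         Phi_psi Phi s r th ph ^+ 2 / Rc r ^+ 2)%R
     <= (energy2 r0 rI Rc Phi 0
         + (2^-1)%:E * int_tube r0 t (fun s r th ph =>
             Phi_psib Phi s r th ph ^+ 2)%R
         + int_region r0 rI Rc t (fun s r th ph =>
             Rc r ^+ 2 * F s r th ph ^+ 2)%R)
        * (expR (C * t))%:E)%E.
Proof.
(* [C] depends on R(r) alone and is fixed before the source, the solution and the time. *)
have [C C0 bound_dRc] := dRc_quadratic_bound hcoord hn.
exists C => // F [u v w1 w2] t t0 _ reg sys /=.
have r0I := hyp_lt hcoord.
pose I := (0 : R, t); pose L := (0 : R, 2 * pi : R).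
have L12 : L.1 <= L.2 by rewrite /= mulr_ge0// pi_ge0.
rewrite !(energy2E hcoord) (damping_integralE hcoord) source_integralE ingoing_integralE.
rewrite !outgoing_integralE.
pose eden s r th ph := edens Rc u v w1 w2 s r th ph * sin th.
have ev s r : r0 <= r < rI -> polar_vanishing (eden s r).
  by move=> rr; apply: polar_vanishing_sin => th ph; exact: (edens_sin_ge0 hcoord).
have dv s r : r0 <= r < rI -> polar_vanishing (damping_density Rc p u v s r).
  by move=> rr; apply: polar_vanishing_sin => th ph; exact: (damping_density_ge0 hcoord).
have sv s r : r0 <= r < rI -> polar_vanishing (source_density Rc F s r).
  by move=> rr; apply: polar_vanishing_sin => th ph; exact: (source_density_ge0 hcoord).
have zv s := polar_vanishing_sqr (zf Rc v s r0).
have uv (r s : R) : polar_vanishing (fun th ph => u s r th ph ^+ 2 * sin th) :=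
  polar_vanishing_sqr (u s r).
pose E1 := slice_integral r0 rI (fun r th ph => edens Rc u v w1 w2 t r th ph * sin th).
pose E0 := slice_integral r0 rI (fun r th ph => edens Rc u v w1 w2 0 r th ph * sin th).
pose D := (\int[@lebesgue_measure R]_(s in `[0%R, t]) slice_integral r0 rI (damping_density Rc p u v s))%E.
pose S := (\int[@lebesgue_measure R]_(s in `[0%R, t]) slice_integral r0 rI (source_density Rc F s))%E.
pose Z := (\int[@lebesgue_measure R]_(s in `[0%R, t]) sphere_integral (fun th ph => zf Rc v s r0 th ph ^+ 2 * sin th)%R)%E.
pose UI := (\int[@lebesgue_measure R]_(s in `[0%R, t]) sphere_integral (fun th ph => u s rI th ph ^+ 2 * sin th)%R)%E.
pose U0 := (\int[@lebesgue_measure R]_(s in `[0%R, t]) sphere_integral (fun th ph => u s r0 th ph ^+ 2 * sin th)%R)%E.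
have slice0 g : (forall s r, r0 <= r < rI -> polar_vanishing (g s r)) ->
    (0 <= \int[@lebesgue_measure R]_(s in `[0%R, t]) slice_integral r0 rI (g s))%E.
  move=> gv; apply: integral_ge0 => s _; apply: slice_integral_ge0 => r rr; exact: gv.
have tube0 g : (forall s, polar_vanishing (g s)) ->
    (0 <= \int[@lebesgue_measure R]_(s in `[0%R, t]) sphere_integral (g s))%E.
  by move=> gv; apply: integral_ge0 => s _; exact: sphere_integral_ge0.
have E1_0 : (0 <= E1)%E by apply: slice_integral_ge0 => r; exact: ev.
have E0_0 : (0 <= E0)%E by apply: slice_integral_ge0 => r; exact: ev.
have D_0 : (0 <= D)%E by exact: slice0.
have S_0 : (0 <= S)%E by exact: slice0.
have Z_0 : (0 <= Z)%E by exact: tube0.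
have UI_0 : (0 <= UI)%E by exact: tube0.
have U0_0 : (0 <= U0)%E by exact: tube0.
pose J N := radial_seg r0 rI N; pose K N := @polar_seg R N.
have Jin N : r0 <= (J N).2 < rI by exact: radial_seg_in.
have K1 N : 0 < (K N).1 by exact: polar_gap_gt0.
have K2 N : (K N).2 < pi by exact: polar_seg_lt.
have tI : I.1 <= t <= I.2 by rewrite /= t0 lexx.
have zI : I.1 <= 0 <= I.2 by rewrite /= t0 lexx.
have cdens N M : [/\ cont4 I (J M) (K N) L eden,
    cont4 I (J M) (K N) L (damping_density Rc p u v)
    & cont4 I (J M) (K N) L (source_density Rc F)].
  exact: (box_densities_continuous hcoord reg sys (Jin M) (K1 N) (K2 N)).
have cface r2 d1 d2 : r0 <= r2 < rI -> 0 < d1 -> d2 < pi ->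
    cont3 I (d1, d2) L (fun s th ph => u s r0 th ph ^+ 2 * sin th) /\
    cont3 I (d1, d2) L (fun s th ph => zf Rc v s r0 th ph ^+ 2 * sin th).
  move=> r2_in d10 d2pi; have [cu cz] := box_zf_continuous hcoord reg r2_in d10 d2pi.
  have cs : cont4 I (r0, r2) (d1, d2) L (fun _ _ th _ => sin th) by exact: box_sin.
  have r0J : (r0, r2).1 <= r0 <= (r0, r2).2 by rewrite /= lexx; case/andP: r2_in.
  split; [exact: (cont4_slice2 (cont4M (cont4X (n := 2) cu) cs) r0J)
    |exact: (cont4_slice2 (cont4M (cont4X (n := 2) cz) cs) r0J)].
have cscri N : cont3 I (K N) L (fun s th ph => u s rI th ph ^+ 2 * sin th).
  have cuI := scri_trace_continuous hcoord reg (K1 N) (K2 N).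
  apply: withinM; first exact: withinX cuI.
  apply: (cont4_slice1 (I := I) (J := I) (K := K N) (L := L)
    (f := fun _ _ th _ => sin th) (x := 0)); last by rewrite /= lexx.
  by apply: cont4_fun3; apply: continuous_subspaceT; exact: continuous_sin.
pose X1 N := int3 (J N) (K N) L (eden t).
pose X2 N := int4 I (J N) (K N) L (damping_density Rc p u v).
pose X3 N := int3 I (K N) L (fun s th ph => u s rI th ph ^+ 2 * sin th).
pose X4 N := int3 I (K N) L (fun s th ph => zf Rc v s r0 th ph ^+ 2 * sin th).
have C1 : (X1 N)%:E @[N --> \oo] --> E1.
  apply: cvg_slice_integral => // [N M|r rr]; last exact: ev.
  by have [c _ _] := cdens N M; exact: cont4_slice1 c tI.
have C2 : (X2 N)%:E @[N --> \oo] --> D.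
  apply: cvg_region_integral => // [N M|s r _ rr]; last exact: dv.
  by have [_ c _] := cdens N M.
have C3 : (X3 N)%:E @[N --> \oo] --> UI.
  by apply: cvg_tube_integral => // s _; exact: uv.
have C4 : (X4 N)%:E @[N --> \oo] --> Z.
  apply: cvg_tube_integral => // N.
  by have [_ c] := cface _ _ _ (Jin N) (K1 N) (K2 N).
apply: (limit_estimate C1 C2 C3 C4 E1_0 D_0 UI_0 Z_0 E0_0 U0_0 S_0 (expR_gt0 _)).
move=> b bE N.
(* The inner box [N] stays fixed while [e] tends to 0. The outer box depends on [e], but its data
   integrals never exceed the full ones, which sum to [b]. *)
apply/ler_addgt0Pr => e e0.
  have [r2 [d [r2_in d0 dd /le_trans]]] := truncated_estimate hcoord hn t0 reg sys C0
    bound_dRc (Jin N) (K1 N) (polar_segW N) (K2 N) e0.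
  apply; rewrite lerD2r ler_pM2l ?expR_gt0// -lee_fin -bE !EFinD EFinM.
  have pid : pi - d < pi by rewrite ltrBlDr ltrDl.
  have /andP[r02 r2I] := r2_in.
  have [c1 _ c3] := box_densities_continuous hcoord reg sys r2_in d0 pid.
  have [c2 _] := cface _ _ _ r2_in d0 pid.
  apply: leeD; first apply: leeD.
  - exact: (int3_le_slice_integral (J := (r0, r2)) (K := (d, pi - d)) (lexx r0) r2I
      (ltW d0) dd (ltW pid) (cont4_slice1 c1 zI) (ev 0)).
  - apply: lee_wpmul2l; first by rewrite lee_fin.
    exact: (int3_le_tube_integral (K := (d, pi - d)) (ltW d0) dd (ltW pid) c2
      (fun s _ => uv r0 s)).
  - exact: (int4_le_region_integral (J := (r0, r2)) (K := (d, pi - d)) (lexx r0) r02 r2I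
      (ltW d0) dd (ltW pid) c3 (fun s r _ rr => sv s r rr)).
Qed.
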